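(* Let $n\ge 2$ and let $M=([2n],B)$ be an $S_{2n}$-matroid (ordinary matroid) of rank $2$ with set of bases $B$ and thin Schubert cell $G_M\subset G(2,2n)$. If $G_M\cap\mathcal H\neq\emptyset$, then there is a fibration $$T_M\to (G_M\cap\mathcal H)\to \mathcal G_{M,\mathcal H},$$ where $\mathcal G_{M,\mathcal H}=(G_M\cap\mathcal H)/T_M$, satisfying $$\dim\mathcal G_{M,\mathcal H}=\begin{cases}\dim\mathcal G_M+\dim T'_M-\dim T_M,&\text{if } B \text{ contains no pair } \{i,i^*\},\\ \dim\mathcal G_M-1+\dim T'_M-\dim T_M,&\text{if } B \text{ contains at least } 2 \text{ pairs } \{i,i^*\}.\end{cases}$$
   Context: Work over $\mathbb C$, $n\ge2$. For $1\le i\le 2n$ put $i^*=2n+1-i$, so $i^{**}=i$. $G(2,2n)$ is the Grassmannian of $2$-dimensional subspaces of $\mathbb C^{2n}$, embedded by Plücker coordinates $[x_{i,j}]$, $\{i,j\}\in\binom{[2n]}{2}$, in $\mathbb P^N$, $N=\binom{2n}{2}-1$. Let $\mathcal H=\{s=0\}\subset\mathbb P^N$ with $s=\sum_{i=1}^n x_{i,i^*}$; then $G(2,2n)\cap\mathcal H=\mathrm{SpG}(2,2n)$ is the symplectic Grassmannian of isotropic $2$-planes. $T'=(\mathbb C^* )^{2n}$ is the torus of invertible diagonal matrices acting on $G(2,2n)$ by $\mathrm{diag}(\lambda_i)\cdot[x_{i,j}]=[\lambda_i\lambda_jx_{i,j}]$, and $T\subset T'$ is the $n$-dimensional subtorus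 of matrices $\mathrm{diag}(\mu_1,\dots,\mu_n,\mu_n^{-1},\dots,\mu_1^{-1})$; $T$ preserves $\mathrm{SpG}(2,2n)$. For a rank $2$ matroid $M=([2n],B)$, the thin Schubert cell is $G_M=\{x\in G(2,2n): \{\{i,j\}:x_{i,j}\ne0\}=B\}$. The stabilizer in $T'$ of a point of $G_M$ depends only on $M$ and is denoted $\mathrm{Stab}_{T'}(M)$; put $\mathrm{Stab}_T(M)=\mathrm{Stab}_{T'}(M)\cap T$, $T'_M=T'/\mathrm{Stab}_{T'}(M)$, $T_M=T/\mathrm{Stab}_T(M)$, and $\mathcal G_M=G_M/T'_M$. $\mathcal G_{M,\mathcal H}$ denotes the categorical quotient of $G_M\cap\mathcal H$ by $T_M$ (which acts freely). *)

(* Defs.v *)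
From HB Require Import structures.
From mathcomp Require Import all_boot all_order all_algebra.
From mathcomp Require Import generic_quotient.
From mathcomp Require Import boolp classical_sets topology.
From mathcomp Require Import mpoly.

Set Implicit Arguments.
Unset Strict Implicit.
Unset Printing Implicit Defensive.

Import GRing.Theory.
Local Open Scope classical_set_scope.
Local Open Scope ring_scope.
Local Open Scope quotient_scope.

Record matroid (E : finType) := Matroid {
  bases : {set {set E}};
  bases_nonempty : (exists b, b \in bases);
  bases_exchange : (forall b1 b2, b1 \in bases -> b2 \in bases ->
       forall x, x \in b1 :\: b2 ->
       exists2 y, y \in b2 :\: b1 & y |: (b1 :\ x) \in bases)%SET
}.

Definition has_rank (E : finType) (M : matroid E) (r : nat) :=
  forall b, b \in bases M -> #|b| = r.

Definition irreducible (X : topologicalType) (Z : set X) :=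
  Z !=set0 /\ forall F G : set X, closed F -> closed G ->
    Z `<=` F `|` G -> Z `<=` F \/ Z `<=` G.

Definition irreducible_chain (X : topologicalType) (d : nat)
    (Z : nat -> set X) :=
  (forall i, (i <= d)%N -> closed (Z i) /\ irreducible (Z i)) /\
  (forall i, (i < d)%N -> Z i `<` Z i.+1).

Definition has_dim (X : topologicalType) (d : nat) :=
  (exists Z : nat -> set X, irreducible_chain d Z) /\
  (forall e (Z : nat -> set X), irreducible_chain e Z -> (e <= d)%N).

(* Spaces with functions: topological spaces with a sheaf of K-valued
   functions.  [regular U f] only depends on the values of [f] on [U], and is
   only meaningful for [U] open. *)

HB.mixin Record isFunSpace (K : fieldType) T of Topological T := {
  regular : set T -> set (T -> K);
  regular_eq : forall (U : set T) (f g : T -> K),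
    open U -> (forall x, U x -> f x = g x) -> regular U f -> regular U g;
  regular_cst : forall (U : set T) c, open U -> regular U (fun=> c);
  regularD : forall (U : set T) f g, open U -> regular U f -> regular U g ->
    regular U (fun x => f x + g x);
  regularM : forall (U : set T) f g, open U -> regular U f -> regular U g ->
    regular U (fun x => f x * g x);
  regularV : forall (U : set T) f, open U -> regular U f ->
    open (U `&` [set x | f x != 0]) /\
    regular (U `&` [set x | f x != 0]) (fun x => (f x)^-1);
  regular_sub : forall (U V : set T) f, open U -> open V -> V `<=` U ->
    regular U f -> regular V f;
  regular_glue : forall (U : set T) f, open U ->
    (forall x, U x -> exists V : set T,
       [/\ open V, V x, V `<=` U & regular V f]) ->
    regular U f
}.

#[short(type="funSpaceType")]
HB.structure Definition FunSpace (K : fieldType) :=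
  {T of Topological T & isFunSpace K T}.

Lemma open_local (X : topologicalType) (U : set X) :
  (forall x, U x -> exists V : set X, [/\ open V, V x & V `<=` U]) -> open U.
Proof.
move=> H; rewrite openE => x /H [V [oV Vx sVU]].
by rewrite /interior nbhsE; exists V.
Qed.

Section Morphisms.
Variable K : fieldType.

Definition morphism (X Y : funSpaceType K) (f : X -> Y) :=
  continuous f /\ forall (V : set Y) (h : Y -> K), open V ->
    regular V h -> regular (f @^-1` V) (h \o f).

Definition isomorphism (X Y : funSpaceType K) (f : X -> Y) :=
  morphism f /\ exists g : Y -> X, [/\ morphism g, cancel f g & cancel g f].

Definition isomorphic (X Y : funSpaceType K) :=
  exists f : X -> Y, isomorphism f.

End Morphisms.

Section Subspace.
Variables (K : fieldType) (X : funSpaceType K) (A : set X).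

Definition sub_regular (U : set A) : set (A -> K) := [set f |
  forall x, U x -> exists (V : set X) (g : X -> K),
    [/\ open V, V (val x), regular V g &
        forall y, U y -> V (val y) -> f y = g (val y)]].

Lemma sub_openP (U : set A) :
  open U <-> exists2 V : set X, open V & val @^-1` V = U.
Proof. by []. Qed.

Fact sub_regular_eq U f g :
  open U -> (forall x, U x -> f x = g x) -> sub_regular U f -> sub_regular U g.
Proof.
move=> _ fg rf x Ux; have [V [h [oV Vx rh fh]]] := rf x Ux.
by exists V, h; split=> // y Uy Vy; rewrite -fg// fh.
Qed.

Fact sub_regular_cst U c : open U -> sub_regular U (fun=> c).
Proof.
move=> _ x Ux; exists setT, (fun=> c); split=> //; first exact: openT.
by apply: regular_cst; exact: openT.
Qed.

Fact sub_regularD U f g : open U -> sub_regular U f -> sub_regular U g ->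
  sub_regular U (fun x => f x + g x).
Proof.
move=> _ rf rg x Ux.
have [V [h [oV Vx rh fh]]] := rf x Ux; have [W [k [oW Wx rk gk]]] := rg x Ux.
have oVW : open (V `&` W) by exact: openI.
exists (V `&` W), (fun x => h x + k x); split=> //.
  by apply: regularD => //; [apply: regular_sub rh|apply: regular_sub rk] =>
    // ? [].
by move=> y Uy [Vy Wy]; rewrite fh// gk.
Qed.

Fact sub_regularM U f g : open U -> sub_regular U f -> sub_regular U g ->
  sub_regular U (fun x => f x * g x).
Proof.
move=> _ rf rg x Ux.
have [V [h [oV Vx rh fh]]] := rf x Ux; have [W [k [oW Wx rk gk]]] := rg x Ux.
have oVW : open (V `&` W) by exact: openI.
exists (V `&` W), (fun x => h x * k x); split=> //.
  by apply: regularM => //; [apply: regular_sub rh|apply: regular_sub rk] =>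
    // ? [].
by move=> y Uy [Vy Wy]; rewrite fh// gk.
Qed.

Fact sub_regularV U f : open U -> sub_regular U f ->
  open (U `&` [set x | f x != 0]) /\
  sub_regular (U `&` [set x | f x != 0]) (fun x => (f x)^-1).
Proof.
move=> oU rf; split.
  apply: open_local => x [Ux fx]; have [V [h [oV Vx rh fh]]] := rf x Ux.
  have [oVh _] := regularV _ _ oV rh.
  exists (U `&` val @^-1` (V `&` [set x | h x != 0])); split.
  - by apply: openI => //; apply/sub_openP; exists (V `&` [set x | h x != 0]).
  - by split=> //; split=> //=; rewrite -fh.
  - by move=> y [Uy [/= Vy hy]]; split=> //=; rewrite fh.
move=> x [Ux fx]; have [V [h [oV Vx rh fh]]] := rf x Ux.
have [oVh rVh] := regularV _ _ oV rh.
exists (V `&` [set x | h x != 0]), (fun x => (h x)^-1); split=> //.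
  by split=> //=; rewrite -fh.
by move=> y [Uy fy] [Vy _]; rewrite fh.
Qed.

Fact sub_regular_sub U V f : open U -> open V -> V `<=` U ->
  sub_regular U f -> sub_regular V f.
Proof.
move=> _ _ sVU rf x Vx; have [W [h [oW Wx rh fh]]] := rf x (sVU _ Vx).
by exists W, h; split=> // y Vy; apply: fh; exact: sVU.
Qed.

Fact sub_regular_glue U f : open U ->
  (forall x, U x -> exists V : set A,
     [/\ open V, V x, V `<=` U & sub_regular V f]) -> sub_regular U f.
Proof.
move=> _ H x Ux; have [V [/sub_openP [V' oV' <-] Vx sVU rf]] := H x Ux.
have [W [h [oW Wx rh fh]]] := rf x Vx.
have oVW : open (V' `&` W) by exact: openI.
exists (V' `&` W), h; split=> //.
  by apply: regular_sub rh => // ? [].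
by move=> y Uy [V'y Wy]; apply: fh.
Qed.

HB.instance Definition _ := isFunSpace.Build K (set_type A)
  sub_regular_eq sub_regular_cst sub_regularD sub_regularM sub_regularV
  sub_regular_sub sub_regular_glue.

End Subspace.

Section Quotient.
Variables (K : fieldType) (X : funSpaceType K) (Q0 : quotType X).
Local Notation Q := (quotient_topology Q0).

Definition quot_regular (U : set Q) : set (Q -> K) :=
  [set f : Q -> K | regular (\pi_Q @^-1` U : set X) (f \o \pi_Q)].

Let open_pi (U : set Q) : open U -> open (\pi_Q @^-1` U : set X).
Proof. by []. Qed.

Fact quot_regular_eq (U : set Q) (f g : Q -> K) : open U -> (forall x, U x -> f x = g x) ->
  quot_regular U f -> quot_regular U g.
Proof.
by move=> oU fg; apply: regular_eq; [exact: open_pi|move=> x Ux; exact: fg].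
Qed.

Fact quot_regular_cst (U : set Q) (c : K) : open U -> quot_regular U (fun=> c).
Proof. by move=> /open_pi oU; exact: (regular_cst _ _ oU). Qed.

Fact quot_regularD (U : set Q) (f g : Q -> K) : open U -> quot_regular U f -> quot_regular U g ->
  quot_regular U (fun x => f x + g x).
Proof. by move=> /open_pi oU; exact: regularD. Qed.

Fact quot_regularM (U : set Q) (f g : Q -> K) : open U -> quot_regular U f -> quot_regular U g ->
  quot_regular U (fun x => f x * g x).
Proof. by move=> /open_pi oU; exact: regularM. Qed.

Fact quot_regularV (U : set Q) (f : Q -> K) : open U -> quot_regular U f ->
  open (U `&` [set x | f x != 0]) /\
  quot_regular (U `&` [set x | f x != 0]) (fun x => (f x)^-1).
Proof. by move=> /open_pi oU rf; exact: (regularV _ _ oU rf). Qed.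

Fact quot_regular_sub (U V : set Q) (f : Q -> K) : open U -> open V -> V `<=` U ->
  quot_regular U f -> quot_regular V f.
Proof.
by move=> /open_pi oU /open_pi oV sVU; apply: regular_sub => // x; exact: sVU.
Qed.

Fact quot_regular_glue (U : set Q) (f : Q -> K) : open U ->
  (forall x, U x -> exists V : set Q,
     [/\ open V, V x, V `<=` U & quot_regular V f]) -> quot_regular U f.
Proof.
move=> /open_pi oU H; apply: regular_glue => // x Ux.
have [V [/open_pi oV Vx sVU rf]] := H _ Ux.
by exists (\pi_Q @^-1` V); split=> // y; exact: sVU.
Qed.

HB.instance Definition _ := isFunSpace.Build K Q
  quot_regular_eq quot_regular_cst quot_regularD quot_regularM quot_regularV
  quot_regular_sub quot_regular_glue.

End Quotient.

Definition affine (K : fieldType) (I : finType) : Type := {ffun I -> K}.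

Section Affine.
Variables (K : fieldType) (I : finType).
Local Notation A := (affine K I).
Local Notation poly_fun := {mpoly K[#|I|]}.

HB.instance Definition _ := Choice.copy A {ffun I -> K}.

Definition peval (p : poly_fun) (x : A) : K :=
  p.@[fun k => (x : {ffun I -> K}) (enum_val k)].

Lemma pevalM p q x : peval (p * q) x = peval p x * peval q x.
Proof. exact: mevalM. Qed.
Lemma pevalD p q x : peval (p + q) x = peval p x + peval q x.
Proof. exact: mevalD. Qed.
Lemma pevalC c x : peval c%:MP x = c.
Proof. exact: mevalC. Qed.

Definition zero_locus (S : set poly_fun) : set A :=
  [set x | forall p, S p -> peval p x = 0].

Definition affine_open : set (set A) :=
  [set U | exists S, ~` U = zero_locus S].

Lemma affine_openP U : affine_open U <-> forall x, U x -> exists p,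
  peval p x != 0 /\ forall y, peval p y != 0 -> U y.
Proof.
split=> [[S US] x Ux|H].
  have: ~ zero_locus S x by rewrite -US; apply.
  move=> /existsNP [p /not_implyP [Sp /eqP px]]; exists p; split=> // y py.
  apply: contrapT => nUy; have: zero_locus S y by rewrite -US.
  by move=> /(_ p Sp) /eqP; apply/negP.
exists [set p | forall y, peval p y != 0 -> U y].
apply/seteqP; split=> x /=.
  by move=> nUx p /(_ x) Hp; apply/eqP; apply: contra_notT nUx.
by move=> Hx Ux; have [p [/eqP px Hp]] := H x Ux; apply: px; exact: Hx.
Qed.

Fact affine_openT : affine_open setT.
Proof. by apply/affine_openP => x _; exists 1%:MP; rewrite pevalC oner_neq0. Qed.

Fact affine_openI : setI_closed affine_open.
Proof.
move=> U V /affine_openP oU /affine_openP oV; apply/affine_openP.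
move=> x [/oU [p [px pU]] /oV [q [qx qV]]]; exists (p * q).
rewrite pevalM mulf_neq0//; split=> // y.
by rewrite pevalM mulf_eq0 negb_or => /andP [/pU ? /qV].
Qed.

Fact affine_open_bigU (J : Type) (f : J -> set A) :
  (forall j, affine_open (f j)) -> affine_open (\bigcup_j f j).
Proof.
move=> of_; apply/affine_openP => x [j _ fjx].
have /affine_openP /(_ x fjx) [p [px pf]] := of_ j.
by exists p; split=> // y /pf; exists j.
Qed.

HB.instance Definition _ :=
  isOpenTopological.Build A affine_openT affine_openI affine_open_bigU.

Definition affine_regular (U : set A) : set (A -> K) := [set f |
  forall x, U x -> exists p q, peval q x != 0 /\
    forall y, U y -> peval q y != 0 -> f y = peval p y / peval q y].

Lemma open_affine (U : set A) : open U = affine_open U.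
Proof. by []. Qed.

Fact affine_regular_eq U f g : open U -> (forall x, U x -> f x = g x) ->
  affine_regular U f -> affine_regular U g.
Proof.
move=> _ fg rf x Ux; have [p [q [qx H]]] := rf x Ux.
by exists p, q; split=> // y Uy qy; rewrite -fg// H.
Qed.

Fact affine_regular_cst U c : open U -> affine_regular U (fun=> c).
Proof.
move=> _ x Ux; exists c%:MP, 1%:MP; rewrite pevalC oner_neq0; split=> // y.
by rewrite !pevalC divr1.
Qed.

Fact affine_regularD U f g : open U ->
  affine_regular U f -> affine_regular U g ->
  affine_regular U (fun x => f x + g x).
Proof.
move=> _ rf rg x Ux.
have [p [q [qx H]]] := rf x Ux; have [r [s [sx H']]] := rg x Ux.
exists (p * s + r * q), (q * s); rewrite pevalM mulf_neq0//; split=> // y Uy.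
rewrite pevalD !pevalM mulf_eq0 negb_or => /andP [qy sy].
by rewrite H// H'// addf_div.
Qed.

Fact affine_regularM U f g : open U ->
  affine_regular U f -> affine_regular U g ->
  affine_regular U (fun x => f x * g x).
Proof.
move=> _ rf rg x Ux.
have [p [q [qx H]]] := rf x Ux; have [r [s [sx H']]] := rg x Ux.
exists (p * r), (q * s); rewrite pevalM mulf_neq0//; split=> // y Uy.
rewrite !pevalM mulf_eq0 negb_or => /andP [qy sy].
by rewrite H// H'// mulf_div.
Qed.

Fact affine_regularV U f : open U -> affine_regular U f ->
  open (U `&` [set x | f x != 0]) /\
  affine_regular (U `&` [set x | f x != 0]) (fun x => (f x)^-1).
Proof.
move=> oU rf; split.
  rewrite open_affine; apply/affine_openP => x [Ux /= fx].
  have [p [q [qx H]]] := rf x Ux.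
  move: (oU); rewrite open_affine => /affine_openP /(_ x Ux) [r [rx rU]].
  exists (r * (p * q)); rewrite !pevalM !mulf_neq0//; last first.
    by apply: contraNneq fx => px; rewrite H// px mul0r.
  split=> // y; rewrite !pevalM !mulf_eq0 !negb_or => /and3P [/rU Uy py qy].
  by split=> //=; rewrite H// mulf_neq0// invr_neq0.
move=> x [Ux /= fx]; have [p [q [qx H]]] := rf x Ux.
exists (q * q), (p * q); rewrite pevalM mulf_neq0//; last first.
  by apply: contraNneq fx => px; rewrite H// px mul0r.
split=> // y [Uy /= fy]; rewrite !pevalM mulf_eq0 negb_or => /andP [py qy].
by rewrite H// invf_div -mulf_div divff// mulr1.
Qed.

Fact affine_regular_sub U V f : open U -> open V -> V `<=` U ->
  affine_regular U f -> affine_regular V f.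
Proof.
move=> _ _ sVU rf x Vx; have [p [q [qx H]]] := rf x (sVU _ Vx).
by exists p, q; split=> // y Vy; apply: H; exact: sVU.
Qed.

Fact affine_regular_glue U f : open U ->
  (forall x, U x -> exists V : set A,
     [/\ open V, V x, V `<=` U & affine_regular V f]) -> affine_regular U f.
Proof.
move=> _ H x Ux; have [V [oV Vx sVU rf]] := H x Ux.
have [p [q [qx Hpq]]] := rf x Vx.
move: oV; rewrite open_affine => /affine_openP /(_ x Vx) [r [rx rV]].
exists (r * p), (r * q); rewrite pevalM mulf_neq0//; split=> // y Uy.
rewrite !pevalM mulf_eq0 negb_or => /andP [ry qy].
by rewrite (Hpq y (rV _ ry) qy) -mulf_div divff// mul1r.
Qed.

HB.instance Definition _ := isFunSpace.Build K A
  affine_regular_eq affine_regular_cst affine_regularD affine_regularM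
  affine_regularV affine_regular_sub affine_regular_glue.

End Affine.

(* Projective space, with one homogeneous coordinate for each element of [I].
   A homogeneous condition on a point is evaluated on its representative. *)

Section Projective.
Variables (K : fieldType) (I : finType).
Local Notation poly_fun := {mpoly K[#|I|]}.

Definition punctured : set (affine K I) := [set v | exists i, v i != 0].

Definition scale (c : K) (v : affine K I) : affine K I :=
  [ffun i => c * v i].

Definition proportional : rel punctured :=
  fun u v => `[< exists2 c, c != 0 & val v = scale c (val u) >].

Fact proportional_refl : reflexive proportional.
Proof.
move=> u; apply/asboolP; exists 1; rewrite ?oner_neq0//.
by apply/ffunP => i; rewrite ffunE mul1r.
Qed.

Fact proportional_sym : ssrbool.symmetric proportional.
Proof.
suff imp u v : proportional u v -> proportional v u.
  by move=> u v; apply/idP/idP; exact: imp.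
move=> /asboolP [c c0 E]; apply/asboolP; exists c^-1; rewrite ?invr_neq0//.
by apply/ffunP => i; rewrite E !ffunE mulrA mulVf// mul1r.
Qed.

Fact proportional_trans : transitive proportional.
Proof.
move=> v u w /asboolP [c c0 E] /asboolP [d d0 F]; apply/asboolP.
exists (d * c); rewrite ?mulf_neq0//.
by apply/ffunP => i; rewrite F E !ffunE mulrA.
Qed.

Canonical proportional_equiv := EquivRel proportional
  proportional_refl proportional_sym proportional_trans.

Definition proj : Type := {eq_quot proportional}.
HB.instance Definition _ := Choice.on proj.

Definition coords (x : proj) : affine K I :=
  val (repr (x : {eq_quot proportional})).

Definition point_of (v : punctured) : proj := \pi_{eq_quot proportional} v.

Lemma coords_neq0 x : punctured (coords x).
Proof. exact: set_valP. Qed.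

Lemma coords_point_of v : exists2 c, c != 0 & coords (point_of v) =
  scale c (val v).
Proof.
suff /asboolP : proportional v (repr (point_of v : {eq_quot proportional})).
  by [].
by apply/eqmodP; rewrite reprK.
Qed.

Lemma point_of_eq u v c : c != 0 -> val v = scale c (val u) ->
  point_of u = point_of v.
Proof. by move=> c0 E; apply/eqmodP; apply/asboolP; exists c. Qed.

Lemma point_of_coords x (h : punctured (coords x)) :
  point_of (SigSub (mem_set h)) = x.
Proof.
rewrite -[RHS](reprK (x : {eq_quot proportional})).
by congr (\pi); apply: val_inj.
Qed.

Definition pzero_locus (S : set poly_fun) : set proj :=
  [set x | forall p, S p -> peval p (coords x) = 0].

Definition proj_open : set (set proj) :=
  [set U | exists S : set poly_fun,
     (forall p, S p -> exists d, p \is d.-homog) /\ ~` U = pzero_locus S].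

Lemma proj_openP U : proj_open U <-> forall x, U x -> exists p d,
  [/\ p \is d.-homog, peval p (coords x) != 0 &
      forall y, peval p (coords y) != 0 -> U y].
Proof.
split=> [[S [homS US]] x Ux|H].
  have: ~ pzero_locus S x by rewrite -US; apply.
  move=> /existsNP [p /not_implyP [Sp /eqP px]].
  have [d dp] := homS p Sp; exists p, d; split=> // y py.
  apply: contrapT => nUy; have: pzero_locus S y by rewrite -US.
  by move=> /(_ p Sp) /eqP; apply/negP.
exists [set p | (exists d, p \is d.-homog) /\
                forall y, peval p (coords y) != 0 -> U y].
split; first by move=> p [].
apply/seteqP; split=> x /=.
  by move=> nUx p [_ /(_ x) Hp]; apply/eqP; apply: contra_notT nUx.
move=> Hx Ux; have [p [d [dp /eqP px Hp]]] := H x Ux.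
by apply: px; apply: Hx; split=> //; exists d.
Qed.

Lemma homogC c : (c%:MP : poly_fun) \is 0.-homog.
Proof. by rewrite -[c%:MP]mulr1 mul_mpolyC dhomogZ// dhomog1. Qed.

Fact proj_openT : proj_open setT.
Proof.
apply/proj_openP => x _; exists 1%:MP, 0%N.
by rewrite homogC pevalC oner_neq0.
Qed.

Fact proj_openI : setI_closed proj_open.
Proof.
move=> U V /proj_openP oU /proj_openP oV; apply/proj_openP.
move=> x [/oU [p [d [dp px pU]]] /oV [q [e [eq qx qV]]]].
exists (p * q), (d + e)%N.
rewrite dhomogM// pevalM mulf_neq0//; split=> // y.
by rewrite pevalM mulf_eq0 negb_or => /andP [/pU ? /qV].
Qed.

Fact proj_open_bigU (J : Type) (f : J -> set proj) :
  (forall j, proj_open (f j)) -> proj_open (\bigcup_j f j).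
Proof.
move=> of_; apply/proj_openP => x [j _ fjx].
have /proj_openP /(_ x fjx) [p [d [dp px pf]]] := of_ j.
by exists p, d; split=> // y /pf; exists j.
Qed.

HB.instance Definition _ :=
  isOpenTopological.Build proj proj_openT proj_openI proj_open_bigU.

Lemma open_proj (U : set proj) : open U = proj_open U.
Proof. by []. Qed.

Definition proj_regular (U : set proj) : set (proj -> K) := [set f |
  forall x, U x -> exists p q d,
    [/\ p \is d.-homog, q \is d.-homog, peval q (coords x) != 0 &
        forall y, U y -> peval q (coords y) != 0 ->
          f y = peval p (coords y) / peval q (coords y)]].

Fact proj_regular_eq U f g : open U -> (forall x, U x -> f x = g x) ->
  proj_regular U f -> proj_regular U g.
Proof.
move=> _ fg rf x Ux; have [p [q [d [dp dq qx H]]]] := rf x Ux.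
by exists p, q, d; split=> // y Uy qy; rewrite -fg// H.
Qed.

Fact proj_regular_cst U c : open U -> proj_regular U (fun=> c).
Proof.
move=> _ x Ux; exists c%:MP, 1%:MP, 0%N.
rewrite !homogC pevalC oner_neq0; split=> // y.
by rewrite !pevalC divr1.
Qed.

Fact proj_regularD U f g : open U ->
  proj_regular U f -> proj_regular U g ->
  proj_regular U (fun x => f x + g x).
Proof.
move=> _ rf rg x Ux.
have [p [q [d [dp dq qx H]]]] := rf x Ux.
have [r [s [e [er es sx H']]]] := rg x Ux.
exists (p * s + r * q), (q * s), (d + e)%N.
rewrite pevalM mulf_neq0//; split=> //; last first.
- move=> y Uy.
  rewrite pevalD !pevalM mulf_eq0 negb_or => /andP [qy sy].
  by rewrite H// H'// addf_div.
- exact: dhomogM.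
- by apply: rpredD; [|rewrite [(d + e)%N]addnC]; exact: dhomogM.
Qed.

Fact proj_regularM U f g : open U ->
  proj_regular U f -> proj_regular U g ->
  proj_regular U (fun x => f x * g x).
Proof.
move=> _ rf rg x Ux.
have [p [q [d [dp dq qx H]]]] := rf x Ux.
have [r [s [e [er es sx H']]]] := rg x Ux.
exists (p * r), (q * s), (d + e)%N.
rewrite pevalM mulf_neq0// !dhomogM//; split=> // y Uy.
rewrite !pevalM mulf_eq0 negb_or => /andP [qy sy].
by rewrite H// H'// mulf_div.
Qed.

Fact proj_regularV U f : open U -> proj_regular U f ->
  open (U `&` [set x | f x != 0]) /\
  proj_regular (U `&` [set x | f x != 0]) (fun x => (f x)^-1).
Proof.
move=> oU rf; split.
  rewrite open_proj; apply/proj_openP => x [Ux /= fx].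
  have [p [q [d [dp dq qx H]]]] := rf x Ux.
  move: (oU); rewrite open_proj => /proj_openP /(_ x Ux) [r [e [er rx rU]]].
  exists (r * (p * q)), (e + (d + d))%N.
  rewrite !dhomogM// !pevalM !mulf_neq0//; last first.
    by apply: contraNneq fx => px; rewrite H// px mul0r.
  split=> // y; rewrite !pevalM !mulf_eq0 !negb_or => /and3P [/rU Uy py qy].
  by split=> //=; rewrite H// mulf_neq0// invr_neq0.
move=> x [Ux /= fx]; have [p [q [d [dp dq qx H]]]] := rf x Ux.
exists (q * q), (p * q), (d + d)%N.
rewrite !dhomogM// pevalM mulf_neq0//; last first.
  by apply: contraNneq fx => px; rewrite H// px mul0r.
split=> // y [Uy /= fy]; rewrite !pevalM mulf_eq0 negb_or => /andP [py qy].
by rewrite H// invf_div -mulf_div divff// mulr1.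
Qed.

Fact proj_regular_sub U V f : open U -> open V -> V `<=` U ->
  proj_regular U f -> proj_regular V f.
Proof.
move=> _ _ sVU rf x Vx; have [p [q [d [dp dq qx H]]]] := rf x (sVU _ Vx).
by exists p, q, d; split=> // y Vy; apply: H; exact: sVU.
Qed.

Fact proj_regular_glue U f : open U ->
  (forall x, U x -> exists V : set proj,
     [/\ open V, V x, V `<=` U & proj_regular V f]) -> proj_regular U f.
Proof.
move=> _ H x Ux; have [V [oV Vx sVU rf]] := H x Ux.
have [p [q [d [dp dq qx Hpq]]]] := rf x Vx.
move: oV; rewrite open_proj => /proj_openP /(_ x Vx) [r [e [er rx rV]]].
exists (r * p), (r * q), (e + d)%N.
rewrite !dhomogM// pevalM mulf_neq0//; split=> // y Uy.
rewrite !pevalM mulf_eq0 negb_or => /andP [ry qy].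
by rewrite (Hpq y (rV _ ry) qy) -mulf_div divff// mul1r.
Qed.

HB.instance Definition _ := isFunSpace.Build K proj
  proj_regular_eq proj_regular_cst proj_regularD proj_regularM
  proj_regularV proj_regular_sub proj_regular_glue.

End Projective.

(* Product of two spaces with functions: the basic open sets are the
   nonvanishing loci on U x V of sums of f_i(x) g_i(y), with f_i regular on U
   and g_i regular on V. *)

Definition prod_space (X Y : Type) : Type := (X * Y)%type.

Section Product.
Variables (K : fieldType) (X Y : funSpaceType K).
Local Notation XY := (prod_space X Y).

HB.instance Definition _ := Choice.copy XY (X * Y)%type.

Definition tensor (U : set X) (V : set Y) : set (XY -> K) := [set h |
  exists (I : finType) (f : I -> X -> K) (g : I -> Y -> K),
    [/\ forall i, regular U (f i), forall i, regular V (g i) &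
        forall z, h z = \sum_i f i z.1 * g i z.2]].

Lemma tensor_sub (U U' : set X) (V V' : set Y) h :
  open U -> open V -> open U' -> open V' -> U' `<=` U -> V' `<=` V ->
  tensor U V h -> tensor U' V' h.
Proof.
move=> oU oV oU' oV' sU sV [I [f [g [rf rg H]]]]; exists I, f, g.
by split=> // i; [exact: regular_sub (rf i)|exact: regular_sub (rg i)].
Qed.

Lemma tensor_cst U V c : open U -> open V -> tensor U V (fun=> c).
Proof.
move=> oU oV; exists unit, (fun _ _ => c), (fun _ _ => 1).
split=> [_|_|z]; [exact: regular_cst|exact: regular_cst|].
by rewrite big_const card_unit /= mulr1 addr0.
Qed.

Lemma tensorM U V h k : open U -> open V -> tensor U V h -> tensor U V k ->
  tensor U V (fun z => h z * k z).
Proof.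
move=> oU oV [I [f [g [rf rg H]]]] [J [f' [g' [rf' rg' H']]]].
exists (I * J)%type, (fun ij x => f ij.1 x * f' ij.2 x),
  (fun ij x => g ij.1 x * g' ij.2 x).
split=> [[i j]|[i j]|z]; [exact: regularM|exact: regularM|].
rewrite H H' big_distrl/= -(pair_bigA _ (fun i j =>
  (f i z.1 * f' j z.1) * (g i z.2 * g' j z.2)))/=.
by apply: eq_bigr => i _; rewrite big_distrr/=; apply: eq_bigr => j _;
  rewrite mulrACA.
Qed.

Lemma tensorD U V h k : open U -> open V -> tensor U V h -> tensor U V k ->
  tensor U V (fun z => h z + k z).
Proof.
move=> oU oV [I [f [g [rf rg H]]]] [J [f' [g' [rf' rg' H']]]].
exists (I + J)%type,
  (fun ij => match ij with inl i => f i | inr j => f' j end),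
  (fun ij => match ij with inl i => g i | inr j => g' j end).
by split=> [[i|j]|[i|j]|z] //; rewrite H H' big_sumType/=.
Qed.

Definition prod_open : set (set XY) := [set W |
  forall z, W z -> exists (U : set X) (V : set Y) (h : XY -> K),
    [/\ open U, open V & tensor U V h] /\ [/\ U z.1, V z.2 & h z != 0] /\
    forall w, U w.1 -> V w.2 -> h w != 0 -> W w].

Fact prod_openT : prod_open setT.
Proof.
move=> z _; exists setT, setT, (fun=> 1); split; last first.
  by do 2?split=> //; exact: oner_neq0.
by split; [exact: openT|exact: openT|apply: tensor_cst; exact: openT].
Qed.

Fact prod_openI : setI_closed prod_open.
Proof.
move=> W W' oW oW' z [/oW + /oW'].
move=> [U [V [h [[oU oV th] [[Uz Vz hz] H]]]]].
move=> [U' [V' [h' [[oU' oV' th'] [[Uz' Vz' hz'] H']]]]].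
have oUU : open (U `&` U') by exact: openI.
have oVV : open (V `&` V') by exact: openI.
exists (U `&` U'), (V `&` V'), (fun z => h z * h' z); do 2?split=> //.
- by apply: tensorM => //; [apply: tensor_sub th|apply: tensor_sub th'] =>
    // ? [].
- by rewrite mulf_neq0.
- move=> w [Uw Uw'] [Vw Vw']; rewrite mulf_eq0 negb_or => /andP [hw hw'].
  by split; [exact: H|exact: H'].
Qed.

Fact prod_open_bigU (J : Type) (f : J -> set XY) :
  (forall j, prod_open (f j)) -> prod_open (\bigcup_j f j).
Proof.
move=> of_ z [j _ fjz]; have [U [V [h [? [? H]]]]] := of_ j z fjz.
by exists U, V, h; do 2?split=> //; move=> w *; exists j => //; exact: H.
Qed.

HB.instance Definition _ :=
  isOpenTopological.Build XY prod_openT prod_openI prod_open_bigU.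

Definition prod_regular (W : set XY) : set (XY -> K) := [set f |
  forall z, W z -> exists (U : set X) (V : set Y) (a h : XY -> K),
    [/\ open U, open V, tensor U V a & tensor U V h] /\
    [/\ U z.1, V z.2 & h z != 0] /\
    forall w, W w -> U w.1 -> V w.2 -> h w != 0 -> f w = a w / h w].

Lemma open_prod (W : set XY) : open W = prod_open W.
Proof. by []. Qed.

Fact prod_regular_eq W f g : open W -> (forall x, W x -> f x = g x) ->
  prod_regular W f -> prod_regular W g.
Proof.
move=> _ fg rf z Wz; have [U [V [a [h [? [? H]]]]]] := rf z Wz.
by exists U, V, a, h; do 2?split=> //; move=> w Ww *; rewrite -fg// H.
Qed.

Fact prod_regular_cst W c : open W -> prod_regular W (fun=> c).
Proof.
move=> _ z Wz; exists setT, setT, (fun=> c), (fun=> 1).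
split; first by split; try apply: tensor_cst; exact: openT.
split; first by split=> //; exact: oner_neq0.
by move=> *; rewrite divr1.
Qed.

Lemma prod_regular2 W f g z : prod_regular W f -> prod_regular W g -> W z ->
  exists (U : set X) (V : set Y) (a h b k : XY -> K),
    [/\ open U, open V & U z.1 /\ V z.2] /\
    [/\ tensor U V a, tensor U V h, tensor U V b & tensor U V k] /\
    [/\ h z != 0, k z != 0,
     forall w, W w -> U w.1 -> V w.2 -> h w != 0 -> f w = a w / h w &
     forall w, W w -> U w.1 -> V w.2 -> k w != 0 -> g w = b w / k w].
Proof.
move=> rf rg Wz.
have [U [V [a [h [[oU oV ta th] [[Uz Vz hz] H]]]]]] := rf z Wz.
have [U' [V' [b [k [[oU' oV' tb tk] [[Uz' Vz' kz] H']]]]]] := rg z Wz.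
have oUU : open (U `&` U') by exact: openI.
have oVV : open (V `&` V') by exact: openI.
exists (U `&` U'), (V `&` V'), a, h, b, k.
split; first by do 2?split.
split; first by split; [apply: tensor_sub ta|apply: tensor_sub th|
  apply: tensor_sub tb|apply: tensor_sub tk] => // ? [].
by split=> // w Ww [Uw Uw'] [Vw Vw'] hw; [exact: H|exact: H'].
Qed.

Fact prod_regularD W f g : open W -> prod_regular W f -> prod_regular W g ->
  prod_regular W (fun x => f x + g x).
Proof.
move=> _ rf rg z Wz.
have [U [V [a [h [b [k [[oU oV [Uz Vz]] [[ta th tb tk] [hz kz H H']]]]]]]]] :=
  prod_regular2 rf rg Wz.
exists U, V, (fun z => a z * k z + b z * h z), (fun z => h z * k z).
do 2?split=> //; [by apply: tensorD; [| |exact: tensorM..]|exact: tensorM|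
  by rewrite mulf_neq0|].
move=> w Ww Uw Vw; rewrite mulf_eq0 negb_or => /andP [hw kw].
by rewrite H// H'// addf_div.
Qed.

Fact prod_regularM W f g : open W -> prod_regular W f -> prod_regular W g ->
  prod_regular W (fun x => f x * g x).
Proof.
move=> _ rf rg z Wz.
have [U [V [a [h [b [k [[oU oV [Uz Vz]] [[ta th tb tk] [hz kz H H']]]]]]]]] :=
  prod_regular2 rf rg Wz.
exists U, V, (fun z => a z * b z), (fun z => h z * k z).
do 2?split=> //; [exact: tensorM|exact: tensorM|by rewrite mulf_neq0|].
move=> w Ww Uw Vw; rewrite mulf_eq0 negb_or => /andP [hw kw].
by rewrite H// H'// mulf_div.
Qed.

Fact prod_regularV W f : open W -> prod_regular W f ->
  open (W `&` [set x | f x != 0]) /\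
  prod_regular (W `&` [set x | f x != 0]) (fun x => (f x)^-1).
Proof.
move=> oW rf; split.
  rewrite open_prod => z [Wz /= fz].
  have [U [V [a [h [[oU oV ta th] [[Uz Vz hz] H]]]]]] := rf z Wz.
  move: (oW); rewrite open_prod => /(_ z Wz).
  move=> [U' [V' [k [[oU' oV' tk] [[Uz' Vz' kz] H']]]]].
  have oUU : open (U `&` U') by exact: openI.
  have oVV : open (V `&` V') by exact: openI.
  exists (U `&` U'), (V `&` V'), (fun z => k z * (a z * h z)).
  split; [split=> //|split].
  - apply: tensorM => //; first by apply: tensor_sub tk => // ? [].
    by apply: tensorM => //; [apply: tensor_sub ta|apply: tensor_sub th] =>
      // ? [].
  - split=> //; rewrite !mulf_neq0//.
    by apply: contraNneq fz => az; rewrite H// az mul0r.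
  - move=> w [Uw Uw'] [Vw Vw']; rewrite !mulf_eq0 !negb_or.
    move=> /and3P [kw aw hw]; have Ww := H' w Uw' Vw' kw.
    by split=> //=; rewrite H// mulf_neq0 ?invr_neq0.
move=> z [Wz /= fz].
have [U [V [a [h [[oU oV ta th] [[Uz Vz hz] H]]]]]] := rf z Wz.
exists U, V, (fun z => h z * h z), (fun z => a z * h z).
do 2?split=> //; [exact: tensorM|exact: tensorM| |].
  rewrite mulf_neq0//.
  by apply: contraNneq fz => az; rewrite H// az mul0r.
move=> w [Ww /= fw] Uw Vw; rewrite mulf_eq0 negb_or => /andP [aw hw].
by rewrite H// invf_div -mulf_div divff// mulr1.
Qed.

Fact prod_regular_sub W W' f : open W -> open W' -> W' `<=` W ->
  prod_regular W f -> prod_regular W' f.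
Proof.
move=> _ _ sW rf z Wz; have [U [V [a [h [? [? H]]]]]] := rf z (sW _ Wz).
by exists U, V, a, h; do 2?split=> //; move=> w /sW Ww *; exact: H.
Qed.

Fact prod_regular_glue W f : open W ->
  (forall x, W x -> exists W' : set XY,
     [/\ open W', W' x, W' `<=` W & prod_regular W' f]) -> prod_regular W f.
Proof.
move=> _ H0 z Wz; have [W' [oW' Wz' sW rf]] := H0 z Wz.
have [U [V [a [h [[oU oV ta th] [[Uz Vz hz] H]]]]]] := rf z Wz'.
move: oW'; rewrite open_prod => /(_ z Wz').
move=> [U' [V' [k [[oU' oV' tk] [[Uz' Vz' kz] H']]]]].
have oUU : open (U `&` U') by exact: openI.
have oVV : open (V `&` V') by exact: openI.
have tk' : tensor (U `&` U') (V `&` V') k by apply: tensor_sub tk => // ? [].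
exists (U `&` U'), (V `&` V'), (fun z => k z * a z), (fun z => k z * h z).
do 2?split=> //.
- by apply: tensorM => //; apply: tensor_sub ta => // ? [].
- by apply: tensorM => //; apply: tensor_sub th => // ? [].
- by rewrite mulf_neq0.
- move=> w Ww [Uw Uw'] [Vw Vw']; rewrite mulf_eq0 negb_or => /andP [kw hw].
  by rewrite (H w (H' _ Uw' Vw' kw))// -mulf_div divff// mul1r.
Qed.

HB.instance Definition _ := isFunSpace.Build K XY
  prod_regular_eq prod_regular_cst prod_regularD prod_regularM
  prod_regularV prod_regular_sub prod_regular_glue.

End Product.

(* Varieties are not assumed to be irreducible. *)

Section Varieties.
Variable K : fieldType.

Definition affine_variety (X : funSpaceType K) :=
  exists m (Z : set (affine K 'I_m)), closed Z /\ isomorphic X Z.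

Definition separated (X : funSpaceType K) :=
  closed [set z : prod_space X X | z.1 = z.2].

Definition variety (X : funSpaceType K) :=
  separated X /\ exists k (U : 'I_k -> set X),
    (forall i, open (U i) /\ affine_variety (U i)) /\
    forall x, exists i, U i x.

Definition invariant_map (G X Y : Type) (act : G -> X -> X) (f : X -> Y) :=
  forall g x, f (act g x) = f x.

Definition categorical_quotient (G : Type) (X Q : funSpaceType K)
    (act : G -> X -> X) (p : X -> Q) :=
  [/\ morphism p, invariant_map act p &
      forall (Z : funSpaceType K) (f : X -> Z), variety Z -> morphism f ->
        invariant_map act f ->
        exists! q : Q -> Z, morphism q /\ f = q \o p].

(* A fibration G -> X -> Q whose fibres are orbits of [act]: Zariski-locally
   on Q, the map [p] is the first projection of a product with G, on which G
   acts by multiplication on the second factor. *)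
Definition fibration (G X Q : funSpaceType K) (mul : G -> G -> G)
    (act : G -> X -> X) (p : X -> Q) :=
  morphism p /\ forall q : Q, exists U : set Q,
    [/\ open U, U q &
      exists phi : (p @^-1` U : set X) -> prod_space U G,
        [/\ isomorphism phi,
            forall x, val (phi x).1 = p (val x) &
            forall g x y, val y = act g (val x) ->
              (phi y).2 = mul g (phi x).2]].

End Varieties.

Definition pairs (m : nat) := {ij : 'I_m * 'I_m | (ij.1 < ij.2)%N}.

Section Grassmannian.
Variables (K : fieldType) (m : nat).
Local Notation P := (proj K (pairs m)).
Local Notation V := (@punctured K (pairs m)).

Definition plucker (A : 'M[K]_(2, m)) : affine K (pairs m) :=
  [ffun ij => let: (i, j) := val ij in A 0 i * A 1 j - A 0 j * A 1 i].

Definition gr2 : set P := [set x | exists A : 'M[K]_(2, m),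
  \rank A = 2%N /\ exists2 v : V, val v = plucker A & x = point_of v].

Definition support (x : P) : {set {set 'I_m}} :=
  [set [set (val ij).1; (val ij).2] | ij : pairs m & coords x ij != 0]%SET.

Definition thin_cell (B : {set {set 'I_m}}) : set P :=
  gr2 `&` [set x | support x = B].

Definition torus_set : set (affine K 'I_m) := [set t | forall i, t i != 0].
Definition torus := set_type torus_set.

Lemma torus_neq0 (t : torus) i : val t i != 0.
Proof. exact: (set_valP t). Qed.

Lemma torus_one_subproof : torus_set [ffun=> 1].
Proof. by move=> i; rewrite ffunE oner_neq0. Qed.
Definition tone : torus := SigSub (mem_set torus_one_subproof).

Lemma torus_mul_subproof (s t : torus) :
  torus_set [ffun i => val s i * val t i].
Proof. by move=> i; rewrite ffunE mulf_neq0 ?torus_neq0. Qed.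
Definition tmul (s t : torus) : torus :=
  SigSub (mem_set (torus_mul_subproof s t)).

Lemma torus_inv_subproof (t : torus) : torus_set [ffun i => (val t i)^-1].
Proof. by move=> i; rewrite ffunE invr_neq0 ?torus_neq0. Qed.
Definition tinv (t : torus) : torus :=
  SigSub (mem_set (torus_inv_subproof t)).

Lemma tmulE s t i : val (tmul s t) i = val s i * val t i.
Proof. by rewrite ffunE. Qed.
Lemma tinvE t i : val (tinv t) i = (val t i)^-1.
Proof. by rewrite ffunE. Qed.
Lemma toneE i : val tone i = 1.
Proof. by rewrite ffunE. Qed.

Lemma torusP (s t : torus) : (forall i, val s i = val t i) -> s = t.
Proof. by move=> H; apply: val_inj; apply/ffunP. Qed.

Lemma tmulA s t u : tmul s (tmul t u) = tmul (tmul s t) u.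
Proof. by apply: torusP => i; rewrite !tmulE mulrA. Qed.
Lemma tmulC s t : tmul s t = tmul t s.
Proof. by apply: torusP => i; rewrite !tmulE mulrC. Qed.
Lemma tmul1 t : tmul tone t = t.
Proof. by apply: torusP => i; rewrite tmulE toneE mul1r. Qed.
Lemma tmulV t : tmul (tinv t) t = tone.
Proof. by apply: torusP => i; rewrite tmulE tinvE toneE mulVf ?torus_neq0. Qed.

Definition weight (t : torus) (ij : pairs m) : K :=
  val t (val ij).1 * val t (val ij).2.

Lemma weight_neq0 t ij : weight t ij != 0.
Proof. by rewrite mulf_neq0 ?torus_neq0. Qed.

Definition tscale (t : torus) (v : affine K (pairs m)) : affine K (pairs m) :=
  [ffun ij => weight t ij * v ij].

Lemma tscale_punctured t v : punctured v -> punctured (tscale t v).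
Proof. by move=> [i vi]; exists i; rewrite ffunE mulf_neq0 ?weight_neq0. Qed.

Definition tact (t : torus) (x : P) : P :=
  point_of (SigSub (mem_set (tscale_punctured t (coords_neq0 x)))).

Lemma tact_coords t x : exists2 c, c != 0 &
  coords (tact t x) = scale c (tscale t (coords x)).
Proof. exact: coords_point_of. Qed.

Lemma tact_eq t x (v : V) c : c != 0 ->
  val v = scale c (tscale t (coords x)) -> tact t x = point_of v.
Proof. by move=> c0 E; apply: point_of_eq c0 _. Qed.

Lemma point_of_coords_eq x (v : V) : val v = coords x -> point_of v = x.
Proof.
move=> E; rewrite -[RHS](point_of_coords (coords_neq0 x)).
by congr point_of; apply: val_inj.
Qed.

Lemma tact1 x : tact tone x = x.
Proof.
apply: point_of_coords_eq; apply/ffunP => ij.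
by rewrite ffunE /weight !toneE !mul1r.
Qed.

Lemma tactM s t x : tact s (tact t x) = tact (tmul s t) x.
Proof.
have [c c0 E] := tact_coords t x; apply/esym; apply: (@tact_eq _ _ _ c) => //.
apply/ffunP => ij; rewrite [LHS]ffunE E !ffunE /weight !tmulE.
by rewrite [LHS]mulrCA; congr (c * _); rewrite [LHS]mulrA; congr (_ * _);
  rewrite mulrACA.
Qed.

Lemma support_tact t x : support (tact t x) = support x.
Proof.
have [c c0 E] := tact_coords t x.
suff H : (fun ij => coords (tact t x) ij != 0) = (fun ij => coords x ij != 0).
  by rewrite /support H.
apply/funext => ij.
by rewrite E !ffunE mulrA mulf_eq0
  (negPf (mulf_neq0 c0 (weight_neq0 t ij))).
Qed.

Lemma gr2_tact t x : gr2 x -> gr2 (tact t x).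
Proof.
move=> [A [rA [v vA ->]]]; pose d := \row_i (val t i).
have dU : diag_mx d \in unitmx.
  rewrite unitmxE det_diag unitfE; apply/prodf_neq0 => i _.
  by rewrite mxE torus_neq0.
exists (A *m diag_mx d); split; first by rewrite mxrankMfree ?row_free_unit.
have [c c0 E] := coords_point_of v.
exists (SigSub (mem_set (tscale_punctured t (set_valP v)))).
  apply/ffunP => -[[i j] ij] /=; rewrite [LHS]ffunE vA !ffunE /weight /=.
  rewrite mul_mx_diag !mxE mulrBr [X in _ = X - _]mulrACA.
  by rewrite [X in _ = _ - X]mulrACA; congr (_ - _); rewrite mulrC //
    [val t j * _]mulrC.
apply: (@tact_eq _ _ _ c^-1); rewrite ?invr_neq0// E.
by apply/ffunP => ij; rewrite !ffunE [RHS]mulrCA mulKf.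
Qed.

Lemma thin_cell_tact B t x : thin_cell B x -> thin_cell B (tact t x).
Proof.
by move=> [/gr2_tact gx xB]; split; [exact: gx|rewrite /= support_tact].
Qed.

Definition stab (B : {set {set 'I_m}}) : set torus :=
  [set t | forall x, thin_cell B x -> tact t x = x].

Record subtorus := Subtorus {
  subtorus_set :> set torus;
  subtorus1 : subtorus_set tone;
  subtorusM : forall s t,
    subtorus_set s -> subtorus_set t -> subtorus_set (tmul s t);
  subtorusV : forall t, subtorus_set t -> subtorus_set (tinv t)
}.

Definition full_torus : subtorus :=
  @Subtorus setT I (fun _ _ _ _ => I) (fun _ _ => I).

Record stable_subset (S : subtorus) (B : {set {set 'I_m}}) := StableSubset {
  stable_set :> set P;
  stable_thin : stable_set `<=` thin_cell B;
  stable_tact : forall s x,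
    subtorus_set S s -> stable_set x -> stable_set (tact s x)
}.

Definition full_cell (B : {set {set 'I_m}}) : stable_subset full_torus B :=
  @StableSubset full_torus B (thin_cell B) (@subset_refl _ _)
    (fun s x _ => @thin_cell_tact B s x).

Section QuotientTorus.
Variables (S : subtorus) (B : {set {set 'I_m}}).

Definition stab_in : set torus := subtorus_set S `&` stab B.

Definition stab_rel : rel (subtorus_set S) :=
  fun s t => `[< exists2 u, stab_in u & val t = tmul u (val s) >].

Lemma stabM u v : stab B u -> stab B v -> stab B (tmul u v).
Proof. by move=> su sv x Bx; rewrite -tactM sv// su. Qed.

Lemma stabV u : stab B u -> stab B (tinv u).
Proof. by move=> su x Bx; rewrite -{1}(su x Bx) tactM tmulV tact1. Qed.

Fact stab_rel_refl : reflexive stab_rel.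
Proof.
move=> s; apply/asboolP; exists tone; last by rewrite tmul1.
by split; [exact: subtorus1|move=> x _; exact: tact1].
Qed.

Fact stab_rel_sym : ssrbool.symmetric stab_rel.
Proof.
suff imp s t : stab_rel s t -> stab_rel t s.
  by move=> s t; apply/idP/idP; exact: imp.
move=> /asboolP [u [Su su] E]; apply/asboolP; exists (tinv u).
  by split; [exact: subtorusV|exact: stabV].
by rewrite E tmulA tmulV tmul1.
Qed.

Fact stab_rel_trans : transitive stab_rel.
Proof.
move=> t s r /asboolP [u [Su su] E] /asboolP [v [Sv sv] F]; apply/asboolP.
exists (tmul v u); first by split; [exact: subtorusM|exact: stabM].
by rewrite F E tmulA.
Qed.

Canonical stab_equiv :=
  EquivRel stab_rel stab_rel_refl stab_rel_sym stab_rel_trans.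

Definition quot_torus := quotient_topology {eq_quot stab_rel}.

Definition qclass (s : subtorus_set S) : quot_torus := \pi_{eq_quot stab_rel} s.
Definition qrepr (c : quot_torus) : subtorus_set S :=
  repr (c : {eq_quot stab_rel}).

(* Independent of the representatives: see [qmul_class]. *)
Definition qmul (c d : quot_torus) : quot_torus :=
  qclass (SigSub (mem_set
    (subtorusM (set_valP (qrepr c)) (set_valP (qrepr d))))).

Lemma qreprP s : exists2 u, stab_in u & val (qrepr (qclass s)) = tmul u (val s).
Proof.
suff /asboolP : stab_rel s (qrepr (qclass s)) by [].
by apply/eqmodP; rewrite reprK.
Qed.

Lemma qmul_class s t : qmul (qclass s) (qclass t) =
  qclass (SigSub (mem_set (subtorusM (set_valP s) (set_valP t)))).
Proof.
have [u [Su su] E] := qreprP s; have [v [Sv sv] F] := qreprP t.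
apply/esym/eqmodP/asboolP; exists (tmul u v).
  by split; [exact: subtorusM|exact: stabM].
rewrite /= E F; apply: torusP => i; rewrite !tmulE; exact: mulrACA.
Qed.

Variable X : stable_subset S B.

(* Well defined, since Stab_S(B) acts trivially on X: see [qact_class]. *)

Definition qact (c : quot_torus) (x : stable_set X) : stable_set X :=
  SigSub (mem_set (stable_tact (set_valP (qrepr c)) (set_valP x))).

Lemma qact_class s x : val (qact (qclass s) x) = tact (val s) (val x).
Proof.
rewrite /=; have [u [_ su] ->] := qreprP s; rewrite -tactM su//.
by apply: (@stable_thin _ _ X); apply: stable_tact; exact: set_valP.
Qed.

Definition orbit_rel : rel (stable_set X) :=
  fun x y => `[< exists c, qact c x = y >].

Lemma orbit_relP x y : reflect
  (exists s : subtorus_set S, tact (val s) (val x) = val y) (orbit_rel x y).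
Proof.
apply: (iffP (asboolP _)) => [[c <-]|[s E]]; first by exists (qrepr c).
by exists (qclass s); apply: val_inj; rewrite qact_class.
Qed.

Fact orbit_rel_refl : reflexive orbit_rel.
Proof.
move=> x; apply/orbit_relP; exists (SigSub (mem_set (subtorus1 S))).
exact: tact1.
Qed.

Fact orbit_rel_sym : ssrbool.symmetric orbit_rel.
Proof.
suff imp x y : orbit_rel x y -> orbit_rel y x.
  by move=> x y; apply/idP/idP; exact: imp.
move=> /orbit_relP [s E]; apply/orbit_relP.
exists (SigSub (mem_set (subtorusV (set_valP s)))).
by rewrite -E tactM tmulV tact1.
Qed.

Fact orbit_rel_trans : transitive orbit_rel.
Proof.
move=> y x z /orbit_relP [s E] /orbit_relP [t F]; apply/orbit_relP.
exists (SigSub (mem_set (subtorusM (set_valP t) (set_valP s)))).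
by rewrite -F -E tactM.
Qed.

Canonical orbit_equiv :=
  EquivRel orbit_rel orbit_rel_refl orbit_rel_sym orbit_rel_trans.

Definition orbit_space := quotient_topology {eq_quot orbit_rel}.

Definition orbit_map (x : stable_set X) : orbit_space :=
  \pi_{eq_quot orbit_rel} x.

End QuotientTorus.

End Grassmannian.

(* The hyperplane s = 0 and the symplectic torus; the involution i |-> i^* on
   'I_(n + n) is [rev_ord], and the indices 1, ..., n are the [lshift n i]. *)

Section Symplectic.
Variables (K : fieldType) (n : nat).

Lemma star_pair_subproof (i : 'I_n) :
  (lshift n i < rev_ord (lshift n i))%N.
Proof. by rewrite /= ltn_subRL -addnS leq_add. Qed.

Definition star_pair (i : 'I_n) : pairs (n + n) :=
  exist _ (lshift n i, rev_ord (lshift n i)) (star_pair_subproof i).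

Definition hyperplane : set (proj K (pairs (n + n))) :=
  [set x | \sum_(i < n) coords x (star_pair i) = 0].

Definition sp_torus_set : set (torus K (n + n)) :=
  [set t : torus K (n + n) | exists mu : 'I_n -> K, forall i : 'I_n,
     val t (lshift n i) = mu i /\ val t (rev_ord (lshift n i)) = (mu i)^-1].

Fact sp_torus1 : sp_torus_set (tone K (n + n)).
Proof. by exists (fun=> 1) => i; rewrite !toneE invr1. Qed.

Fact sp_torusM s t :
  sp_torus_set s -> sp_torus_set t -> sp_torus_set (tmul s t).
Proof.
move=> [mu Hmu] [nu Hnu]; exists (fun i => mu i * nu i) => i.
by rewrite !tmulE; have [-> ->] := Hmu i; have [-> ->] := Hnu i; rewrite invfM.
Qed.

Fact sp_torusV t : sp_torus_set t -> sp_torus_set (tinv t).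
Proof.
move=> [mu Hmu]; exists (fun i => (mu i)^-1) => i.
by rewrite !tinvE; have [-> ->] := Hmu i.
Qed.

Definition sp_torus : subtorus K (n + n) :=
  Subtorus sp_torus1 sp_torusM sp_torusV.

Lemma hyperplane_tact t x :
  sp_torus_set t -> hyperplane x -> hyperplane (tact t x).
Proof.
move=> [mu Hmu] Hx; have [c c0 E] := tact_coords t x.
rewrite /hyperplane /= E -[RHS](mulr0 c) -[in RHS]Hx big_distrr/=.
apply: eq_bigr => i _; rewrite !ffunE /weight /=; congr (c * _).
have [Hl Hr] := Hmu i; have := torus_neq0 t (lshift n i).
by rewrite Hl Hr => mu0; rewrite divff// mul1r.
Qed.

Variable B : {set {set 'I_(n + n)}}.

Definition sp_cell_set : set (proj K (pairs (n + n))) := thin_cell B `&` hyperplane.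

Fact sp_cell_tact s x :
  sp_torus_set s -> sp_cell_set x -> sp_cell_set (tact s x).
Proof.
by move=> Ss [Bx Hx]; split; [exact: thin_cell_tact|exact: hyperplane_tact].
Qed.

Definition sp_cell : stable_subset sp_torus B :=
  @StableSubset _ _ sp_torus B sp_cell_set (@subIsetl _ _ _) sp_cell_tact.

(* The number of pairs {i, i^*} which belong to [B]. *)
Definition star_count : nat :=
  #|[set i : 'I_n | [set lshift n i; rev_ord (lshift n i)] \in B]|%SET.

End Symplectic.

Arguments thin_cell K {m} B.
Arguments hyperplane K n : clear implicits.
Arguments full_cell K {m} B.
Arguments sp_cell K {n} B.
Arguments qmul {K m S B} c d.
Arguments qact {K m S B} X c x.
Arguments orbit_map {K m S B} X x.

(* Main.v *)
Require Import Defs.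
From mathcomp Require Import all_boot all_order all_algebra.
From mathcomp Require separable cyclotomic.
From mathcomp Require Import generic_quotient.
From mathcomp Require Import boolp classical_sets reals topology.
From mathcomp Require Import complex.
From mathcomp Require Import mpoly.
From mathcomp Require Import ring.

Set Implicit Arguments.
Unset Strict Implicit.
Unset Printing Implicit Defensive.

Import Order.TTheory GRing.Theory Num.Theory.
Local Open Scope classical_set_scope.
Local Open Scope ring_scope.
Local Open Scope quotient_scope.

(** The matrix of a point of the thin cell can be normalised in exactly one way
so that two chosen columns [i0] and [j0], with {i0, j0} a basis, become the
standard basis.  What is left is a scale for each other non-zero column and a
slope for each parallel class other than those of [i0] and [j0], subject only
to some polynomial being non-zero.  The cell is thus an open subset of the form
f != 0 of a torus of some rank D, and diagonal matrices act on it by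
multiplying the coordinates with Laurent monomials ([cell_invK], [cell_chartK],
[cell_chart_tact]).

The same holds for the section of the cell by the hyperplane s = 0.  If no pair
{i, i^*} is a basis, the hyperplane contains the cell.  If two are, the chart is
taken with respect to one of them, and s is linear in the scale of a column of
the other: solving for this scale shows that the section is an open subset of a
torus of rank D - 1 ([solved_toric_chart], [sp_cell_chart]).  A single pair
cannot occur, since s would then be a sum with exactly one non-zero term.

Now let a torus act by monomials on a torus of rank D.  By the Smith normal
form of the matrix of the exponents there are coordinates in which the action
translates r of the coordinates by psi(t), where psi is a surjective
homomorphism onto a torus of rank r, and fixes the others ([torus_splitting]).
A stable subset f != 0 is therefore the product of a torus of rank r and a slice
Y, which is affine and open in a torus of rank D - r.  Hence Y is the quotient,
the quotient map is a trivial fibration, the acting torus modulo the stabiliser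
is the torus of rank r, and the two dimensions add up to D
([toric_chart_quotient]).  The dimension formula compares this sum for the big
torus acting on the cell, D, with that for the symplectic torus acting on the
section, D or D - 1.

Two facts need an argument of their own.  The torus of rank r carries the
quotient structure for psi: this reduces to the map which raises one coordinate
to a power, and there to the decomposition of polynomials into isotypic
components under roots of unity ([pow_tor_quotient]).  A non-empty open subset
of affine d-space has dimension d: a chain of length e yields e polynomials
whose monomials are linearly independent, and counting these against the
polynomials of bounded degree gives e <= d ([chain_le_dim]), while coordinate
subspaces through a point give a chain of length d ([flag_chain]). *)

(** * Morphisms of spaces with functions *)

Section Morphisms.
Variable K : fieldType.
Implicit Types X Y Z : funSpaceType K.

Lemma open_preimage (X Y : topologicalType) (f : X -> Y) (U : set Y) :
  continuous f -> open U -> open (f @^-1` U).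
Proof. by move=> /continuousP; apply. Qed.

Lemma closed_preimage (X Y : topologicalType) (f : X -> Y) (F : set Y) :
  continuous f -> closed F -> closed (f @^-1` F).
Proof.
rewrite -[closed F]openC -[closed (_ @^-1` _)]openC => cf oF.
exact: (open_preimage cf oF).
Qed.

Lemma morphism_id X : morphism (@id X).
Proof. by split=> // x; exact: id. Qed.

Lemma morphism_comp X Y Z (f : X -> Y) (g : Y -> Z) :
  morphism f -> morphism g -> morphism (g \o f).
Proof.
move=> [cf rf] [cg rg]; split=> [|V h oV rh].
  by move=> x; apply: continuous_comp; [exact: cf|exact: cg].
by apply: (rf (g @^-1` V) (h \o g)); [exact: open_preimage cg oV|exact: rg].
Qed.

Lemma morphism_ext X Y (f g : X -> Y) : f =1 g -> morphism f -> morphism g.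
Proof. by move=> /funext ->. Qed.

Lemma regular_comp X Y (f : X -> Y) (h : Y -> K) :
  morphism f -> regular setT h -> regular setT (h \o f).
Proof. by move=> [_ rf]; apply: rf openT. Qed.

Lemma isomorphic_trans X Y Z :
  isomorphic X Y -> isomorphic Y Z -> isomorphic X Z.
Proof.
move=> [f [mf [f' [mf' ff' f'f]]]] [g [mg [g' [mg' gg' g'g]]]].
exists (g \o f); split; first exact: morphism_comp.
by exists (f' \o g'); split; [exact: morphism_comp|exact: can_comp|exact: can_comp].
Qed.

Lemma isomorphic_sym X Y : isomorphic X Y -> isomorphic Y X.
Proof. by move=> [f [mf [g [mg fg gf]]]]; exists g; split=> //; exists f. Qed.

Lemma regular_ext X (U : set X) (f g : X -> K) :
  f =1 g -> regular U f -> regular U g.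
Proof. by move=> /funext ->. Qed.

Lemma regular_sum X (U : set X) (I : Type) (r : seq I) (P : pred I)
    (f : I -> X -> K) : open U -> (forall i, P i -> regular U (f i)) ->
  regular U (fun x => \sum_(i <- r | P i) f i x).
Proof.
move=> oU rf; elim: r => [|i r IH].
  apply: (@regular_ext _ _ (fun=> 0)) => [x|]; first by rewrite big_nil.
  exact: regular_cst.
case: (boolP (P i)) => Pi; last first.
  by apply: (regular_ext _ IH) => x; rewrite big_cons (negPf Pi).
apply: (@regular_ext _ _
  (fun x => f i x + \sum_(j <- r | P j) f j x)) => [x|].
  by rewrite big_cons Pi.
by apply: regularD; [|exact: rf|exact: IH].
Qed.

Lemma regular_prod X (U : set X) (I : Type) (r : seq I) (P : pred I)
    (f : I -> X -> K) : open U -> (forall i, P i -> regular U (f i)) ->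
  regular U (fun x => \prod_(i <- r | P i) f i x).
Proof.
move=> oU rf; elim: r => [|i r IH].
  apply: (@regular_ext _ _ (fun=> 1)) => [x|]; first by rewrite big_nil.
  exact: regular_cst.
case: (boolP (P i)) => Pi; last first.
  by apply: (regular_ext _ IH) => x; rewrite big_cons (negPf Pi).
apply: (@regular_ext _ _
  (fun x => f i x * \prod_(j <- r | P j) f j x)) => [x|].
  by rewrite big_cons Pi.
by apply: regularM; [|exact: rf|exact: IH].
Qed.

Lemma regularN X (U : set X) (f : X -> K) : open U -> regular U f ->
  regular U (fun x => - f x).
Proof.
move=> oU rf; apply: (@regular_ext _ _ (fun x => -1 * f x)) => [x|].
  by rewrite mulN1r.
by apply: regularM => //; exact: regular_cst.
Qed.

Lemma regularX X (U : set X) (f : X -> K) n : open U -> regular U f ->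
  regular U (fun x => f x ^+ n).
Proof.
move=> oU rf; elim: n => [|n IH].
  by apply: (regular_ext _ (regular_cst _ 1 oU)) => x; rewrite expr0.
by apply: (regular_ext _ (regularM _ _ _ oU rf IH)) => x; rewrite exprS.
Qed.

Lemma regular_inv X (f : X -> K) : regular setT f -> (forall x, f x != 0) ->
  regular setT (fun x => (f x)^-1).
Proof.
move=> rf f0; have [_] := regularV _ _ openT rf.
by rewrite setTI (_ : [set x | f x != 0] = setT)// -subTset => x _ /=.
Qed.

Lemma regularXz X (f : X -> K) (n : int) : regular setT f ->
  (forall x, f x != 0) -> regular setT (fun x => f x ^ n).
Proof.
move=> rf f0; case: n => n; first by apply: regularX; [exact: openT|].
by apply: regular_inv => [|x]; [apply: regularX; [exact: openT|]|rewrite expf_neq0].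
Qed.

(** Affine, projective and product spaces describe their regular functions by
local fractions; this turns such a description back into regularity. *)
Lemma regular_local_frac X (U : set X) (f : X -> K) : open U ->
  (forall x, U x -> exists (V : set X) (a b : X -> K),
    [/\ open V, V x, regular V a & regular V b] /\
    b x != 0 /\ forall y, U y -> V y -> b y != 0 -> f y = a y / b y) ->
  regular U f.
Proof.
move=> oU H; apply: regular_glue => // x Ux.
have [V [a [b [[oV Vx ra rb] [bx fab]]]]] := H x Ux.
have oW : open (U `&` V) by exact: openI.
have rb' : regular (U `&` V) b by apply: regular_sub rb => // ? [].
have [oN rN] := regularV _ _ oW rb'.
exists (U `&` V `&` [set x | b x != 0]); split=> //; first by move=> y [[]].
apply: (@regular_eq _ _ _ (fun y => a y * (b y)^-1)) => //.
  by move=> y [[Uy Vy] by0]; rewrite fab.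
by apply: regularM => //; apply: regular_sub ra => // y [[]].
Qed.

Lemma open_neq0 X (f : X -> K) : regular setT f -> open [set x | f x != 0].
Proof. by move=> /(regularV _ _ openT) [+ _]; rewrite setTI. Qed.

Lemma closed_eq0 X (f : X -> K) : regular setT f -> closed [set x | f x = 0].
Proof.
move=> /open_neq0; rewrite -closedC; congr closed.
apply/seteqP; split=> x /=; first by move/negP; rewrite negbK => /eqP.
by move=> ->; rewrite eqxx.
Qed.

Lemma morphism_val X (A : set X) : morphism (val : A -> X).
Proof.
split=> [|V h oV rh].
  by apply/continuousP => V oV; apply/sub_openP; exists V.
by move=> x Vx; exists V, h; split.
Qed.

Lemma morphism_into X Y (A : set Y) (f : X -> A) :
  morphism (fun x => val (f x)) -> morphism f.
Proof.
move=> [cf rf]; split=> [|V h oV rh].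
  apply/continuousP => V /sub_openP [W oW <-]; exact: (open_preimage cf).
have cf' : open (f @^-1` V).
  by move: oV => /sub_openP [W oW <-]; exact: (open_preimage cf).
apply: regular_glue => // x Vfx.
have [W [g [oW Wfx rg hg]]] := rh _ Vfx.
have oW' := open_preimage cf oW.
have oI : open (f @^-1` V `&` (val \o f) @^-1` W) by exact: openI.
exists (f @^-1` V `&` (val \o f) @^-1` W); split=> //.
apply: (@regular_eq _ _ _ (g \o (fun y => val (f y)))) => //.
  by move=> y [Vy Wy] /=; rewrite hg.
by apply: regular_sub (rf _ _ oW rg) => // y [].
Qed.

Lemma setT_isomorphic X : isomorphic (set_type [set: X]) X.
Proof.
exists val; split; first exact: morphism_val.
exists (fun x => SigSub (mem_set (I : [set: X] x))); split=> //.
- by apply: morphism_into; exact: morphism_id.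
- by move=> x; exact: val_inj.
Qed.

Lemma morphism_fst X Y : morphism (fst : prod_space X Y -> X).
Proof.
have o1 (U : set X) : open U -> open (fst @^-1` U : set (prod_space X Y)).
  move=> oU; rewrite open_prod => z Uz; exists U, setT, (fun=> 1).
  split; first by split=> //; [exact: openT|apply: tensor_cst => //; exact: openT].
  by split; first by split=> //; exact: oner_neq0.
split=> [|V h oV rh]; first exact/continuousP.
move=> z Vz; exists V, setT, (h \o fst), (fun=> 1).
split.
  split=> //; [exact: openT| |apply: tensor_cst => //; exact: openT].
  exists unit, (fun=> h), (fun _ _ => 1); split=> // [_|w].
    by apply: regular_cst; exact: openT.
  by rewrite big_const card_unit /= mulr1 addr0.
split; first by split=> //; exact: oner_neq0.
by move=> *; rewrite divr1.
Qed.

Lemma morphism_snd X Y : morphism (snd : prod_space X Y -> Y).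
Proof.
have o1 (U : set Y) : open U -> open (snd @^-1` U : set (prod_space X Y)).
  move=> oU; rewrite open_prod => z Uz; exists setT, U, (fun=> 1).
  split; first by split=> //; [exact: openT|apply: tensor_cst => //; exact: openT].
  by split; first by split=> //; exact: oner_neq0.
split=> [|V h oV rh]; first exact/continuousP.
move=> z Vz; exists setT, V, (h \o snd), (fun=> 1).
split.
  split=> //; [exact: openT| |apply: tensor_cst => //; exact: openT].
  exists unit, (fun _ _ => 1), (fun=> h); split=> // [_|w].
    by apply: regular_cst; exact: openT.
  by rewrite big_const card_unit /= mul1r addr0.
split; first by split=> //; exact: oner_neq0.
by move=> *; rewrite divr1.
Qed.

Lemma morphism_pair X Y Z (f : Z -> X) (g : Z -> Y) :
  morphism f -> morphism g -> morphism (fun z => (f z, g z) : prod_space X Y).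
Proof.
move=> [cf rf] [cg rg].
have tp (U : set X) (V : set Y) h : open U -> open V -> tensor U V h ->
    regular (f @^-1` U `&` g @^-1` V) (fun z => h (f z, g z)).
  move=> oU oV [I [a [b [ra rb hab]]]].
  have oU' := open_preimage cf oU; have oV' := open_preimage cg oV.
  have oI : open (f @^-1` U `&` g @^-1` V) by exact: openI.
  apply: (regular_ext (fun z => esym (hab _))).
  apply: regular_sum => // i _; apply: regularM => //.
    by apply: regular_sub (rf _ _ oU (ra i)) => // ? [].
  by apply: regular_sub (rg _ _ oV (rb i)) => // ? [].
have op : continuous (fun z => (f z, g z) : prod_space X Y).
  apply/continuousP => W; rewrite open_prod => oW; apply: open_local => z Wz.
  have [U [V [h [[oU oV th] [[Uz Vz hz] H]]]]] := oW _ Wz.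
  have oI : open (f @^-1` U `&` g @^-1` V).
    by apply: openI; [exact: (open_preimage cf oU)|exact: (open_preimage cg oV)].
  have [oN _] := regularV _ _ oI (tp _ _ _ oU oV th).
  exists (f @^-1` U `&` g @^-1` V `&` [set z | h (f z, g z) != 0]).
  by split=> // y [[Uy Vy] hy]; exact: H.
split=> // W h oW rh; apply: regular_local_frac => [|z Wz].
  by apply: (open_preimage op).
have [U [V [a [b [[oU oV ta tb] [[Uz Vz bz] H]]]]]] := rh _ Wz.
exists (f @^-1` U `&` g @^-1` V), (fun z => a (f z, g z)), (fun z => b (f z, g z)).
split.
  split=> //; [|exact: tp|exact: tp].
  by apply: openI; [exact: (open_preimage cf oU)|exact: (open_preimage cg oV)].
by split=> // y Wy [Uy Vy] by0 /=; rewrite H.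
Qed.

Lemma peval_X (I : finType) (i : 'I_#|I|) (x : affine K I) :
  peval 'X_i x = x (enum_val i).
Proof. by rewrite /peval mevalXU. Qed.

Lemma peval_coord (I : finType) (i : I) (x : affine K I) :
  peval 'X_(enum_rank i) x = x i.
Proof. by rewrite peval_X enum_rankK. Qed.

Lemma pevalZ (I : finType) c (p : {mpoly K[#|I|]}) (x : affine K I) :
  peval (c *: p) x = c * peval p x.
Proof. exact: mevalZ. Qed.

Lemma pevalN (I : finType) (p : {mpoly K[#|I|]}) (x : affine K I) :
  peval (- p) x = - peval p x.
Proof. exact: mevalN. Qed.

Lemma pevalXn (I : finType) (p : {mpoly K[#|I|]}) k (x : affine K I) :
  peval (p ^+ k) x = peval p x ^+ k.
Proof. exact: rmorphXn. Qed.

Lemma peval_sum (I : finType) (J : Type) (r : seq J) (P : pred J)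
    (F : J -> {mpoly K[#|I|]}) (x : affine K I) :
  peval (\sum_(j <- r | P j) F j) x = \sum_(j <- r | P j) peval (F j) x.
Proof. exact: raddf_sum. Qed.

Lemma regular_peval (I : finType) (p : {mpoly K[#|I|]}) :
  regular setT (peval p : affine K I -> K).
Proof.
move=> x _; exists p, 1%:MP; rewrite pevalC oner_neq0; split=> // y _ _.
by rewrite pevalC divr1.
Qed.

Lemma regular_coord (I : finType) (i : I) :
  regular setT (fun x : affine K I => x i).
Proof.
rewrite (_ : (fun _ => _) = peval 'X_(enum_rank i)); first exact: regular_peval.
by apply/funext => x; rewrite peval_coord.
Qed.

Lemma pevalE (I : finType) (p : {mpoly K[#|I|]}) (x : affine K I) :
  peval p x = \sum_(m <- msupp p) p@_m * \prod_i x (enum_val i) ^+ m i.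
Proof. by rewrite /peval mevalE. Qed.

Lemma regular_peval_comp X (U : set X) (I : finType) (f : X -> affine K I) p :
  open U -> (forall i, regular U (fun x => f x i)) ->
  regular U (fun x => peval p (f x)).
Proof.
move=> oU rf; apply: (regular_ext (fun x => esym (pevalE _ _))).
apply: regular_sum => // m _; apply: regularM; [by []|exact: regular_cst|].
by apply: regular_prod => // i _; exact: regularX.
Qed.

(** Basic open sets and local fractions are given by polynomials, and polynomials
in regular functions are regular, so that it suffices to look at coordinates. *)
Lemma morphism_affine X (I : finType) (f : X -> affine K I) :
  (forall i, regular setT (fun x => f x i)) -> morphism f.
Proof.
move=> rf.
have rp p : regular setT (fun x => peval p (f x)).
  by apply: regular_peval_comp => //; exact: openT.
have cf : continuous f.
  apply/continuousP => W; rewrite open_affine => /affine_openP oW.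
  apply: open_local => x /oW [p [px pW]].
  by exists [set x | peval p (f x) != 0]; split=> // [|y /pW]; first exact: open_neq0.
split=> // W h oW rh; apply: regular_local_frac => [|x Wx].
  exact: (open_preimage cf oW).
have [p [q [qx H]]] := rh _ Wx.
exists setT, (fun x => peval p (f x)), (fun x => peval q (f x)).
split; first by split=> //; exact: openT.
by split=> // y Wy _; exact: H.
Qed.

Lemma affine_coord_regular X (I : finType) (A : set (affine K I)) (f : X -> A) i :
  morphism f -> regular setT (fun x => val (f x) i).
Proof.
move=> mf.
apply: (@regular_comp X _ (val \o f) (fun x : affine K I => x i)).
  by apply: morphism_comp mf _; exact: morphism_val.
exact: regular_coord.
Qed.

Lemma scale_peval (I : finType) (p : {mpoly K[#|I|]}) d c (v : affine K I) :
  p \is d.-homog -> peval p (scale c v) = c ^+ d * peval p v.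
Proof.
move=> /dhomogP hp; rewrite !pevalE big_distrr/=; apply: eq_big_seq => m mp.
rewrite mulrCA; congr (_ * _).
under eq_bigr do rewrite ffunE exprMn.
by rewrite big_split/= prodrXr -mdegE (hp m mp).
Qed.

(** The representative [coords (f x)] differs from [v x] by a scalar; it changes
neither the vanishing of a homogeneous polynomial nor a ratio of two such
polynomials of the same degree. *)
Lemma morphism_proj X (I : finType) (v : X -> affine K I) (f : X -> proj K I)
    (v0 : forall x, punctured (v x)) :
  (forall i, regular setT (fun x => v x i)) ->
  (forall x, f x = point_of (SigSub (mem_set (v0 x)))) -> morphism f.
Proof.
move=> rv fE.
have rp p : regular setT (fun x => peval p (v x)).
  by apply: regular_peval_comp => //; exact: openT.
have cE x : exists2 c, c != 0 & coords (f x) = scale c (v x).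
  by rewrite fE; exact: coords_point_of.
have p0 p d x : p \is d.-homog ->
    (peval p (coords (f x)) != 0) = (peval p (v x) != 0).
  have [c c0 ->] := cE x; move=> /scale_peval ->.
  by rewrite mulf_eq0 expf_eq0 (negPf c0) andbF.
have cf : continuous f.
  apply/continuousP => W; rewrite open_proj => /proj_openP oW.
  apply: open_local => x /oW [p [d [dp px pW]]].
  exists [set x | peval p (v x) != 0]; split=> // [|/=|y /= py].
  - exact: open_neq0.
  - by rewrite -(p0 _ _ _ dp).
  - by apply: pW; rewrite (p0 _ _ _ dp).
split=> // W h oW rh; apply: regular_local_frac => [|x Wx].
  exact: (open_preimage cf oW).
have [p [q [d [dp dq qx H]]]] := rh _ Wx.
exists setT, (fun x => peval p (v x)), (fun x => peval q (v x)).
split; first by split=> //; exact: openT.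
split=> [|y Wy _ qy]; first by rewrite -(p0 _ _ _ dq).
rewrite /= H ?(p0 _ _ _ dq)//; have [c c0 ->] := cE y.
by rewrite (scale_peval _ _ dp) (scale_peval _ _ dq) -mulf_div divff ?mul1r ?expf_neq0.
Qed.

Lemma regular_coords_ratio (I : finType) (A : set (proj K I)) (i j : I) :
  (forall x, A x -> coords x j != 0) ->
  regular setT (fun x : A => coords (val x) i / coords (val x) j).
Proof.
move=> Aj x _.
have hX (k : I) : ('X_(enum_rank k) : {mpoly K[#|I|]}) \is 1.-homog.
  by rewrite dhomogX; apply/eqP; exact: mdeg1.
exists [set x | peval 'X_(enum_rank j) (coords x) != 0],
  (fun x => coords x i / coords x j).
split=> //.
- rewrite open_proj; apply/proj_openP => y yj; exists 'X_(enum_rank j), 1%N.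
  by split.
- by rewrite /= peval_coord; exact/Aj/set_valP.
- move=> y /= yj; exists 'X_(enum_rank i), 'X_(enum_rank j), 1%N.
  by split=> // z _ _; rewrite !peval_coord.
Qed.

End Morphisms.

(** * Krull dimension of open subsets of affine space *)

Lemma irreducible_chain_homeo (X Y : topologicalType) (f : X -> Y) (g : Y -> X) :
  continuous f -> continuous g -> cancel f g -> cancel g f -> forall d Z,
  irreducible_chain d Z -> irreducible_chain d (fun i => g @^-1` (Z i)).
Proof.
move=> cf cg fg gf d Z [HZ SZ]; split=> i lid.
  have [cZ [[x Zx] iZ]] := HZ i lid; split; first exact: closed_preimage.
  split=> [|F G cF cG sFG]; first by exists (f x); rewrite /= fg.
  have cF' := closed_preimage cf cF; have cG' := closed_preimage cf cG.
  have [|sF|sG] := iZ _ _ cF' cG'.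
  - by move=> y Zy; apply: (sFG (f y)); rewrite /= fg.
  - by left=> y /sF /=; rewrite gf.
  - by right=> y /sG /=; rewrite gf.
have [sZ nZ] := SZ i lid; split=> [y|/= H]; first exact: sZ.
by apply: nZ => x Zx; have := H (f x); rewrite /= fg; apply.
Qed.

Lemma has_dim_homeo (X Y : topologicalType) (f : X -> Y) (g : Y -> X) d :
  continuous f -> continuous g -> cancel f g -> cancel g f ->
  has_dim X d -> has_dim Y d.
Proof.
move=> cf cg fg gf [[Z HZ] ub]; split.
  by exists (fun i => g @^-1` (Z i)); exact: irreducible_chain_homeo HZ.
by move=> e Z' /(irreducible_chain_homeo cg cf gf fg); exact: ub.
Qed.

Section Lines.
Variables (K : numFieldType) (I : finType).
Local Notation A := (affine K I).

Definition line (x y : A) (s : K) : A := [ffun i => x i + s * (y i - x i)].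

Definition line_closed (L : set A) := forall x y s, L x -> L y -> L (line x y s).

Lemma line0 x y : line x y 0 = x.
Proof. by apply/ffunP => i; rewrite ffunE mul0r addr0. Qed.

Lemma line1 x y : line x y 1 = y.
Proof. by apply/ffunP => i; rewrite ffunE mul1r addrCA subrr addr0. Qed.

Lemma peval_line (p : {mpoly K[#|I|]}) x y :
  exists q : {poly K}, forall s, q.[s] = peval p (line x y s).
Proof.
exists (\sum_(m <- msupp p) (p@_m)%:P *
  \prod_i ((x (enum_val i))%:P + 'X * (y (enum_val i) - x (enum_val i))%:P) ^+ m i).
move=> s; rewrite pevalE horner_sum; apply: eq_bigr => m _.
rewrite hornerM hornerC horner_prod; congr (_ * _); apply: eq_bigr => i _.
by rewrite horner_exp ffunE !hornerE.
Qed.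

Lemma poly_nonroot (q : {poly K}) : q != 0 -> exists s, q.[s] != 0.
Proof.
move=> q0; apply: contrapT => /forallNP H.
suff : (size [seq k%:R : K | k <- iota 0 (size q)] < size q)%N.
  by rewrite size_map size_iota ltnn.
apply: max_poly_roots => //.
  by apply/allP => s _; apply/rootP/eqP; apply: contrapT => /negP; exact: H.
by rewrite map_inj_uniq ?iota_uniq// => i j /eqP; rewrite eqr_nat => /eqP.
Qed.

(** Two polynomials which are not identically zero on [L] restrict to non-zero
polynomials in one variable on the line joining witnesses of this. *)
Lemma common_nonzero (L : set A) (p q : {mpoly K[#|I|]}) x y : line_closed L ->
  L x -> L y -> peval p x != 0 -> peval q y != 0 ->
  exists2 w, L w & peval (p * q) w != 0.
Proof.
move=> Ll Lx Ly px qy.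
have [p' p'E] := peval_line p x y; have [q' q'E] := peval_line q x y.
have [|s] := @poly_nonroot (p' * q').
  rewrite mulf_neq0//.
    by apply: contraNneq px => p0; rewrite -[x](line0 x y) -p'E p0 horner0.
  by apply: contraNneq qy => q0; rewrite -[y](line1 x y) -q'E q0 horner0.
by rewrite hornerM p'E q'E -pevalM; exists (line x y s) => //; exact: Ll.
Qed.

End Lines.

Section Dimension.
Variables (K : numFieldType) (I : finType) (X : topologicalType).
Local Notation A := (affine K I).
(** The topology of [X] is the one induced by the Zariski topology of an affine
space along [iota]. *)
Variable iota : X -> A.
Hypothesis iota_cont : continuous iota.
Hypothesis iota_closed : forall F : set X, closed F ->
  exists2 G : set A, closed G & F = iota @^-1` G.
Local Notation ev p x := (peval p (iota x)).

Let closed_sep (F : set X) x : closed F -> ~ F x ->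
  exists2 p, ev p x != 0 & forall y, F y -> ev p y = 0.
Proof.
move=> /iota_closed [G + ->] nGx.
rewrite -openC open_affine => /affine_openP /(_ _ nGx) [p [px pG]].
by exists p => // y Gy; apply/eqP; apply: contraPT Gy => /pG.
Qed.

Let closed_zero p : closed [set x | ev p x = 0].
Proof.
exact: (closed_preimage iota_cont (closed_eq0 (regular_peval p))).
Qed.

Section UpperBound.
Variables (e : nat) (Z : nat -> set X) (g : nat -> {mpoly K[#|I|]}).
Hypothesis irrZ : forall i, (i <= e)%N -> irreducible (Z i).
Hypothesis subZ : forall i, (i < e)%N -> Z i `<=` Z i.+1.
Hypothesis gZ : forall i x, (i < e)%N -> Z i x -> ev (g i) x = 0.
Hypothesis gnZ : forall i, (i < e)%N -> ~ (Z i.+1 `<=` [set x | ev (g i) x = 0]).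
Variable N : nat.

(** Exponents less than [N] for [g 0], ..., [g i.-1], as nested pairs: inductions
split off the exponent of the last one. *)
Fixpoint box (i : nat) : finType :=
  if i is j.+1 then (box j * 'I_N)%type : finType else unit.

Fixpoint gmon (i : nat) : box i -> {mpoly K[#|I|]} :=
  if i is j.+1 then fun b : box j * 'I_N => gmon b.1 * g j ^+ b.2
  else fun=> 1.

Lemma card_box i : #|box i| = (N ^ i)%N.
Proof.
by elim: i => [|i IH]; rewrite ?card_unit//= card_prod IH card_ord expnSr.
Qed.

(** Induction on [i].  In a relation on [Z i.+1], the smallest power of [g i]
that occurs can be cancelled since [Z i.+1] is irreducible; restricting to
[Z i], where [g i] vanishes, then leaves a relation between the previous
monomials. *)
Lemma gmon_free i (c : box i -> K) : (i <= e)%N ->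
  (forall x, Z i x -> \sum_b c b * ev (gmon b) x = 0) -> forall b, c b = 0.
Proof.
elim: i c => [|i IH] c lie Hc.
  have [[x Zx] _] := irrZ lie; case.
  have := Hc x Zx; rewrite (bigD1 tt)//= big1 ?addr0 => [|[]//].
  by rewrite -mpolyC1 pevalC mulr1.
move=> [b a]; move: b; rewrite -/box.
have [n] := ubnP a; elim: n a => // n IHn a; rewrite ltnS => lan.
have c0 (a' : 'I_N) (b : box i) : (a' < a)%N -> c (b, a') = 0.
  by move=> la; apply: IHn; exact: leq_trans la lan.
pose Q := \sum_(b : box i) \sum_(a' < N | (a <= a')%N)
  (c (b, a') *: (gmon b * g i ^+ (a' - a))).
have evQ x : ev Q x = \sum_(b : box i) \sum_(a' < N | (a <= a')%N)
    (c (b, a') * (ev (gmon b) x * ev (g i) x ^+ (a' - a))).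
  rewrite /Q peval_sum; apply: eq_bigr => b _.
  rewrite peval_sum; apply: eq_bigr => a' _.
  by rewrite pevalZ pevalM pevalXn.
have sumE x : \sum_(b : box i.+1) c b * ev (gmon b) x =
    \sum_(b : box i) \sum_(a' < N)
      c (b, a') * (ev (gmon b) x * ev (g i) x ^+ a').
  rewrite pair_bigA; apply: eq_bigr => -[b a'] _ /=.
  by rewrite pevalM pevalXn.
have QZ x : Z i.+1 x -> ev Q x = 0.
  have iZ := (irrZ lie).2 _ _ (@closed_zero (g i)) (@closed_zero Q).
  have [y Zy|/(gnZ lie)//|H /H //] := iZ.
  suff /eqP : ev (g i) y ^+ a * ev Q y = 0.
    by rewrite mulf_eq0 expf_eq0 => /orP [/andP [_ /eqP ?]|/eqP ?]; [left|right].
  rewrite evQ -[RHS](Hc y Zy) sumE big_distrr/=; apply: eq_bigr => b _.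
  rewrite big_distrr/= [RHS](bigID (fun a' : 'I_N => (a <= a')%N))/=.
  rewrite [X in _ + X]big1 ?addr0 => [|a']; last first.
    by rewrite -ltnNge => /c0 ->; rewrite mul0r.
  apply: eq_bigr => a' laa; rewrite mulrCA; congr (_ * _).
  by rewrite mulrCA -exprD subnKC.
move=> b; apply: (IH (fun b => c (b, a)) (ltnW lie)) => x Zx.
rewrite -[RHS](QZ x (subZ lie Zx)) evQ; apply: eq_bigr => b' _.
rewrite (bigD1 a)//= subnn expr0 mulr1 big1 ?addr0// => a' /andP [laa na].
rewrite (gZ lie Zx) expr0n subn_eq0.
case: leqP => [laa'|]; last by rewrite !mulr0.
by case/negP: na; rewrite -val_eqE eqn_leq laa laa'.
Qed.

Lemma msizeM_leq n (p q : {mpoly K[n]}) a b :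
  (msize p <= a.+1)%N -> (msize q <= b.+1)%N -> (msize (p * q) <= (a + b).+1)%N.
Proof.
have [->|p0] := eqVneq p 0; first by rewrite mul0r msize0.
have [->|q0] := eqVneq q 0; first by rewrite mulr0 msize0.
move=> pa qb; rewrite msizeM//; apply: (@leq_trans (a.+1 + b.+1).-1).
  by rewrite -!subn1 leq_sub2r// leq_add.
by rewrite addnS addSn.
Qed.

Lemma msize_gmon G i (b : box i) :
  (forall j, (j < i)%N -> (msize (g j) <= G.+1)%N) ->
  (msize (gmon b) <= (i * N * G).+1)%N.
Proof.
elim: i b => [|i IH] b gG; first by rewrite msize1.
case: b => b a /=; rewrite mulSn mulnDl addnC; apply: msizeM_leq.
  by apply: IH => j ji; apply: gG; exact: ltnW.
have ga k : (msize (g i ^+ k) <= (k * G).+1)%N.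
  elim: k => [|k IHk]; first by rewrite expr0 msize1.
  by rewrite exprS mulSn; apply: msizeM_leq; [exact: gG|].
by apply: leq_trans (ga a) _; rewrite ltnS leq_mul2r (ltnW (ltn_ord a)) orbT.
Qed.

Lemma card_bmultinom n b : (#|{: 'X_{1..n < b.+1}}| <= b.+1 ^ n)%N.
Proof.
rewrite -[n in leqRHS]card_ord -[b.+1 in leqRHS]card_ord -card_ffun.
pose f (m : 'X_{1..n < b.+1}) : {ffun 'I_n -> 'I_b.+1} :=
  [ffun i => inord ((m : 'X_{1..n}) i)].
apply: (@leq_card _ _ f) => m m' /ffunP H.
apply/val_inj/mnmP => i; have := congr1 val (H i); rewrite !ffunE/=.
have lt (k : 'X_{1..n < b.+1}) : ((k : 'X_{1..n}) i < b.+1)%N.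
  by apply: leq_ltn_trans (bmdeg k); rewrite mdegE (bigD1 i)//= leq_addr.
by rewrite !inordK// ?lt.
Qed.

(** The monomials of [gmon_free] are linearly independent polynomials whose
degrees are at most [e * N * G]. *)
Lemma box_bound G : (forall j, (j < e)%N -> (msize (g j) <= G.+1)%N) ->
  (N ^ e <= (e * N * G).+1 ^ #|I|)%N.
Proof.
move=> gG; rewrite -(card_box e); apply: leq_trans (card_bmultinom _ _).
set M := (e * N * G)%N.
pose T := 'X_{1..#|I| < M.+1}.
pose C := \matrix_(k < #|box e|, m < #|{: T}|)
  (gmon (enum_val k))@_(enum_val m : 'X_{1..#|I|}).
suff /eqP <- : row_free C by exact: rank_leq_col.
apply: inj_row_free => v vC; apply/rowP => k; rewrite mxE.
have H0 : \sum_(k < #|box e|) v 0 k *: gmon (enum_val k) = 0.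
  apply/mpolyP => m; rewrite mcoeff0 raddf_sum/=.
  have [mM|Mm] := ltnP (mdeg m) M.+1.
    have := congr1 (fun w : 'rV_#|{: T}| => w 0 (enum_rank (BMultinom mM : T))) vC.
    rewrite !mxE => E; rewrite -[RHS]E; apply: eq_bigr => j _.
    by rewrite mcoeffZ mxE enum_rankK.
  apply: big1 => j _; rewrite mcoeffZ memN_msupp_eq0 ?mulr0//.
  by apply: msize_mdeg_ge; apply: leq_trans Mm; exact: msize_gmon.
have := @gmon_free e (fun b => v 0 (enum_rank b)) (leqnn _).
move=> /(_ _ (enum_val k)); rewrite enum_valK; apply => x _.
have := congr1 (fun p => ev p x) H0; rewrite peval_sum.
rewrite -[X in _ = peval X _ -> _]mpolyC0 pevalC => E; rewrite -[RHS]E.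
rewrite (reindex (enum_val : 'I_#|box e| -> _))/=; last first.
  by apply: onW_bij; exact: enum_val_bij.
by apply: eq_bigr => j _; rewrite enum_valK pevalZ.
Qed.

End UpperBound.

Lemma chain_le_dim e (Z : nat -> set X) : irreducible_chain e Z -> (e <= #|I|)%N.
Proof.
move=> [HZ SZ].
have /choice [g Hg] i : exists p, (i < e)%N ->
    (forall x, Z i x -> ev p x = 0) /\ ~ (Z i.+1 `<=` [set x | ev p x = 0]).
  have [lie|] := ltnP i e; last by exists 0.
  have [_ nsub] := SZ i lie.
  have [x [Zx nZx]] : exists x, Z i.+1 x /\ ~ Z i x.
    apply: contrapT => /forallNP H; apply: nsub => x Zx; apply: contrapT => nZ.
    by apply: (H x).
  have [p px pZ] := closed_sep (HZ i (ltnW lie)).1 nZx.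
  by exists p => _; split=> // /(_ x Zx) /=; apply/eqP.
pose G := (\max_(j < e) msize (g j))%N.
have gG j : (j < e)%N -> (msize (g j) <= G.+1)%N.
  move=> je; apply: leqW.
  exact: (leq_bigmax (F := fun j : 'I_e => msize (g j)) (Ordinal je)).
have B N := @box_bound e Z g (fun i h => (HZ i h).2) (fun i h => (SZ i h).1)
  (fun i x h => (Hg i h).1 x) (fun i h => (Hg i h).2) N G gG.
rewrite leqNgt; apply/negP => lt.
set d := #|I| in B lt; pose c := (e * G).+1.
(* Both sides of the bound grow like powers of N, the left one with the larger
exponent; this N beats the constant c ^ d. *)
pose N := (c ^ d).+1.
have : (N ^ d.+1 <= c ^ d * N ^ d)%N.
  rewrite -expnMn; apply: leq_trans (leq_trans (leq_pexp2l _ lt) (B N)) _ => //.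
  have le_cN : ((e * N * G).+1 <= c * N)%N.
    by rewrite /c mulSn mulnAC -addn1 addnC leq_add2r.
  by elim: (d) => // k IHk; rewrite !expnS leq_mul.
by rewrite expnS leq_pmul2r ?expn_gt0// ltnn.
Qed.

Section LowerBound.
Variables (x0 : X) (p0 : {mpoly K[#|I|]}).
Hypothesis p0_x0 : ev p0 x0 != 0.
Hypothesis p0_range : forall v, peval p0 v != 0 -> exists x, iota x = v.

Let flag (i : nat) : set A := [set v | forall k : 'I_#|I|, (i <= k)%N ->
  v (enum_val k) = iota x0 (enum_val k)].

Let flag_line i : line_closed (flag i).
Proof. by move=> x y s Lx Ly k ik; rewrite ffunE Lx// Ly// subrr mulr0 addr0. Qed.

Let flag_x0 i : flag i (iota x0).
Proof. by []. Qed.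

(** Irreducibility and strictness both come from [common_nonzero], with [p0] as
one of the polynomials in order to end up in the range of [iota]. *)
Lemma flag_chain : irreducible_chain #|I| (fun i => iota @^-1` flag i).
Proof.
split=> i lid.
  split.
    apply: closed_preimage => //.
    rewrite (_ : flag i = \bigcap_(k in [set k : 'I_#|I| | (i <= k)%N])
      [set v | v (enum_val k) - iota x0 (enum_val k) = 0]).
      apply: closed_bigI => k _; apply: closed_eq0.
      apply: regularD; [exact: openT|exact: regular_coord|].
      by apply: regular_cst; exact: openT.
    apply/seteqP; split=> [v Lv k ik/=|v Lv k ik]; first by rewrite Lv ?subrr.
    by apply/eqP; rewrite -subr_eq0; apply/eqP/Lv.
  split=> [|F G cF cG sFG]; first by exists x0.
  have [?|/existsNP[x /not_implyP [Zx nFx]]] := pselect (iota @^-1` flag i `<=` F).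
    by left.
  right=> y Zy; apply: contrapT => nGy.
  have [f fx fF] := closed_sep cF nFx; have [g gy gG] := closed_sep cG nGy.
  have [w Lw w0] := common_nonzero (@flag_line i) Zx Zy fx gy.
  have [v Lv] := common_nonzero (@flag_line i) Lw (@flag_x0 i) w0 p0_x0.
  rewrite !pevalM !mulf_eq0 !negb_or => /andP [/andP [fv gv] pv].
  have [z zv] := p0_range pv; rewrite -zv in fv gv Lv.
  by case: (sFG z Lv) => [/fF|/gG] E; [rewrite E eqxx in fv|rewrite E eqxx in gv].
split=> [x Lx k ik|/= H]; first by apply: Lx; exact: ltnW.
pose k := Ordinal lid; pose a := iota x0 (enum_val k).
pose q : {mpoly K[#|I|]} := 'X_k - a%:MP.
have qE v : peval q v = v (enum_val k) - a by rewrite pevalD pevalN pevalC peval_X.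
pose y : A := [ffun j => iota x0 j + (j == enum_val k)%:R].
have Ly : flag i.+1 y.
  move=> j ij; rewrite ffunE (inj_eq enum_val_inj) (_ : j == k = false) ?addr0//.
  by apply/negP => /eqP jk; move: ij; rewrite jk ltnn.
have [|v Lv] := common_nonzero (@flag_line i.+1) Ly (@flag_x0 i.+1) (p := q) _ p0_x0.
  by rewrite qE ffunE eqxx addrC addKr oner_neq0.
rewrite pevalM mulf_eq0 negb_or qE => /andP [vk pv].
have [x xv] := p0_range pv; rewrite -xv in Lv vk.
by have := H x Lv k (leqnn _); move/eqP; rewrite -subr_eq0 (negPf vk).
Qed.

Lemma has_dim_open : has_dim X #|I|.
Proof. by split; [eexists; exact: flag_chain|exact: chain_le_dim]. Qed.

End LowerBound.

End Dimension.

(** * Affine varieties and algebraic tori *)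

Section AffineVariety.
Variable K : fieldType.

Lemma affine_variety_iso (X Y : funSpaceType K) :
  isomorphic X Y -> affine_variety Y -> affine_variety X.
Proof. by move=> XY [m [Z [cZ YZ]]]; exists m, Z; split=> //; exact: isomorphic_trans YZ. Qed.

Lemma affine_variety_closed (X : funSpaceType K) (J : finType)
    (Z : set (affine K J)) : closed Z -> isomorphic X Z -> affine_variety X.
Proof.
move=> cZ XZ; apply: affine_variety_iso XZ _.
pose rho (v : affine K J) : affine K 'I_#|J| := [ffun k => v (enum_val k)].
pose sig (w : affine K 'I_#|J|) : affine K J := [ffun j => w (enum_rank j)].
have rhoK : cancel rho sig by move=> v; apply/ffunP => j; rewrite !ffunE enum_rankK.
have sigK : cancel sig rho by move=> v; apply/ffunP => j; rewrite !ffunE enum_valK.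
have mrho : morphism rho.
  apply: morphism_affine => k; apply: (regular_ext _ (regular_coord (enum_val k))).
  by move=> v; rewrite ffunE.
have msig : morphism sig.
  apply: morphism_affine => j; apply: (regular_ext _ (regular_coord (enum_rank j))).
  by move=> v; rewrite ffunE.
have Zr (z : Z) : (sig @^-1` Z) (rho (val z)) by rewrite /= rhoK; exact: set_valP.
have Zs (w : sig @^-1` Z) : Z (sig (val w)) by exact: (set_valP w).
exists #|J|, (sig @^-1` Z); split; first exact: (closed_preimage msig.1 cZ).
exists (fun z => SigSub (mem_set (Zr z))).
split.
  by apply: morphism_into; apply: (morphism_comp _ mrho); exact: morphism_val.
exists (fun w => SigSub (mem_set (Zs w))); split.
- by apply: morphism_into; apply: (morphism_comp _ msig); exact: morphism_val.
- by move=> z; apply: val_inj; rewrite /= rhoK.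
- by move=> w; apply: val_inj; rewrite /= sigK.
Qed.

Lemma affine_variety_separated (X : funSpaceType K) :
  affine_variety X -> Defs.separated X.
Proof.
move=> [m [Z [_ [f [mf [g [_ fg _]]]]]]]; rewrite /Defs.separated.
rewrite (_ : [set z | _] = \bigcap_(i in [set: 'I_m])
    [set z : prod_space X X | val (f z.1) i - val (f z.2) i = 0]).
  apply: closed_bigI => i _; apply: closed_eq0.
  have ri := affine_coord_regular i mf.
  apply: regularD; [exact: openT| |apply: regularN; first exact: openT].
    exact: (regular_comp (@morphism_fst _ X X) ri).
  exact: (regular_comp (@morphism_snd _ X X) ri).
apply/seteqP; split=> [[x y] /= -> i _ /=|[x y] H /=]; first by rewrite subrr.
apply: (can_inj fg); apply: val_inj; apply/ffunP => i.
by apply/eqP; rewrite -subr_eq0; apply/eqP/(H i).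
Qed.

Lemma affine_variety_variety (X : funSpaceType K) : affine_variety X -> variety X.
Proof.
move=> aX; split; first exact: affine_variety_separated.
exists 1%N, (fun=> setT); split=> [_|x]; last by exists ord0.
by split; [exact: openT|exact: affine_variety_iso (setT_isomorphic X) aX].
Qed.

End AffineVariety.

Section Tori.
Variable K : fieldType.
Implicit Types I J : finType.

Definition tor_set I : set (affine K I) := [set v | forall i, v i != 0].
Definition tor I := set_type (@tor_set I).

Lemma tor_neq0 I (u : tor I) i : val u i != 0.
Proof. exact: (set_valP u). Qed.

Lemma tor_of_subproof I (f : I -> K) :
  tor_set [ffun i => if f i == 0 then 1 else f i].
Proof. by move=> i; rewrite ffunE; case: ifP => [_|/negbT//]; exact: oner_neq0. Qed.

(** Vanishing values are replaced by one, so that [tor_of] is total. *)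
Definition tor_of I (f : I -> K) : tor I := SigSub (mem_set (tor_of_subproof f)).

Lemma tor_ofE I (f : I -> K) i : f i != 0 -> val (tor_of f) i = f i.
Proof. by move=> f0; rewrite ffunE (negPf f0). Qed.

Lemma torP I (u v : tor I) : (forall i, val u i = val v i) -> u = v.
Proof. by move=> H; apply: val_inj; apply/ffunP. Qed.

Lemma regular_tor_coord I i : regular setT (fun u : tor I => val u i).
Proof. exact: affine_coord_regular (morphism_id _). Qed.

Lemma morphism_tor (X : funSpaceType K) I (f : X -> tor I) :
  (forall i, regular setT (fun x => val (f x) i)) -> morphism f.
Proof. by move=> H; apply: morphism_into; exact: morphism_affine. Qed.

Lemma morphism_tor_coord (X : funSpaceType K) I (f : X -> tor I) i :
  morphism f -> regular setT (fun x => val (f x) i).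
Proof. exact: affine_coord_regular. Qed.

Definition tor_mul I (u v : tor I) := tor_of (fun i => val u i * val v i).

Lemma tor_mulE I (u v : tor I) i : val (tor_mul u v) i = val u i * val v i.
Proof. by rewrite tor_ofE// mulf_neq0 ?tor_neq0. Qed.

Definition tor_one I : tor I := tor_of (fun=> 1).

Lemma tor_oneE I i : val (tor_one I) i = 1.
Proof. by rewrite tor_ofE// oner_neq0. Qed.

Definition monom_val I J (E : I -> J -> int) (u : tor I) j :=
  \prod_i val u i ^ E i j.

Lemma monom_val_neq0 I J (E : I -> J -> int) (u : tor I) j : monom_val E u j != 0.
Proof. by apply/prodf_neq0 => i _; rewrite expfz_neq0 ?tor_neq0. Qed.

Definition monom I J (E : I -> J -> int) (u : tor I) : tor J := tor_of (monom_val E u).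

Lemma monomE I J (E : I -> J -> int) u j :
  val (monom E u) j = \prod_i val u i ^ E i j.
Proof. by rewrite tor_ofE// monom_val_neq0. Qed.

Lemma monom_morphism I J (E : I -> J -> int) : morphism (monom E).
Proof.
apply: morphism_tor => j; apply: (regular_ext (fun u => esym (monomE E u j))).
apply: regular_prod => [|i _]; first exact: openT.
by apply: regularXz => [|u]; [exact: regular_tor_coord|exact: tor_neq0].
Qed.

Lemma monomM I J (E : I -> J -> int) u v :
  monom E (tor_mul u v) = tor_mul (monom E u) (monom E v).
Proof.
apply: torP => j; rewrite tor_mulE !monomE -big_split; apply: eq_bigr => i _.
by rewrite tor_mulE exprMz_comm ?unitfE ?tor_neq0//; exact: mulrC.
Qed.

Lemma prodf_exprz (T : Type) (r : seq T) (P : pred T) (F : T -> K) (n : int) :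
  (\prod_(i <- r | P i) F i) ^ n = \prod_(i <- r | P i) F i ^ n.
Proof.
elim/big_rec2: _ => [|i x y _ <-]; first by rewrite exp1rz.
by rewrite expfzMl.
Qed.

Lemma exprz_sum (T : Type) (r : seq T) (P : pred T) (F : T -> int) (x : K) :
  x != 0 -> x ^ (\sum_(i <- r | P i) F i) = \prod_(i <- r | P i) x ^ F i.
Proof.
move=> x0; elim/big_rec2: _ => [|i y z _ <-]; first by rewrite expr0z.
by rewrite expfzDr.
Qed.

Lemma monom_comp I J (L : finType) (E : I -> J -> int) (F : J -> L -> int) u :
  monom F (monom E u) = monom (fun i l => \sum_j E i j * F j l) u.
Proof.
apply: torP => l; rewrite !monomE.
under eq_bigr => j _ do rewrite monomE prodf_exprz.
rewrite exchange_big; apply: eq_bigr => i _ /=.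
rewrite exprz_sum ?tor_neq0//; apply: eq_bigr => j _.
by rewrite exprz_exp.
Qed.

Lemma monom_id I u : monom (fun i j : I => (i == j)%:Z) u = u.
Proof.
apply: torP => j; rewrite monomE (bigD1 j)//= eqxx expr1z big1 ?mulr1// => i ij.
by rewrite (negPf ij) expr0z.
Qed.

Lemma monom_ext I J (E F : I -> J -> int) u :
  (forall i j, E i j = F i j) -> monom E u = monom F u.
Proof.
move=> EF; apply: torP => j; rewrite !monomE; apply: eq_bigr => i _.
by rewrite EF.
Qed.

(** Adding the inverses of the coordinates and of [f] to the coordinates turns
the locus into a closed subset of affine space.  The equations involving [f] and
[g] only make sense on the closed set [Z1] where the coordinates are invertible,
and are imposed there. *)
Lemma affine_variety_tor I (W : set (tor I)) (f g : tor I -> K) :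
  regular setT f -> regular setT g ->
  (forall u, W u <-> f u != 0 /\ g u = 0) -> affine_variety W.
Proof.
move=> rf rg WE.
pose J : finType := option (I + I)%type.
pose Z1 : set (affine K J) :=
  [set v | forall i, v (Some (inl i)) * v (Some (inr i)) = 1].
pose h (v : affine K J) : tor I := tor_of (fun i => v (Some (inl i))).
have Z1_0 (v : Z1) i : val v (Some (inl i)) != 0.
  have := set_valP v i => /eqP; apply: contraTneq => ->.
  by rewrite mul0r eq_sym oner_neq0.
have mh : morphism (fun v : Z1 => h (val v)).
  apply: morphism_tor => i.
  apply: (@regular_ext _ _ _ (fun v : Z1 => val v (Some (inl i)))) => [v|].
    by rewrite tor_ofE.
  exact: affine_coord_regular (morphism_id _).
pose Z : set (affine K J) := [set v | Z1 v /\
  (f (h v) * v None = 1 /\ g (h v) = 0)].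
have cZ1 : closed Z1.
  rewrite (_ : Z1 = \bigcap_(i in [set: I])
      [set v | v (Some (inl i)) * v (Some (inr i)) - 1 = 0]).
    apply: closed_bigI => i _; apply: closed_eq0.
    apply: regularD; [exact: openT| |apply: regular_cst; exact: openT].
    by apply: regularM; [exact: openT|exact: regular_coord|exact: regular_coord].
  apply/seteqP; split=> [v Zv i _/=|v Zv i]; first by rewrite Zv subrr.
  by apply/eqP; rewrite -subr_eq0; apply/eqP/(Zv i).
have cZ : closed Z.
  have := @closedI _ [set v : Z1 | f (h (val v)) * val v None - 1 = 0]
    [set v : Z1 | g (h (val v)) = 0].
  have c1 : closed [set v : Z1 | f (h (val v)) * val v None - 1 = 0].
    apply: closed_eq0; apply: regularD; [exact: openT| |apply: regular_cst; exact: openT].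
    apply: regularM; [exact: openT|exact: (regular_comp mh rf)|].
    exact: affine_coord_regular (morphism_id _).
  have c2 : closed [set v : Z1 | g (h (val v)) = 0].
    by apply: closed_eq0; exact: (regular_comp mh rg).
  move=> /(_ c1 c2); rewrite -openC => /sub_openP [V oV VE].
  rewrite (_ : Z = Z1 `&` ~` V); first by apply: closedI => //; rewrite closedC.
  apply/seteqP; split=> [v [Zv [fv gv]]|v [Zv nV]].
    split=> // Vv; have : (val @^-1` V) (SigSub (mem_set Zv)) by [].
    by rewrite VE => /=; apply; split => /=; rewrite ?fv ?subrr.
  split=> //; have : ~ (val @^-1` V) (SigSub (mem_set Zv)) by [].
  rewrite VE => /contrapT [/= /eqP + ?]; rewrite subr_eq0 => /eqP ?.
  by split.
apply: (affine_variety_closed cZ).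
pose k (u : tor I) : affine K J := [ffun j => match j with
  | Some (inl i) => val u i | Some (inr i) => (val u i)^-1 | None => (f u)^-1 end].
have hk u : h (k u) = u.
  by apply: torP => i; rewrite tor_ofE ffunE// tor_neq0.
have Zk (w : W) : Z (k (val w)).
  have [fw gw] := (WE _).1 (set_valP w).
  split=> [i|]; first by rewrite !ffunE mulfV ?tor_neq0.
  by rewrite hk ffunE mulfV.
have Wh (z : Z) : W (h (val z)).
  have [_ [fz gz]] := set_valP z; apply/WE; split=> //.
  by apply/negP => /eqP f0; move/eqP: fz; rewrite f0 mul0r eq_sym oner_eq0.
have Z_Z1 (z : Z) : Z1 (val z) by case: (set_valP z).
exists (fun w => SigSub (mem_set (Zk w))); split.
  apply: morphism_into; apply: morphism_affine => j /=.
  have mW : morphism (val : W -> tor I) by exact: morphism_val.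
  have rW i : regular setT (fun w : W => val (val w) i) by exact: morphism_tor_coord.
  case: j => [[i|i]|].
  - by apply: (regular_ext _ (rW i)) => w; rewrite ffunE.
  - have := regular_inv (rW i) (fun w => tor_neq0 _ _).
    by apply: regular_ext => w; rewrite ffunE.
  - have f0 (w : W) : f (val w) != 0 by have [] := (WE _).1 (set_valP w).
    have := regular_inv (regular_comp mW rf) f0.
    by apply: regular_ext => w; rewrite ffunE.
exists (fun z => SigSub (mem_set (Wh z))); split.
- apply: morphism_into.
  have m1 : morphism (fun z : Z => SigSub (mem_set (Z_Z1 z)) : Z1).
    by apply: morphism_into; exact: morphism_val.
  exact: (morphism_comp m1 mh).
- by move=> w; apply: val_inj; rewrite /= hk.
- move=> z; apply: val_inj; apply/ffunP => j /=.
  have z0 i : val z (Some (inl i)) != 0 := Z1_0 (SigSub (mem_set (Z_Z1 z))) i.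
  have [z1 [fz gz]] := set_valP z.
  rewrite ffunE; case: j => [[i|i]|].
  - by rewrite tor_ofE.
  - by rewrite tor_ofE//; apply: (mulfI (z0 i)); rewrite z1 mulfV.
  - have f0 : f (h (val z)) != 0 by have [] := (WE _).1 (Wh z).
    by apply: (mulfI f0); rewrite fz mulfV.
Qed.

End Tori.

(** * Quotient maps of tori *)

Section QuotientMaps.
Variable K : fieldType.
Implicit Types X Y Z : funSpaceType K.

Definition quotient_map X Y (f : X -> Y) :=
  [/\ morphism f, forall y, exists x, f x = y,
      forall U : set Y, open (f @^-1` U) -> open U &
      forall (U : set Y) h, open U -> regular (f @^-1` U) (h \o f) -> regular U h].

Lemma quotient_map_comp X Y Z (f : X -> Y) (g : Y -> Z) :
  quotient_map f -> quotient_map g -> quotient_map (g \o f).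
Proof.
move=> [mf sf of_ rf] [mg sg og rg]; split.
- exact: morphism_comp.
- by move=> z; have [y <-] := sg z; have [x <-] := sf y; exists x.
- by move=> U oU; apply: og; apply: of_.
- move=> U h oU rh; apply: rg => //; apply: rf; last exact: rh.
  exact: (open_preimage mg.1 oU).
Qed.

Lemma quotient_map_section X Y (f : X -> Y) (s : Y -> X) :
  morphism f -> morphism s -> cancel s f -> quotient_map f.
Proof.
move=> mf ms sf; split=> // [y|U oU|U h oU rh]; first by exists (s y).
  have := open_preimage ms.1 oU.
  by congr open; apply/seteqP; split=> y /=; rewrite sf.
have oU' := open_preimage mf.1 oU.
have := ms.2 _ _ oU' rh.
rewrite (_ : s @^-1` _ = U); first by apply: regular_ext => y /=; rewrite sf.
by apply/seteqP; split=> y /=; rewrite sf.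
Qed.

Lemma quotient_map_factor X Y Z (f : X -> Y) (q : Y -> Z) :
  quotient_map f -> morphism (q \o f) -> morphism q.
Proof.
move=> [mf sf of_ rf] [cq rq].
have oq : continuous q.
  by apply/continuousP => U oU; apply: of_; exact: (open_preimage cq oU).
split=> // U h oU rh; apply: rf; first exact: (open_preimage oq oU).
exact: (rq _ _ oU rh).
Qed.

End QuotientMaps.

Section PowerMap.
Variables (K : numClosedFieldType) (I : finType) (j : I) (d : nat).
Hypothesis d_gt0 : (0 < d)%N.
Local Notation A := (affine K I).

Lemma unity_roots : exists rs : seq K,
  [/\ uniq rs, size rs = d & forall z, z \in rs -> z ^+ d = 1].
Proof.
have [rs rsE] := closed_field_poly_normal ('X^d - 1 : {poly K}).
have m1 : lead_coef ('X^d - 1 : {poly K}) = 1.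
  exact/eqP/monic_Xn_sub_1.
rewrite m1 scale1r in rsE; exists rs; split.
- rewrite -separable.separable_prod_XsubC -rsE cyclotomic.separable_Xn_sub_1//.
  by rewrite pnatr_eq0 -lt0n.
- have := size_Xn_sub_1 K d_gt0; rewrite rsE size_prod_XsubC => -[].
  exact.
- move=> z; rewrite -root_prod_XsubC -rsE => /rootP.
  by rewrite hornerD hornerXn hornerN hornerC => /eqP; rewrite subr_eq0 => /eqP.
Qed.

(** A polynomial of degree less than [d] with [d] distinct roots is zero. *)
Lemma sum_unity_eq0 (a : 'I_d -> K) :
  (forall z : K, z ^+ d = 1 -> \sum_(c < d) z ^+ c * a c = 0) -> forall c, a c = 0.
Proof.
move=> H c; have [rs [urs srs rs1]] := unity_roots.
pose p := \sum_(c < d) (a c)%:P * 'X^c.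
have pE : p = \poly_(c < d) (if insub c is Some c' then a c' else 0).
  rewrite poly_def; apply: eq_bigr => i _; rewrite valK mul_polyC //.
have p0 : p = 0.
  apply: (@roots_geq_poly_eq0 _ p rs) => //.
    apply/allP => z /rs1 /H Hz; apply/rootP; rewrite -[RHS]Hz horner_sum.
    by apply: eq_bigr => i _; rewrite hornerM hornerC hornerXn mulrC.
  by rewrite srs pE size_poly.
have := congr1 (fun q : {poly K} => q`_c) p0.
by rewrite pE coef_poly ltn_ord valK coef0.
Qed.

Definition pow_affine (x : A) : A := [ffun k => if k == j then x k ^+ d else x k].
Definition twist (z : K) (x : A) : A := [ffun k => if k == j then z * x k else x k].

Lemma pow_affine_twist z x : z ^+ d = 1 -> pow_affine (twist z x) = pow_affine x.
Proof.
move=> z1; apply/ffunP => k; rewrite !ffunE; case: eqP => // _.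
by rewrite exprMn z1 mul1r.
Qed.

(** The isotypic decomposition of polynomials for the action by roots of unity
on the coordinate [j]. *)
Lemma peval_isotypic (p : {mpoly K[#|I|]}) : exists g : 'I_d -> {mpoly K[#|I|]},
  forall x, peval p x = \sum_(c < d) x j ^+ c * peval (g c) (pow_affine x).
Proof.
pose r := enum_rank j.
pose m' (m : 'X_{1..#|I|}) : 'X_{1..#|I|} :=
  [multinom if k == r then m k %/ d else m k | k < #|I|]%N.
exists (fun c : 'I_d => \sum_(m <- msupp p)
  ((m r %% d == c :> nat)%N%:R * p@_m) *: 'X_[m' m]) => x.
under eq_bigr => c _ do rewrite peval_sum big_distrr/=.
rewrite pevalE exchange_big; apply: eq_bigr => m _ /=.
pose c0 : 'I_d := Ordinal (ltn_pmod (m r) d_gt0).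
rewrite [RHS](bigD1 c0)//= [X in _ = _ + X]big1 ?addr0 => [|c cc0]; last first.
  rewrite pevalZ (_ : _ == _ = false) ?mul0r ?mulr0//.
  by apply/negP => /eqP E; case/negP: cc0; apply/eqP/val_inj.
rewrite eqxx mul1r pevalZ mulrCA; congr (_ * _).
rewrite /peval mevalX (bigD1 r)//= [in RHS](bigD1 r)//= mulrA; congr (_ * _).
  by rewrite mnmE ffunE enum_rankK !eqxx -exprM -exprD mulnC addnC -divn_eq.
apply: eq_bigr => i ir; rewrite mnmE ffunE (negPf ir).
rewrite (_ : enum_val i == j = false)//.
by apply/negP => /eqP E; case/negP: ir; rewrite /r -E enum_valK.
Qed.

Definition pow_tor (u : tor K I) : tor K I := tor_of (pow_affine (val u)).

Lemma pow_torE u : val (pow_tor u) = pow_affine (val u).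
Proof.
apply/ffunP => k; rewrite tor_ofE// ffunE.
by case: ifP => _; rewrite ?expf_neq0 ?tor_neq0.
Qed.

Lemma pow_tor_morphism : morphism pow_tor.
Proof.
apply: morphism_tor => i.
apply: (@regular_ext _ _ _ (fun u : tor K I =>
  if i == j then val u i ^+ d else val u i)) => [u|].
  by rewrite pow_torE ffunE.
case: (i == j); last exact: regular_tor_coord.
by apply: regularX; [exact: openT|exact: regular_tor_coord].
Qed.

Lemma pow_tor_surj y : exists x, pow_tor x = y.
Proof.
exists (tor_of (fun k => if k == j then d.-root (val y k) else val y k)).
apply: torP => k; rewrite pow_torE ffunE tor_ofE.
  by case: (k == j) => //; rewrite rootCK.
by case: (k == j); rewrite ?rootC_eq0 ?tor_neq0.
Qed.

(** The hypothesis, applied to all preimages of a point, holds for the [d]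
multiples of [val u j] by roots of unity. *)
Lemma pow_tor_isotypic (S : set (tor K I)) (a : 'I_d -> tor K I -> K) :
  (forall u, S (pow_tor u) ->
    \sum_(c < d) val u j ^+ c * a c (pow_tor u) = 0) ->
  forall y c, S y -> a c y = 0.
Proof.
move=> H y c Sy; have [x xy] := pow_tor_surj y.
suff /eqP : val x j ^+ c * a c y = 0.
  by rewrite mulf_eq0 expf_eq0 (negPf (tor_neq0 _ _)) andbF => /eqP.
apply: (@sum_unity_eq0 (fun c => val x j ^+ c * a c y)) => z z1.
have z0 : z != 0.
  apply: contraPneq z1 => ->; rewrite expr0n (gtn_eqF d_gt0) => /eqP.
  by rewrite eq_sym oner_eq0.
pose xz : tor K I := tor_of (twist z (val x)).
have xzE : val xz = twist z (val x).
  apply/ffunP => k; rewrite tor_ofE// ffunE.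
  by case: ifP => _; rewrite ?mulf_neq0 ?tor_neq0.
have Pxz : pow_tor xz = y.
  by apply: val_inj; rewrite -xy !pow_torE xzE pow_affine_twist.
have := H xz; rewrite Pxz => /(_ Sy) E; rewrite -[RHS]E; apply: eq_bigr => i _.
by rewrite xzE ffunE eqxx exprMn mulrA.
Qed.

(** If polynomials describe an invariant open set or function, so do their
isotypic components of any given degree; up to a power of the invertible
coordinate [j], these are polynomials on the target. *)
Lemma pow_tor_quotient : quotient_map pow_tor.
Proof.
split; [exact: pow_tor_morphism|exact: pow_tor_surj| |].
- move=> U /sub_openP [V oV VU]; apply: open_local => y Uy.
  have [x xy] := pow_tor_surj y.
  have Vx : V (val x) by rewrite -[V _]/((val @^-1` V) x) VU /= xy.
  move: oV; rewrite open_affine => /affine_openP /(_ _ Vx) [p [px pV]].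
  have [g gE] := peval_isotypic p.
  have [c gc] : exists c, peval (g c) (val y) != 0.
    apply: contrapT => /forallNP H; case/negP: px; apply/eqP.
    rewrite gE -pow_torE xy big1// => c _.
    by have /negP := H c; rewrite negbK => /eqP ->; rewrite mulr0.
  exists [set y : tor K I | peval (g c) (val y) != 0]; split=> //.
    by apply: open_neq0; exact: (regular_comp (morphism_val _) (regular_peval _)).
  move=> y' /= gy'; apply: contrapT => nU; case/negP: gy'; apply/eqP.
  apply: (@pow_tor_isotypic (~` U) (fun c y => peval (g c) (val y))) => // u nUu.
  suff pu0 : peval p (val u) = 0 by rewrite -[RHS]pu0 gE -pow_torE.
  apply/eqP; apply: contrapT => /negP pu; have Vu := pV _ pu; apply: nUu.
  by rewrite -[U _]/((pow_tor @^-1` U) u) -VU.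
- move=> U h oU rh; apply: regular_local_frac => // y Uy.
  have [x xy] := pow_tor_surj y.
  have Ux : (pow_tor @^-1` U) x by rewrite /= xy.
  have [V [G [oV Vx rG hG]]] := rh x Ux.
  have [p [q [qx pqG]]] := rG _ Vx.
  move: oV; rewrite open_affine => /affine_openP /(_ _ Vx) [r [rx rV]].
  (* The factors q and r make the identity h q' = p' hold on all of the preimage
  of U, and not only where the description by p / q is valid. *)
  pose q' := (q * r) * (q * r); pose p' := (p * r) * (q * r).
  have hq u : U (pow_tor u) -> h (pow_tor u) * peval q' (val u) = peval p' (val u).
    move=> Uu; rewrite /q' /p' !pevalM.
    have [->|q0] := eqVneq (peval q (val u)) 0; first by rewrite !(mul0r, mulr0).
    have [->|r0] := eqVneq (peval r (val u)) 0; first by rewrite !(mul0r, mulr0).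
    have Vu := rV _ r0.
    have := hG u Uu Vu; rewrite /= pqG// => ->.
    by rewrite !mulrA mulfVK// .
  have [a aE] := peval_isotypic p'; have [b bE] := peval_isotypic q'.
  have hab y' c : U y' -> h y' * peval (b c) (val y') - peval (a c) (val y') = 0.
    move=> Uy'; apply: (@pow_tor_isotypic U (fun c y =>
      h y * peval (b c) (val y) - peval (a c) (val y))) => // u Uu.
    have /eqP := hq u Uu; rewrite -subr_eq0 => /eqP E; rewrite -[RHS]E aE bE -pow_torE.
    rewrite big_distrr -sumrB; apply: eq_bigr => i _ /=.
    by rewrite mulrBr mulrCA.
  have [c bc] : exists c, peval (b c) (val y) != 0.
    have : peval q' (val x) != 0 by rewrite /q' !pevalM !mulf_neq0.
    move=> qx'; apply: contrapT => /forallNP H; case/negP: qx'; apply/eqP.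
    rewrite bE -pow_torE xy big1// => c _.
    by have /negP := H c; rewrite negbK => /eqP ->; rewrite mulr0.
  have rP (f : {mpoly K[#|I|]}) : regular setT (fun y : tor K I => peval f (val y)).
    exact: (regular_comp (morphism_val _) (regular_peval _)).
  exists setT, (fun y => peval (a c) (val y)), (fun y => peval (b c) (val y)).
  split; first by split=> //; exact: openT.
  split=> // y' Uy' _ by'; apply: (mulIf by').
  rewrite mulfVK//; apply/eqP; rewrite -subr_eq0; apply/eqP; exact: hab.
Qed.

End PowerMap.

(** * Splitting a torus along a monomial action *)

Section Splitting.
Variable K : numClosedFieldType.
Implicit Types I J L : finType.

Lemma quotient_map_ext (X Y : funSpaceType K) (f g : X -> Y) :
  f =1 g -> quotient_map f -> quotient_map g.
Proof. by move=> /funext ->. Qed.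

Definition zpow I (e : I -> int) (u : tor K I) : tor K I :=
  tor_of (fun i => val u i ^ e i).

Lemma zpowE I (e : I -> int) (u : tor K I) i : val (zpow e u) i = val u i ^ e i.
Proof. by rewrite tor_ofE// expfz_neq0// tor_neq0. Qed.

Lemma zpow_morphism I (e : I -> int) : morphism (zpow e).
Proof.
apply: morphism_tor => i; apply: (regular_ext (fun u => esym (zpowE e u i))).
by apply: regularXz => [|u]; [exact: regular_tor_coord|exact: tor_neq0].
Qed.

(** The coordinates are raised to positive powers one after the other, and signs
are dealt with by inverting coordinates, which is an automorphism. *)
Lemma zpow_quotient I (e : I -> int) : (forall i, e i != 0) ->
  quotient_map (zpow e).
Proof.
move=> e0.
pose P (s : seq I) := zpow (fun i => if i \in s then `|e i|%N%:Z else 1).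
have qP s : uniq s -> quotient_map (P s).
  elim: s => [_|j s IH /= /andP [js us]].
    apply: (@quotient_map_ext _ _ id); last first.
      by apply: (@quotient_map_section _ _ _ id id) => //; exact: morphism_id.
    by move=> u; apply: torP => i; rewrite zpowE expr1z.
  have ej : (0 < `|e j|)%N by rewrite lt0n absz_eq0.
  apply: (quotient_map_ext _ (quotient_map_comp (IH us) (pow_tor_quotient K j ej))).
  move=> u; apply: torP => i; rewrite pow_torE// ffunE !zpowE inE.
  by case: eqP => //= ->; rewrite (negPf js) expr1z.
have qs : quotient_map (zpow (fun i => sgz (e i))).
  apply: (@quotient_map_section _ _ _ _ (zpow (fun i => sgz (e i)))).
  - exact: zpow_morphism.
  - exact: zpow_morphism.
  - move=> u; apply: torP => i; rewrite !zpowE exprz_exp -expr2 sqr_sg.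
    by rewrite e0 expr1z.
apply: (quotient_map_ext _ (quotient_map_comp (qP _ (enum_uniq I)) qs)).
by move=> u; apply: torP => i; rewrite !zpowE mem_enum exprz_exp mulrC -intEsg.
Qed.

Lemma monom_mx_inv J (A B : 'M[int]_#|J|) (u : tor K 'I_#|J|) :
  A *m B = 1%:M ->
  monom (fun (j : J) k => B (enum_rank j) k)
    (monom (fun k (j : J) => A k (enum_rank j)) u) = u.
Proof.
move=> AB; rewrite monom_comp -[RHS]monom_id; apply: monom_ext => k k'.
have := congr1 (fun M : 'M[int]_#|J| => M k k') AB; rewrite !mxE.
rewrite natz => <-; rewrite [RHS](reindex (enum_rank : J -> 'I_#|J|)) //.
by apply: onW_bij; exact: enum_rank_bij.
Qed.

Lemma monom_mx_invV J (A B : 'M[int]_#|J|) (u : tor K J) : B *m A = 1%:M ->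
  monom (fun k (j : J) => A k (enum_rank j))
    (monom (fun (j : J) k => B (enum_rank j) k) u) = u.
Proof.
move=> AB; rewrite monom_comp -[RHS]monom_id; apply: monom_ext => j j'.
have := congr1 (fun M : 'M[int]_#|J| => M (enum_rank j) (enum_rank j')) AB.
by rewrite !mxE (inj_eq enum_rank_inj) natz => <-.
Qed.

Definition pull I J (f : I -> J) (v : tor K J) : tor K I :=
  tor_of (fun i => val v (f i)).

Lemma pullE I J (f : I -> J) v i : val (pull f v) i = val v (f i).
Proof. by rewrite tor_ofE// tor_neq0. Qed.

Lemma pull_morphism I J (f : I -> J) : morphism (pull f).
Proof.
apply: morphism_tor => i; apply: (regular_ext (fun u => esym (pullE f u i))).
exact: regular_tor_coord.
Qed.

Lemma pull_quotient I J (f : I -> J) : injective f -> quotient_map (pull f).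
Proof.
move=> f_inj.
pose s (u : tor K I) : tor K J :=
  tor_of (fun j => if [pick i | f i == j] is Some i then val u i else 1).
have sE u j : val (s u) j = if [pick i | f i == j] is Some i then val u i else 1.
  by rewrite tor_ofE//; case: pickP => *; rewrite ?tor_neq0 ?oner_neq0.
apply: (@quotient_map_section _ _ _ _ s); first exact: pull_morphism.
  apply: morphism_tor => j; apply: (regular_ext (fun u => esym (sE u j))).
  case: pickP => [i _|_]; first exact: regular_tor_coord.
  by apply: regular_cst; exact: openT.
move=> u; apply: torP => i; rewrite pullE sE; case: pickP => [i' /eqP /f_inj -> //|].
by move=> /(_ i); rewrite eqxx.
Qed.

(** After a change of coordinates on the target, which exists by the Smith
normal form of the matrix of weights, a monomial action translates some of the
coordinates by arbitrary amounts and leaves the other ones alone. *)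
Theorem torus_splitting L J (E : L -> J -> int) :
  exists (I1 I0 : finType) (psi : tor K L -> tor K I1)
    (rho1 : tor K J -> tor K I1) (rho0 : tor K J -> tor K I0)
    (sig : tor K I1 -> tor K I0 -> tor K J),
  [/\ (#|I1| + #|I0|)%N = #|J|, quotient_map psi &
      forall s t, psi (tor_mul s t) = tor_mul (psi s) (psi t)] /\
  [/\ morphism rho1, morphism rho0 &
      morphism (fun z : prod_space (tor K I1) (tor K I0) => sig z.1 z.2)] /\
  [/\ forall u, sig (rho1 u) (rho0 u) = u,
      forall a b, rho1 (sig a b) = a,
      forall a b, rho0 (sig a b) = b,
      forall t u, rho1 (tor_mul (monom E t) u) = tor_mul (psi t) (rho1 u) &
      forall t u, rho0 (tor_mul (monom E t) u) = rho0 u].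
Proof.
pose M := \matrix_(i < #|L|, j < #|J|) E (enum_val i) (enum_val j).
have [A uA [R uR [d _ MARd]]] := int_Smith_normal_form M.
(* Only the first #|L| new coordinates have an elementary divisor, and those with
a zero one are fixed. *)
pose moving (k : 'I_#|J|) := (k < #|L|)%N && (d`_k != 0).
pose I1 : finType := {k : 'I_#|J| | moving k}.
pose I0 : finType := {k : 'I_#|J| | ~~ moving k}.
pose rho := @monom K J 'I_#|J| (fun j k => invmx R (enum_rank j) k).
pose rhoV := @monom K 'I_#|J| J (fun k j => R k (enum_rank j)).
pose lam := @monom K L 'I_#|L| (fun i k => A (enum_rank i) k).
pose lamV := @monom K 'I_#|L| L (fun k i => invmx A k (enum_rank i)).

have rhoK : cancel rho rhoV by move=> u; apply: monom_mx_invV; exact: mulVmx.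
have rhoVK : cancel rhoV rho by move=> u; apply: monom_mx_inv; exact: mulmxV.
have lamK : cancel lam lamV by move=> u; apply: monom_mx_invV; exact: mulmxV.
have lamVK : cancel lamV lam by move=> u; apply: monom_mx_inv; exact: mulVmx.
have lt1 (k : I1) : (val k < #|L|)%N by case/andP: (valP k).
pose f1 (k : I1) : 'I_#|L| := Ordinal (lt1 k).
pose psi t := zpow (fun k : I1 => d`_(val k)) (pull f1 (lam t)).
pose rho1 u := pull (val : I1 -> 'I_#|J|) (rho u).
pose rho0 u := pull (val : I0 -> 'I_#|J|) (rho u).
pose mrg (a : tor K I1) (b : tor K I0) : tor K 'I_#|J| := tor_of (fun k =>
  if insub k is Some k1 then val a k1 else
  if insub k is Some k0 then val b k0 else 1).
have mrgE a b k : val (mrg a b) k = if insub k is Some k1 then val a k1 else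
  if insub k is Some k0 then val b k0 else 1.
  by rewrite tor_ofE//; do 2?[case: insub => *]; rewrite ?tor_neq0 ?oner_neq0.
have mrg1 a b (k : I1) : val (mrg a b) (val k) = val a k by rewrite mrgE valK.
have mrg0 a b (k : I0) : val (mrg a b) (val k) = val b k.
  by rewrite mrgE insubN ?(valP k)// valK.
have rhoE t k : val (rho (monom E t)) k =
    if insub (k : nat) is Some k' then val (lam t) (k' : 'I_#|L|) ^ d`_k else 1.
  have -> : rho (monom E t) =
      monom (fun (i : 'I_#|L|) (k : 'I_#|J|) =>
        if i == k :> nat then d`_k else 0) (lam t).
    rewrite /rho /lam !monom_comp; apply: monom_ext => i k'.
    have := congr1 (fun M : 'M[int]_(#|L|, #|J|) => (M *m invmx R) (enum_rank i) k') MARd.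
    rewrite /= mulmxK// !mxE.
    rewrite (reindex (enum_rank : J -> 'I_#|J|)); last first.
      by apply: onW_bij; exact: enum_rank_bij.
    under eq_bigr => j _ do rewrite mxE !enum_rankK.
    move=> ->; apply: eq_bigr => j _; rewrite mxE; case: eqP => [->|_].
      by rewrite mulr1n.
    by rewrite mulr0n.
  rewrite monomE; case: insubP => [k' _ kk'|nk].
    rewrite (bigD1 k')//= kk' eqxx big1 ?mulr1// => i ik.
    by rewrite -kk' val_eqE (negPf ik) expr0z.
  rewrite big1// => i _; case: eqP => [ik|_]; last by rewrite expr0z.
  by case/negP: nk; rewrite -ik.
have rhoM u v : rho (tor_mul u v) = tor_mul (rho u) (rho v) by exact: monomM.
exists I1, I0, psi, rho1, rho0, (fun a b => rhoV (mrg a b)); split.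
  split.
  - by rewrite !card_sig -[RHS]card_ord -[RHS](cardC moving).
  - apply: (quotient_map_comp (f := fun t => pull f1 (lam t))).
      apply: (quotient_map_comp (f := lam)).
        by apply: quotient_map_section lamVK; exact: monom_morphism.
      apply: pull_quotient => k k' /(congr1 val) /= E'.
      by apply/val_inj/val_inj.
    by apply: zpow_quotient => k; case/andP: (valP k).
  - move=> s t; apply: torP => k; rewrite tor_mulE !zpowE !pullE /lam monomM.
    by rewrite tor_mulE expfzMl.
split.
  split.
  - by apply: (@morphism_comp _ _ _ _ rho (pull _));
      [exact: monom_morphism|exact: pull_morphism].
  - by apply: (@morphism_comp _ _ _ _ rho (pull _));
      [exact: monom_morphism|exact: pull_morphism].
  - have m : morphism (fun z : prod_space (tor K I1) (tor K I0) => mrg z.1 z.2).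
      apply: morphism_tor => k; apply: (@regular_ext _ _ _ _ _
        (fun z : prod_space (tor K I1) (tor K I0) => esym (mrgE z.1 z.2 k))).
      case: insub => [k1|].
        exact: (regular_comp (@morphism_fst _ _ _) (regular_tor_coord _)).
      case: insub => [k0|].
        exact: (regular_comp (@morphism_snd _ _ _) (regular_tor_coord _)).
      by apply: regular_cst; exact: openT.
    by apply: (@morphism_comp _ _ _ _ _ rhoV m); exact: monom_morphism.
split.
- move=> u; rewrite -[RHS]rhoK; congr (rhoV _); apply: torP => k; rewrite mrgE.
  case: insubP => [k1 _ <-|nk]; first by rewrite pullE.
  by case: insubP => [k0 _ <-|]; [rewrite pullE|rewrite nk].
- by move=> a b; apply: torP => k; rewrite pullE rhoVK mrg1.
- by move=> a b; apply: torP => k; rewrite pullE rhoVK mrg0.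
- move=> t u; apply: torP => k; rewrite pullE rhoM !tor_mulE zpowE !pullE rhoE.
  case: insubP => [k' _ kk'|]; last by rewrite lt1.
  by rewrite (_ : k' = f1 k)//; exact: val_inj.
- move=> t u; apply: torP => k; rewrite !pullE rhoM tor_mulE rhoE.
  case: insubP => [k' lk kk'|_]; last by rewrite mul1r.
  have := valP k; rewrite /moving -kk' ltn_ord/= negbK kk' => /eqP ->.
  by rewrite expr0z mul1r.
Qed.

End Splitting.

(** * Quotients of toric charts *)

Section DimensionOfTori.
Variable K : numFieldType.

Lemma isomorphic_has_dim (X Y : funSpaceType K) d :
  isomorphic X Y -> has_dim X d -> has_dim Y d.
Proof. by move=> [f [[cf _] [g [[cg _] fg gf]]]]; exact: has_dim_homeo fg gf. Qed.

Lemma has_dim_tor_open (I : finType) (W : set (tor K I)) : open W -> W !=set0 ->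
  has_dim W #|I|.
Proof.
move=> oW [u0 Wu0].
have cval : continuous (fun w : W => val (val w)).
  exact: (morphism_comp (morphism_val _) (morphism_val _)).1.
have [V oV VW] := (sub_openP W).1 oW.
have Vu0 : V (val u0) by rewrite -[V _]/((val @^-1` V) u0) VW.
move: (oV); rewrite open_affine => /affine_openP /(_ _ Vu0) [p [pu0 pV]].
pose p0 : {mpoly K[#|I|]} := p * \prod_(i < #|I|) 'X_i.
have p0E v : peval p0 v = peval p v * \prod_(i < #|I|) v (enum_val i).
  rewrite pevalM /peval rmorph_prod; congr (_ * _).
  by apply: eq_bigr => i _; exact: peval_X.
apply: (@has_dim_open _ _ _ (fun w : W => val (val w)) cval _
  (SigSub (mem_set Wu0)) p0).
- move=> F; rewrite -openC => /sub_openP [U /sub_openP [U' oU' <-] UF].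
  exists (~` U'); first by rewrite closedC.
  by rewrite -[LHS]setCK -UF.
- by rewrite p0E mulf_neq0//; apply/prodf_neq0 => i _; exact: tor_neq0.
- move=> v; rewrite p0E mulf_eq0 negb_or => /andP [pv /prodf_neq0 v0].
  have tv : tor_set v by move=> i; rewrite -(enum_rankK i); exact: v0.
  have Wv : W (SigSub (mem_set tv)).
    by rewrite -VW /=; exact: pV.
  by exists (SigSub (mem_set Wv)).
Qed.

Lemma has_dim_tor (I : finType) : has_dim (tor K I) #|I|.
Proof.
apply: (@isomorphic_has_dim (set_type [set: tor K I])).
  exact: setT_isomorphic.
by apply: has_dim_tor_open; [exact: openT|exists (tor_one K I)].
Qed.

End DimensionOfTori.

Section Quotients.
Variables (K : fieldType) (m : nat) (S : subtorus K m) (B : {set {set 'I_m}})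
  (X : stable_subset S B).

(** Openness and regularity on a quotient are defined through the projection. *)
Lemma pi_quotient_map (T : funSpaceType K) (Q0 : quotType T) :
  quotient_map (\pi_(quotient_topology Q0) : T -> quotient_topology Q0).
Proof.
split.
- split; first by apply/continuousP => U oU; exact: oU.
  by move=> V h oV rh; exact: rh.
- by move=> y; exists (repr y); exact: reprK.
- by move=> U oU; exact: oU.
- by move=> U h oU rh; exact: rh.
Qed.

Lemma orbit_map_quotient : quotient_map (orbit_map X).
Proof. exact: pi_quotient_map. Qed.

Lemma qclass_quotient : quotient_map (@qclass K m S B).
Proof. exact: pi_quotient_map. Qed.

Lemma orbit_mapP x y : orbit_map X x = orbit_map X y <->
  exists s : subtorus_set S, tact (val s) (val x) = val y.
Proof.
split=> [/eqmodP /orbit_relP //|H].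
by apply/eqmodP/orbit_relP.
Qed.

Lemma qclassP (s t : subtorus_set S) : @qclass K m S B s = @qclass K m S B t <->
  exists2 u, stab_in S B u & val t = tmul u (val s).
Proof.
by split=> [/eqmodP /asboolP //|H]; apply/eqmodP/asboolP.
Qed.

Lemma orbit_map_invariant : invariant_map (qact X) (orbit_map X).
Proof.
move=> c x; apply/esym/orbit_mapP; exists (qrepr c) => //.
Qed.

(** The quotient structure is universal for maps to all spaces with functions, in
particular to varieties. *)
Lemma orbit_categorical_quotient : categorical_quotient (qact X) (orbit_map X).
Proof.
have [mp sp _ _] := orbit_map_quotient.
split=> //; first exact: orbit_map_invariant.
move=> Z f _ mf If.
pose q (c : orbit_space X) := f (repr (c : {eq_quot (orbit_rel (X := X))})).
have qp : q \o orbit_map X = f.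
  apply/funext => x.
  have /orbit_mapP [s E] : orbit_map X x =
      orbit_map X (repr (orbit_map X x : {eq_quot (orbit_rel (X := X))})).
    by rewrite /orbit_map reprK.
  rewrite /q /=; rewrite -(If (@qclass K m S B s) x); congr f; apply: val_inj.
  by rewrite qact_class E.
exists q; split.
  split=> //; apply: quotient_map_factor orbit_map_quotient _.
  by rewrite qp.
move=> q' [_ fq']; apply/funext => c; have [x <-] := sp c.
by rewrite -[LHS]/((q \o orbit_map X) x) qp fq'.
Qed.

End Quotients.

Section ToricChart.
Variables (K : numClosedFieldType) (m : nat) (S : subtorus K m)
  (B : {set {set 'I_m}}) (X : stable_subset S B).

Definition smul (s t : subtorus_set S) : subtorus_set S :=
  SigSub (mem_set (subtorusM (set_valP s) (set_valP t))).

Definition sact (s : subtorus_set S) (x : stable_set X) : stable_set X :=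
  SigSub (mem_set (stable_tact (set_valP s) (set_valP x))).

(** An equivariant isomorphism [h] of [X] with an open subset f != 0 of a torus of
rank [d], on which [S] acts by the monomials with exponents [E] in its
coordinates [kap].  The inverse [hV] is a total function, constrained on this
subset only. *)
Definition toric_chart (d : nat) :=
  exists (L J : finType) (kap : subtorus_set S -> tor K L) (E : L -> J -> int)
    (f : tor K J -> K) (h : stable_set X -> tor K J)
    (hV : tor K J -> stable_set X),
  [/\ #|J| = d, quotient_map kap &
      forall s t, kap (smul s t) = tor_mul (kap s) (kap t)] /\
  [/\ regular setT f, morphism h,
      morphism (fun u : [set u | f u != 0] => hV (val u)) &
      forall x, f (h x) != 0] /\
  [/\ cancel h hV, forall u, f u != 0 -> h (hV u) = u &
      forall s x, h (sact s x) = tor_mul (monom E (kap s)) (h x)].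

(** [torus_splitting] makes [X] the product of a torus, on which [S] acts by
translations through [Psi], and a slice [Y].  As [Psi] is a quotient map whose
kernel is the stabiliser, the quotient of [S] by the stabiliser is this torus,
and the quotient of [X] is [Y]. *)
Lemma toric_chart_quotient d : toric_chart d -> stable_set X !=set0 ->
  (forall s x, subtorus_set S s -> stable_set X x -> tact s x = x -> stab B s) ->
  [/\ variety (orbit_space X), categorical_quotient (qact X) (orbit_map X),
      fibration (qmul : quot_torus S B -> quot_torus S B -> quot_torus S B)
        (qact X) (orbit_map X) &
      exists dQ dT, [/\ has_dim (orbit_space X) dQ,
        has_dim (quot_torus S B) dT & (dQ + dT)%N = d]].
Proof.
move=> [L [J [kap [E [f [h [hV [[cardJ qkap kapM] [[rf mh mhV fh] [hK hVK hE]]]]]]]]]].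
move=> [x00 Xx0] stabX; pose x0 : stable_set X := SigSub (mem_set Xx0).
have [I1 [I0 [psi [rho1 [rho0 [sig [[card01 qpsi psiM] [[m1 m0 msig]
  [sigK rho1K rho0K rho1E rho0E]]]]]]]]] := torus_splitting K E.
pose Psi s := psi (kap s).
have qPsi : quotient_map Psi by exact: quotient_map_comp qkap qpsi.
have PsiM s t : Psi (smul s t) = tor_mul (Psi s) (Psi t).
  by rewrite /Psi kapM psiM.
pose al x := rho1 (h x); pose be x := rho0 (h x).
have mal : morphism al by exact: morphism_comp mh m1.
have mbe : morphism be by exact: morphism_comp mh m0.
have alE s x : al (sact s x) = tor_mul (Psi s) (al x) by rewrite /al hE rho1E.
have beE s x : be (sact s x) = be x by rewrite /be hE rho0E.
have hsig x : h x = sig (al x) (be x) by rewrite sigK.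
have al_be x y : al x = al y -> be x = be y -> x = y.
  by move=> Ea Eb; rewrite -(hK x) -(hK y) !hsig Ea Eb.
have tor_mul_solve (I : finType) (a b : tor K I) : exists c, tor_mul c a = b.
  exists (tor_of (fun i => val b i / val a i)); apply: torP => i.
  by rewrite tor_mulE tor_ofE ?mulfVK ?mulf_neq0 ?invr_neq0 ?tor_neq0.
have tor_mulI (I : finType) (a b c : tor K I) : tor_mul a c = tor_mul b c -> a = b.
  move=> /(congr1 val) /ffunP H; apply: torP => i; have := H i.
  by rewrite !tor_mulE => /(mulIf (tor_neq0 _ _)).
have transl x (a : tor K I1) : exists s, al (sact s x) = a.
  have [c cE] := tor_mul_solve _ (al x) a; have [_ /(_ c) [s sE] _ _] := qPsi.
  by exists s; rewrite alE sE.
(* [Y] is the slice of the chart where the translated coordinates are one; it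
meets every orbit in exactly one point. *)
pose fY (y : tor K I0) := f (sig (tor_one K I1) y).
have rfY : regular setT fY.
  have ms : morphism (fun y : tor K I0 => sig (tor_one K I1) y).
    have mc : morphism (fun _ : tor K I0 => tor_one K I1).
      apply: morphism_tor => i; apply: (regular_ext (fun _ => esym (tor_oneE _ i))).
      by apply: regular_cst; exact: openT.
    exact: (morphism_comp (morphism_pair mc (@morphism_id _ (tor K I0))) msig).
  exact: (regular_comp ms rf).
pose Y : set (tor K I0) := [set y | fY y != 0].
have Ybe x : Y (be x).
  have [s sE] := transl x (tor_one K I1).
  by rewrite /Y /= /fY -sE -(beE s x) -hsig; exact: fh.
have sigY a y : Y y -> f (sig a y) != 0.
  move=> Yy; pose x := hV (sig (tor_one K I1) y).
  have hx : h x = sig (tor_one K I1) y by rewrite hVK.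
  have [s sE] := transl x a.
  have -> : y = be (sact s x) by rewrite beE /be hx rho0K.
  by rewrite -sE -hsig; exact: fh.
pose Q := orbit_space X; pose p := orbit_map X.
have qp : quotient_map p := orbit_map_quotient X.
have [mp sp _ _] := qp.
have beQ x y : p x = p y -> be x = be y.
  move=> /orbit_mapP [s sE]; rewrite -(beE (s) x); congr be; exact: val_inj.
pose beY x : Y := SigSub (mem_set (Ybe x)).
pose qb (c : Q) : Y := beY (xget x0 [set x | p x = c]).
have qbp x : qb (p x) = beY x.
  apply: val_inj => /=; apply: beQ.
  by rewrite (@xgetPex _ x0 [set y | p y = p x]) //; exists x.
have mqb : morphism qb.
  apply: (quotient_map_factor qp).
  apply: (morphism_ext (fun x => esym (qbp x))); exact: morphism_into.
have msigY : morphism (fun z : prod_space (tor K I1) Y => hV (sig z.1 (val z.2))).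
  pose Wf : set (tor K J) := [set u | f u != 0].
  have Wz (z : prod_space (tor K I1) Y) : Wf (sig z.1 (val z.2)).
    by apply: sigY; exact: set_valP.
  have mW : morphism (fun z => SigSub (mem_set (Wz z)) : Wf).
    apply: morphism_into.
    have mY : morphism (fun z : prod_space (tor K I1) Y => val z.2).
      exact: (morphism_comp (@morphism_snd _ _ _) (morphism_val _)).
    exact: (morphism_comp (morphism_pair (@morphism_fst _ _ _) mY) msig).
  exact: (morphism_comp mW mhV).
have al_hV a (y : Y) : al (hV (sig a (val y))) = a.
  by rewrite /al hVK ?rho1K//; apply: sigY; exact: set_valP.
have be_hV a (y : Y) : beY (hV (sig a (val y))) = y.
  by apply: val_inj; rewrite /= /be hVK ?rho0K//; apply: sigY; exact: set_valP.
have isoQY : isomorphic Q Y.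
  exists qb; split=> //; exists (fun y => p (hV (sig (tor_one K I1) (val y)))).
  split.
  - have mc : morphism (fun _ : Y => tor_one K I1).
      apply: morphism_tor => i; apply: (regular_ext (fun _ => esym (tor_oneE _ i))).
      by apply: regular_cst; exact: openT.
    apply: morphism_comp mp.
    exact: (morphism_comp (morphism_pair mc (@morphism_id _ Y)) msigY).
  - move=> c; have [x <-] := sp c; rewrite qbp.
    have [s sE] := transl x (tor_one K I1).
    apply/esym/orbit_mapP; exists s; rewrite -[LHS]/(val (sact s x)); congr val.
    by apply: al_be; rewrite ?al_hV// beE -[RHS]/(val (beY _)) be_hV.
  - by move=> y; rewrite qbp be_hV.
have affY : affine_variety Y.
  apply: (affine_variety_tor (f := fY) (g := fun=> 0)) => //.
    by apply: regular_cst; exact: openT.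
  by move=> u; split=> [|[]].
(* An element fixing one point of [X] stabilises the whole cell, so that [k] and
[Psi] have the same fibres. *)
pose T := quot_torus S B; pose k : subtorus_set S -> T := @qclass K m S B.
have qk : quotient_map k := @qclass_quotient K m S B.
have [mk sk _ _] := qk; have [mPsi sPsi _ _] := qPsi.
have Psi_stab s : (forall x, sact s x = x) <-> Psi s = tor_one K I1.
  split=> [H|H x].
    apply: (tor_mulI _ _ _ (al x0)); rewrite -alE H.
    by apply: torP => i; rewrite tor_mulE tor_oneE mul1r.
  apply: al_be; last exact: beE.
  by rewrite alE H; apply: torP => i; rewrite tor_mulE tor_oneE mul1r.
have kP s t : k s = k t <-> Psi s = Psi t.
  split=> [/qclassP [u [Su stu] tE]|PE].
    pose us : subtorus_set S := SigSub (mem_set Su).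
    have -> : t = smul us s by exact: val_inj.
    rewrite PsiM (_ : Psi us = tor_one K I1).
      by apply: torP => i; rewrite tor_mulE tor_oneE mul1r.
    apply/Psi_stab => x; apply: val_inj => /=; apply: stu.
    by apply: (@stable_thin _ _ _ _ X); exact: set_valP.
  pose vs : subtorus_set S := SigSub (mem_set (subtorusV (set_valP s))).
  pose u := smul t vs.
  have tE : t = smul u s.
    by apply: val_inj; rewrite /= -tmulA tmulV tmulC tmul1.
  have Psiu : Psi u = tor_one K I1.
    apply: (tor_mulI _ _ _ (Psi s)); rewrite -PsiM -tE PE.
    by apply: torP => i; rewrite tor_mulE tor_oneE mul1r.
  apply/qclassP; exists (val u); last by rewrite {1}tE.
  split; first exact: set_valP.
  apply: (stabX _ (val x0)); [exact: set_valP|exact: set_valP|].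
  by rewrite -[LHS]/(val (sact u x0)) ((Psi_stab u).2 Psiu).
pose Psib (c : T) := Psi (qrepr c).
have Psibk s : Psib (k s) = Psi s.
  by apply/kP; rewrite /k /qclass /qrepr reprK.
have mPsib : morphism Psib.
  apply: (quotient_map_factor qk).
  exact: (morphism_ext (fun x => esym (Psibk x))).
pose s1 : subtorus_set S := SigSub (mem_set (subtorus1 S)).
pose kb (a : tor K I1) : T := k (xget s1 [set s | Psi s = a]).
have kbPsi s : kb (Psi s) = k s.
  by apply/kP; rewrite (@xgetPex _ s1 [set t | Psi t = Psi s])//; exists s.
have mkb : morphism kb.
  apply: (quotient_map_factor qPsi).
  exact: (morphism_ext (fun x => esym (kbPsi x))).
have kbK : cancel kb Psib.
  by move=> a; have [s <-] := sPsi a; rewrite kbPsi Psibk.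
have PsibK : cancel Psib kb.
  by move=> c; have [s <-] := sk c; rewrite Psibk kbPsi.
have isoT : isomorphic (tor K I1) T by exists kb; split=> //; exists Psib.
split.
- exact/affine_variety_variety/(affine_variety_iso isoQY).
- exact: orbit_categorical_quotient.
- split; first exact: mp.
  move=> q; exists setT; split=> //; first exact: openT.
  have inT (x : p @^-1` setT) : [set: Q] (p (val x)) by [].
  have inX (x : stable_set X) : (p @^-1` setT) x by [].
  exists (fun x => (SigSub (mem_set (inT x)), kb (al (val x)))); split.
  + split.
      apply: morphism_pair.
        apply: morphism_into; exact: (morphism_comp (morphism_val _) mp).
      apply: (morphism_comp _ mkb); exact: (morphism_comp (morphism_val _) mal).
    exists (fun z => SigSub (mem_set (inX (hV (sig (Psib z.2) (val (qb (val z.1)))))))).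
    split.
    * apply: morphism_into.
      have ma : morphism (fun z : prod_space [set: Q] T => Psib z.2).
        exact: (morphism_comp (@morphism_snd _ _ _) mPsib).
      have mb : morphism (fun z : prod_space [set: Q] T => qb (val z.1)).
        apply: (morphism_comp _ mqb).
        exact: (morphism_comp (@morphism_fst _ _ _) (morphism_val _)).
      exact: (morphism_comp (morphism_pair ma mb) msigY).
    * move=> x; apply: val_inj.
      rewrite -[LHS]/(hV (sig (Psib (kb (al (val x)))) (val (qb (p (val x)))))).
      by rewrite kbK qbp -[val (beY _)]/(be (val x)) -hsig hK.
    * move=> [c t]; congr (_, _); last first.
        rewrite -[LHS]/(kb (al (hV (sig (Psib t) (val (qb (val c))))))).
        by rewrite al_hV PsibK.
      apply: val_inj.
      rewrite -[LHS]/(p (hV (sig (Psib t) (val (qb (val c)))))).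
      have [x <-] := sp (val c); rewrite qbp.
      have [s sE] := transl x (Psib t).
      apply/esym/orbit_mapP; exists s; rewrite -[LHS]/(val (sact s x)); congr val.
      by apply: al_be; rewrite ?al_hV// beE -[RHS]/(val (beY _)) be_hV.
  + by [].
  + move=> g x y xy /=; apply: (can_inj PsibK); rewrite kbK.
    rewrite (_ : val y = sact (qrepr g) (val x)); last by rewrite xy; exact: val_inj.
    rewrite alE -[qmul _ _]/(k (smul (qrepr g) (qrepr (kb (al (val x)))))).
    by rewrite Psibk PsiM -[Psi (qrepr (kb _))]/(Psib (kb _)) kbK.
- exists #|I0|, #|I1|; split; last by rewrite addnC card01.
    apply: (isomorphic_has_dim (isomorphic_sym isoQY)); apply: has_dim_tor_open.
      exact: open_neq0.
    by exists (be x0); exact: Ybe.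
  exact: (isomorphic_has_dim isoT (has_dim_tor K I1)).
Qed.

End ToricChart.

(** * Plücker coordinates and normal forms of matrices *)

Section PluckerCoordinates.
Variables (K : fieldType) (m : nat).
Local Notation P := (proj K (pairs m)).

(** Plücker coordinates as an alternating function of two indices, which spares
the case distinctions on their order. *)
Definition alt (v : affine K (pairs m)) (i j : 'I_m) : K :=
  if insub (i, j) is Some ij then v ij else
  if insub (j, i) is Some ji then - v ji else 0.

Lemma alt_pair v (ij : pairs m) : alt v (val ij).1 (val ij).2 = v ij.
Proof. by rewrite /alt -surjective_pairing valK. Qed.

Lemma alt_lt v (i j : 'I_m) (lij : (i < j)%N) :
  alt v i j = v (exist _ (i, j) lij : pairs m).
Proof. by rewrite -[RHS]alt_pair. Qed.

Lemma altN v i j : alt v j i = - alt v i j.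
Proof.
rewrite /alt; case: insubP => [ji /= lji _|_]; last first.
  by case: insubP => *; rewrite ?opprK ?oppr0 ?opprK.
case: insubP => [ij /= lij _|_]; last by rewrite opprK.
by move: (ltn_trans lij lji); rewrite ltnn.
Qed.

Lemma altxx v i : alt v i i = 0.
Proof. by rewrite /alt !insubN//= ltnn. Qed.

Lemma alt_plucker (A : 'M[K]_(2, m)) i j :
  alt (plucker A) i j = A 0 i * A 1 j - A 0 j * A 1 i.
Proof.
rewrite /alt; case: insubP => [[[k l] lkl] _ /= [<- <-]|nij]; first by rewrite ffunE.
case: insubP => [[[k l] lkl] _ /= [<- <-]|nji]; first by rewrite ffunE opprB.
rewrite /= -!leqNgt in nij nji; have -> : i = j by apply/val_inj/anti_leq/andP.
by rewrite subrr.
Qed.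

Lemma alt_scale c v i j : alt (scale c v) i j = c * alt v i j.
Proof.
by rewrite /alt; do 2?[case: insubP => *]; rewrite ?ffunE ?mulrN ?mulr0.
Qed.

Lemma alt_tscale t v i j : alt (tscale t v) i j = val t i * val t j * alt v i j.
Proof.
rewrite /alt; case: insubP => [k _ kE|_]; first by rewrite ffunE /weight kE.
case: insubP => [k _ kE|_]; last by rewrite mulr0.
by rewrite ffunE /weight kE mulrN [val t j * _]mulrC.
Qed.

Lemma alt_tact t (x : P) : exists2 c, c != 0 & forall i j,
  alt (coords (tact t x)) i j = c * (val t i * val t j * alt (coords x) i j).
Proof.
have [c c0 cE] := tact_coords t x; exists c => // i j.
by rewrite cE alt_scale alt_tscale.
Qed.

Lemma mem_support (x : P) i j :
  ([set i; j]%SET \in Defs.support x) = (alt (coords x) i j != 0).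
Proof.
apply/imsetP/idP => [[[[k l] lkl] /= xkl E]|nz].
  have klE : alt (coords x) k l != 0.
    by move: xkl; rewrite inE alt_lt.
  have nkl : k != l by apply: contraTneq (lkl) => ->; rewrite ltnn.
  have : (i == k) && (j == l) || (i == l) && (j == k).
    have ki : (k \in [set i; j])%SET by rewrite E in_set2 eqxx.
    have li : (l \in [set i; j])%SET by rewrite E in_set2 eqxx orbT.
    move: ki li nkl; rewrite !in_set2.
    by move=> /orP [/eqP ->|/eqP ->] /orP [/eqP ->|/eqP ->]; rewrite !eqxx ?orbT.
  case/orP => /andP [/eqP -> /eqP ->] //.
  by rewrite altN oppr_eq0.
move: nz; rewrite /alt; case: insubP => [ij lij E|nij].
  by move=> nz; exists ij; [rewrite inE|rewrite E].
case: insubP => [ij lij E|nji]; last by rewrite eqxx.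
by rewrite oppr_eq0 => nz; exists ij; [rewrite inE|rewrite E finset.setUC].
Qed.

Lemma support_point_of (v : @punctured K (pairs m)) i j :
  ([set i; j]%SET \in Defs.support (point_of v)) = (alt (val v) i j != 0).
Proof.
rewrite mem_support; have [c c0 ->] := coords_point_of v.
by rewrite alt_scale mulf_eq0 negb_or c0.
Qed.

Lemma support_eqP (x : P) (B : {set {set 'I_m}}) (y : P) : Defs.support y = B ->
  (forall i j, ([set i; j]%SET \in Defs.support x) = ([set i; j]%SET \in B)) ->
  Defs.support x = B.
Proof.
move=> <- H; apply/setP => b.
apply/idP/idP => bx; case/imsetP: (bx) => ij _ bE.
  by rewrite bE -H -bE.
by rewrite bE H -bE.
Qed.

Lemma gr2_alt (x : P) : gr2 x -> exists (A : 'M[K]_(2, m)) c, c != 0 /\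
  forall i j, alt (coords x) i j = c * (A 0 i * A 1 j - A 0 j * A 1 i).
Proof.
move=> [A [_ [v vA ->]]]; have [c c0 cE] := coords_point_of v.
by exists A, c; split=> // i j; rewrite cE alt_scale vA alt_plucker.
Qed.

Lemma plucker_relation (x : P) i j k l : gr2 x -> let q := alt (coords x) in
  q k l * q i j = q i l * q k j - q j l * q k i.
Proof. by move=> /gr2_alt [A [c [_ q]]] /=; rewrite !q; ring. Qed.

Lemma point_eq (x y : P) (i0 j0 : 'I_m) :
  alt (coords x) i0 j0 != 0 -> alt (coords y) i0 j0 != 0 ->
  (forall i j, alt (coords x) i j / alt (coords x) i0 j0 =
               alt (coords y) i j / alt (coords y) i0 j0) -> x = y.
Proof.
move=> x0 y0 H.
rewrite -(point_of_coords (coords_neq0 x)) -(point_of_coords (coords_neq0 y)).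
apply: (@point_of_eq _ _ _ _ (alt (coords y) i0 j0 / alt (coords x) i0 j0)).
  by rewrite mulf_neq0 ?invr_neq0.
apply/ffunP => ij; rewrite ffunE/= -!alt_pair mulrAC -mulrA H mulrC.
by rewrite divfK.
Qed.

Lemma regular_alt_ratio (A : set P) i j i0 j0 :
  (forall x, A x -> alt (coords x) i0 j0 != 0) ->
  regular setT (fun x : A => alt (coords (val x)) i j / alt (coords (val x)) i0 j0).
Proof.
have pos k l k0 l0 : (forall x, A x -> alt (coords x) k0 l0 != 0) -> (k0 < l0)%N ->
    regular setT (fun x : A => alt (coords (val x)) k l / alt (coords (val x)) k0 l0).
  move=> nz lt; pose kl0 : pairs m := exist _ (k0, l0) lt.
  have kl0E v : alt v k0 l0 = v kl0 by rewrite -alt_pair.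
  have nz' x : A x -> coords x kl0 != 0 by rewrite -kl0E; exact: nz.
  have [lkl|] := ltnP k l.
    apply: (regular_ext _ (regular_coords_ratio (exist _ (k, l) lkl : pairs m) nz')).
    by move=> x; rewrite kl0E alt_lt.
  rewrite leq_eqVlt => /orP [/eqP kl|llk].
    apply: (regular_ext _ (regular_cst _ 0 openT)) => x.
    by rewrite (val_inj kl) altxx mul0r.
  apply: (regular_ext _ (regularN openT
    (regular_coords_ratio (exist _ (l, k) llk : pairs m) nz'))).
  by move=> x; rewrite kl0E altN alt_lt mulNr.
move=> nz; have [lt|] := ltnP i0 j0; first exact: pos.
rewrite leq_eqVlt => /orP [/eqP ji|lt].
  apply: (regular_ext _ (regular_cst _ 0 openT)) => x.
  by have := nz _ (set_valP x); rewrite (val_inj ji) altxx eqxx.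
apply: (regular_ext _ (pos j i j0 i0 _ lt)) => [x|x /nz]; last by rewrite altN oppr_eq0.
by rewrite altN [X in _ / X]altN invrN mulrNN.
Qed.

End PluckerCoordinates.

Section ThinCell.
Variables (K : numClosedFieldType) (m : nat) (B : {set {set 'I_m}}).
Variable (x0 : proj K (pairs m)).
Hypothesis Bx0 : thin_cell K B x0.
Local Notation q x := (alt (coords x)).
Local Notation b i j := ([set i; j]%SET \in B).

Lemma thin_cellP x : thin_cell K B x -> forall i j, (q x i j != 0) = b i j.
Proof. by move=> [_ <-] i j; rewrite mem_support. Qed.

Lemma thin_cell_eq0 x i j : thin_cell K B x -> ~~ b i j -> q x i j = 0.
Proof. by move=> Bx; rewrite -(thin_cellP Bx) negbK => /eqP. Qed.

Lemma thin_cell_neq0 x i j : thin_cell K B x -> b i j -> q x i j != 0.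
Proof. by move=> Bx; rewrite (thin_cellP Bx). Qed.

Lemma basisC i j : b i j = b j i.
Proof. by rewrite finset.setUC. Qed.

Variables (i0 j0 : 'I_m).
Hypothesis b0 : b i0 j0.

(** These are the positions of the non-zero entries of the two rows, once the
columns [i0] and [j0] are the standard basis: up to the common factor [q x i0 j0]
the entries of column [i] are then [q x i j0] and [q x i0 i]. *)
Definition has_up i := b i j0.
Definition has_low i := b i0 i.
Definition has_both i := has_up i && has_low i.
Definition slope (x : proj K (pairs m)) i : K := q x i0 i / q x i j0.

(** A representative of the parallel class of [i].  The slopes of [x0] serve to
define it, but parallelism only depends on [B] (see [slope_parallel]). *)
Definition class_rep i :=
  if has_both i then odflt i [pick k | has_both k && (slope x0 k == slope x0 i)] else i.

Lemma repP i : has_both i -> has_both (class_rep i) /\ slope x0 (class_rep i) = slope x0 i.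
Proof.
rewrite /class_rep => /[dup] bi ->; case: pickP => [k /andP [bk /eqP]//|/(_ i)].
by rewrite bi eqxx.
Qed.

Lemma rep_slope i j : has_both i -> has_both j -> slope x0 i = slope x0 j ->
  class_rep i = class_rep j.
Proof.
move=> bi bj E; rewrite /class_rep bi bj E.
case: pickP => // /(_ j); by rewrite bj eqxx.
Qed.

Lemma rep_idem i : has_both i -> class_rep (class_rep i) = class_rep i.
Proof. by move=> bi; have [br sr] := repP bi; exact: rep_slope. Qed.

Let rel x i j : thin_cell K B x ->
  q x i0 j0 * q x i j = q x i j0 * q x i0 j - q x j j0 * q x i0 i.
Proof. by move=> [gx _]; exact: plucker_relation. Qed.

Lemma slope_parallel x i j : thin_cell K B x -> has_both i -> has_both j ->
  (slope x i == slope x j) = ~~ b i j.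
Proof.
move=> Bx /andP [ui li] /andP [uj lj].
have qi := thin_cell_neq0 Bx ui; have qj := thin_cell_neq0 Bx uj.
have q0 := thin_cell_neq0 Bx b0.
rewrite -(thin_cellP Bx) negbK /slope eqr_div// -(mulrI_eq0 _ (mulfI q0)) rel//.
by rewrite subr_eq0 eq_sym mulrC [q x i0 i * _]mulrC.
Qed.

Lemma rep_parallel x i : thin_cell K B x -> has_both i -> slope x (class_rep i) = slope x i.
Proof.
move=> Bx bi; have [br sr] := repP bi; apply/eqP.
by rewrite (slope_parallel Bx)// -(slope_parallel Bx0)// sr.
Qed.

Lemma parallel_rep i j : has_both i -> has_both j -> ~~ b i j -> class_rep i = class_rep j.
Proof.
by move=> bi bj; rewrite -(slope_parallel Bx0)// => /eqP; exact: rep_slope.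
Qed.

(** Otherwise one of the two products in the minor of [x0] at [i], [j] would
vanish, but not the other. *)
Lemma parallel_both i j : has_up i -> has_low j -> ~~ b i j -> has_both i /\ has_both j.
Proof.
move=> ui lj nij; have := rel i j Bx0.
rewrite (thin_cell_eq0 Bx0 nij) mulr0 => /eqP; rewrite eq_sym subr_eq0 => /eqP E.
have : q x0 j j0 * q x0 i0 i != 0.
  by rewrite -E mulf_neq0 ?(thin_cell_neq0 Bx0).
rewrite mulf_eq0 negb_or !(thin_cellP Bx0) => /andP [uj li].
by split; apply/andP; split.
Qed.

Lemma up_i0 : has_up i0. Proof. exact: b0. Qed.
Lemma low_j0 : has_low j0. Proof. exact: b0. Qed.
Lemma up_j0 : has_up j0 = false.
Proof. by rewrite /has_up -(thin_cellP Bx0) altxx eqxx. Qed.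
Lemma low_i0 : has_low i0 = false.
Proof. by rewrite /has_low -(thin_cellP Bx0) altxx eqxx. Qed.

(** For [normal_data] below, column [i] is [t i] times one of the vectors (1, z),
(1, 0), (0, 1) and 0, where z is the slope of its parallel class. *)
Definition cell_mx (t z : 'I_m -> K) : 'M[K]_(2, m) := \matrix_(r, i)
  if r == 0 then (has_up i)%:R * t i else (has_low i)%:R * (t i * z (class_rep i)).

Definition minor_of (t z : 'I_m -> K) i j :=
  t i * t j * ((has_up i && has_low j)%:R * z (class_rep j) -
               (has_up j && has_low i)%:R * z (class_rep i)).

Lemma alt_cell_mx t z i j : alt (plucker (cell_mx t z)) i j = minor_of t z i j.
Proof.
rewrite alt_plucker !mxE /= /minor_of.
by case: (has_up i); case: (has_low j); case: (has_up j); case: (has_low i); rewrite /=; ring.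
Qed.

Definition col_scale x i : K :=
  if has_up i then q x i j0 / q x i0 j0 else
  if has_low i then q x i0 i / q x i0 j0 else 1.

Definition col_slope x r : K := if has_both r then slope x r else 1.

Lemma scales_neq0 x i : thin_cell K B x -> col_scale x i != 0.
Proof.
move=> Bx; rewrite /col_scale; have q0 := thin_cell_neq0 Bx b0.
case: ifP => [ui|_]; first by rewrite mulf_neq0 ?invr_neq0// (thin_cell_neq0 Bx).
by case: ifP => [ui|_]; rewrite ?oner_neq0// mulf_neq0 ?invr_neq0// (thin_cell_neq0 Bx).
Qed.

Lemma slopes_neq0 x i : thin_cell K B x -> col_slope x i != 0.
Proof.
move=> Bx; rewrite /col_slope; case: ifP => [/andP [ui li]|_]; rewrite ?oner_neq0//.
by rewrite mulf_neq0 ?invr_neq0// (thin_cell_neq0 Bx).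
Qed.

(** By the Plücker relation with the pair [i0], [j0], all coordinates are
determined by those which involve [i0] or [j0]. *)
Lemma cell_minor_coords x i j : thin_cell K B x ->
  q x i j / q x i0 j0 = minor_of (col_scale x) (col_slope x) i j.
Proof.
move=> Bx; have q0 := thin_cell_neq0 Bx b0.
have upE k : (has_up k)%:R * col_scale x k = q x k j0 / q x i0 j0.
  rewrite /col_scale; case: ifPn => uk; first by rewrite mul1r.
  by rewrite (thin_cell_eq0 Bx uk) !mul0r.
have lowE k : (has_low k)%:R * (col_scale x k * col_slope x (class_rep k)) =
    q x i0 k / q x i0 j0.
  have [lk|lk] := boolP (has_low k); last by rewrite (thin_cell_eq0 Bx lk) !mul0r.
  rewrite mul1r /col_scale; case: ifPn => uk.
    have bk : has_both k by rewrite /has_both uk lk.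
    rewrite /col_slope (repP bk).1 rep_parallel// /slope mulrAC.
    by rewrite mulrCA mulfV ?mulr1// (thin_cell_neq0 Bx).
  have nbk : has_both k = false by rewrite /has_both (negPf uk).
  by rewrite lk /class_rep nbk /col_slope nbk mulr1.
have -> : minor_of (col_scale x) (col_slope x) i j =
    (has_up i)%:R * col_scale x i *
      ((has_low j)%:R * (col_scale x j * col_slope x (class_rep j))) -
    (has_up j)%:R * col_scale x j *
      ((has_low i)%:R * (col_scale x i * col_slope x (class_rep i))).
  by rewrite -alt_cell_mx alt_plucker !mxE.
rewrite !upE !lowE; apply: (mulfI q0); rewrite mulrCA mulfV// mulr1.
apply: (mulfI q0); rewrite rel// mulrBr mulrBr.
by congr (_ - _); field.
Qed.

(** The slope occurs in [cell_mx] for each lower entry, also when the upper entry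
is zero; it has to be one there. *)
Definition normal_data (t z : 'I_m -> K) :=
  [/\ forall i, t i != 0, forall i, z i != 0, t i0 = 1, t j0 = 1 &
      forall i, ~~ has_both i -> z i = 1].

Lemma cell_minor_up t z i : normal_data t z ->
  minor_of t z i j0 = (has_up i)%:R * t i.
Proof.
move=> [_ _ _ tj zn]; rewrite /minor_of tj mulr1 up_j0 low_j0 andbT mul0r subr0.
by rewrite /class_rep /has_both up_j0 zn ?/has_both ?up_j0// mulr1 mulrC.
Qed.

Lemma cell_minor_low t z i : normal_data t z ->
  minor_of t z i0 i = (has_low i)%:R * (t i * z (class_rep i)).
Proof.
move=> [_ _ ti _ _]; rewrite /minor_of ti mul1r up_i0 low_i0 andbF mul0r subr0.
by rewrite mulrCA.
Qed.

Lemma cell_minor00 t z : normal_data t z -> minor_of t z i0 j0 = 1.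
Proof.
by move=> N; rewrite cell_minor_up// up_i0; case: N => _ _ -> _ _; rewrite mulr1.
Qed.

Lemma cell_minor_parallel t z i j : ~~ b i j -> minor_of t z i j = 0.
Proof.
move=> nij; rewrite /minor_of.
have [/andP [ui lj]|nu] := boolP (has_up i && has_low j).
  have [bi bj] := parallel_both ui lj nij.
  have /andP [_ ->] := bi; have /andP [-> _] := bj.
  by rewrite (parallel_rep bi bj nij) subrr mulr0.
have [/andP [uj li]|nu'] := boolP (has_up j && has_low i); last by rewrite !mul0r subrr mulr0.
case/negP: nu; rewrite basisC in nij.
by have [/andP [_ ->] /andP [-> _]] := parallel_both uj li nij.
Qed.

Lemma cell_mx_punctured t z : normal_data t z -> punctured (plucker (cell_mx t z)).
Proof.
move=> N; apply: contrapT => /forallNP H.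
have : alt (plucker (cell_mx t z)) i0 j0 != 0.
  by rewrite alt_cell_mx cell_minor00 ?oner_neq0.
rewrite /alt; case: insub => [ij|]; first by have /negP := H ij; rewrite negbK => ->.
by case: insub => [ij|]; rewrite ?eqxx// oppr_eq0; have /negP := H ij; rewrite negbK => ->.
Qed.

Definition cell_point t z (N : normal_data t z) : proj K (pairs m) :=
  point_of (SigSub (mem_set (cell_mx_punctured N))).

Lemma cell_pointE t z (N : normal_data t z) : exists2 c, c != 0 &
  forall i j, q (cell_point N) i j = c * minor_of t z i j.
Proof.
have [c c0 cE] := coords_point_of (SigSub (mem_set (cell_mx_punctured N))).
by exists c => // i j; rewrite cE alt_scale alt_cell_mx.
Qed.

Lemma cell_point_ratio t z (N : normal_data t z) i j :
  q (cell_point N) i j / q (cell_point N) i0 j0 = minor_of t z i j.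
Proof.
have [c c0 cE] := cell_pointE N.
by rewrite !cE cell_minor00// mulr1 mulrAC mulfV// mul1r.
Qed.

Lemma cell_point_thin t z (N : normal_data t z) :
  (forall i j, b i j -> minor_of t z i j != 0) -> thin_cell K B (cell_point N).
Proof.
move=> H; split.
  exists (cell_mx t z); split; last by eexists; [|reflexivity].
  apply/eqP; rewrite -[_ == _]/(row_free (cell_mx t z)); apply: inj_row_free => v vA.
  have [_ _ ti tj zn] := N.
  have E (i : 'I_m) := congr1 (fun w : 'rV_m => w 0 i) vA.
  have v0 : v 0 0 = 0.
    have := E i0; rewrite !mxE big_ord_recl big_ord1 !mxE/= up_i0 low_i0 ti.
    by rewrite mulr1n !mul0r mulr0 addr0 !mulr1.
  have v1 : v 0 1 = 0.
    have := E j0; rewrite !mxE big_ord_recl big_ord1 !mxE/= up_j0 low_j0 tj.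
    rewrite /class_rep /has_both up_j0 zn ?/has_both ?up_j0//.
    rewrite mul0r mulr0 add0r !mulr1 => <-; congr (v 0 _).
    exact: val_inj.
  apply/rowP => r; rewrite mxE; case: r => [[|[|//]]] lr.
    by rewrite -[RHS]v0; congr (v 0 _); exact: val_inj.
  by rewrite -[RHS]v1; congr (v 0 _); exact: val_inj.
apply: (@support_eqP _ _ _ _ x0); first by case: Bx0.
move=> i j; rewrite support_point_of /= alt_cell_mx.
by apply/idP/idP => [|/H //]; apply: contraNT => /cell_minor_parallel ->.
Qed.

Lemma scales_cell_point t z (N : normal_data t z) i : has_up i || has_low i ->
  col_scale (cell_point N) i = t i.
Proof.
have [_ _ _ _ zn] := N; rewrite /col_scale.
have [ui _|ui /=] := boolP (has_up i).
  by rewrite cell_point_ratio cell_minor_up// ui mul1r.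
move=> li; rewrite li cell_point_ratio cell_minor_low// li mul1r.
by rewrite /class_rep /has_both (negPf ui) zn ?mulr1// /has_both (negPf ui).
Qed.

Lemma slopes_cell_point t z (N : normal_data t z) r : has_both r -> class_rep r = r ->
  col_slope (cell_point N) r = z r.
Proof.
move=> br rr; rewrite /col_slope br /slope; have /andP [ur lr] := br.
have [c c0 cE] := cell_pointE N; have [t0 z0 _ _ _] := N.
rewrite !cE cell_minor_up// cell_minor_low// ur lr !mul1r rr.
by field; rewrite t0 c0.
Qed.

End ThinCell.

(** * Toric charts of thin Schubert cells *)

Section CellChart.
Variables (K : numClosedFieldType) (m : nat) (B : {set {set 'I_m}}).
Variable (x0 : proj K (pairs m)).
Hypothesis Bx0 : thin_cell K B x0.
Local Notation q x := (alt (coords x)).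
Local Notation b i j := ([set i; j]%SET \in B).
Variables (i0 j0 : 'I_m).
Hypothesis b0 : b i0 j0.
Local Notation up := (has_up B j0).
Local Notation low := (has_low B i0).
Local Notation both := (has_both B i0 j0).
Local Notation rep := (class_rep B x0 i0 j0).
Local Notation cell_minor := (minor_of B x0 i0 j0).
Local Notation scales := (col_scale B i0 j0).
Local Notation slopes := (col_slope B i0 j0).
Local Notation normalised := (normal_data B i0 j0).

Definition cell_coord_pred (k : 'I_m + 'I_m) : bool :=
  match k with
  | inl i => [&& up i || low i, i != i0 & i != j0]
  | inr r => both r && (rep r == r)
  end.

(** The coordinates of the cell: the scales of the columns which are neither
zero nor normalised, and the slopes of the parallel classes other than those of
the two normalised columns. *)
Definition cell_coord : finType := {k : 'I_m + 'I_m | cell_coord_pred k}.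

Definition chart_scale (u : tor K cell_coord) i : K :=
  if insub (inl i) is Some k then val u (k : cell_coord) else 1.
Definition chart_slope (u : tor K cell_coord) r : K :=
  if insub (inr r) is Some k then val u (k : cell_coord) else 1.

Lemma chart_scale_neq0 u i : chart_scale u i != 0.
Proof. by rewrite /chart_scale; case: insub => *; rewrite ?tor_neq0 ?oner_neq0. Qed.

Lemma chart_slope_neq0 u i : chart_slope u i != 0.
Proof. by rewrite /chart_slope; case: insub => *; rewrite ?tor_neq0 ?oner_neq0. Qed.

Lemma chart_scale_regular i : regular setT (fun u => chart_scale u i).
Proof.
rewrite /chart_scale; case: insub => [k|]; first exact: regular_tor_coord.
by apply: regular_cst; exact: openT.
Qed.

Lemma chart_slope_regular i : regular setT (fun u => chart_slope u i).
Proof.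
rewrite /chart_slope; case: insub => [k|]; first exact: regular_tor_coord.
by apply: regular_cst; exact: openT.
Qed.

Lemma chart_normalised u : normalised (chart_scale u) (chart_slope u).
Proof.
split; [exact: chart_scale_neq0|exact: chart_slope_neq0| | |move=> i nb].
- by rewrite /chart_scale insubN//= eqxx andbF.
- by rewrite /chart_scale insubN//= eqxx !andbF.
- by rewrite /chart_slope insubN//= (negPf nb).
Qed.

(** A minor without the scales of its columns.  The condition defining the chart
only involves the slopes, which leaves the scales free to be solved for. *)
Definition bracket (u : tor K cell_coord) i j :=
  (up i && low j)%:R * chart_slope u (rep j) - (up j && low i)%:R * chart_slope u (rep i).

Lemma bracket_regular i j : regular setT (fun u => bracket u i j).
Proof.
have oT := @openT (tor K cell_coord).
by apply: regularD; [|apply: regularM; [|exact: regular_cst|exact: chart_slope_regular]|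
  apply: regularN; [|apply: regularM; [|exact: regular_cst|exact: chart_slope_regular]]].
Qed.

Lemma cell_minorE u i j :
  cell_minor (chart_scale u) (chart_slope u) i j =
  chart_scale u i * chart_scale u j * bracket u i j.
Proof. by []. Qed.

Lemma cell_minor_regular i j :
  regular setT (fun u => cell_minor (chart_scale u) (chart_slope u) i j).
Proof.
have oT := @openT (tor K cell_coord).
by apply: regularM; [|apply: regularM; [|exact: chart_scale_regular..]|exact: bracket_regular].
Qed.

Definition cell_fun (u : tor K cell_coord) : K :=
  \prod_(ij : 'I_m * 'I_m | b ij.1 ij.2) bracket u ij.1 ij.2.

Lemma cell_fun_regular : regular setT cell_fun.
Proof.
by apply: regular_prod => [|ij _]; [exact: openT|exact: bracket_regular].
Qed.

Lemma cell_fun_neq0 u : reflect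
  (forall i j, b i j -> cell_minor (chart_scale u) (chart_slope u) i j != 0) (cell_fun u != 0).
Proof.
apply: (iffP idP) => [/prodf_neq0 H i j bij|H].
  by rewrite cell_minorE !mulf_neq0 ?chart_scale_neq0// (H (i, j)).
apply/prodf_neq0 => -[i j] /= bij; have := H i j bij.
by rewrite cell_minorE !mulf_eq0 !negb_or => /andP [].
Qed.

Definition cell_chart (x : proj K (pairs m)) : tor K cell_coord := tor_of (fun k =>
  match val k with inl i => scales x i | inr r => slopes x r end).

Lemma cell_chartE x k : thin_cell K B x ->
  val (cell_chart x) k = match val k with inl i => scales x i | inr r => slopes x r end.
Proof.
by move=> Bx; rewrite tor_ofE//; case: (val k) => i;
  [exact: scales_neq0|exact: slopes_neq0].
Qed.

Lemma cell_minor_chart x i j : thin_cell K B x ->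
  cell_minor (chart_scale (cell_chart x)) (chart_slope (cell_chart x)) i j =
  q x i j / q x i0 j0.
Proof.
move=> Bx; rewrite (cell_minor_coords Bx0 b0)//.
have zE k : low k -> chart_slope (cell_chart x) (rep k) = slopes x (rep k).
  move=> lk; rewrite /chart_slope; have [bk|nbk] := boolP (both k).
    have [br _] := repP x0 bk.
    case: insubP => [k' _ kE|]; first by rewrite cell_chartE// kE.
    by rewrite /= br (rep_idem x0 bk) eqxx.
  rewrite /class_rep (negPf nbk) insubN /= ?(negPf nbk)//.
  by rewrite /col_slope (negPf nbk).
have q0 := thin_cell_neq0 Bx b0.
have tE k : up k || low k -> chart_scale (cell_chart x) k = scales x k.
  move=> uk; rewrite /chart_scale; case: insubP => [k' _ kE|].
    by rewrite cell_chartE// kE.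
  rewrite /= uk /= negb_and !negbK => /orP [/eqP ->|/eqP ->].
    by rewrite /col_scale (up_i0 b0) mulfV.
  by rewrite /col_scale (up_j0 Bx0) (low_j0 b0) mulfV.
rewrite /minor_of.
have [/andP [ui lj]|_] := boolP (up i && low j);
have [/andP [uj li]|_] := boolP (up j && low i);
  rewrite ?mul0r ?mulr0 ?subr0 ?mulr0//.
- by rewrite !tE ?ui ?uj// !zE.
- by rewrite !tE ?ui ?lj ?orbT// !zE.
- by rewrite !tE ?uj ?li ?orbT// !zE.
Qed.

Definition cell_inv (u : tor K cell_coord) : proj K (pairs m) :=
  cell_point Bx0 b0 (chart_normalised u).

Lemma cell_inv_thin u : cell_fun u != 0 -> thin_cell K B (cell_inv u).
Proof. by move=> /cell_fun_neq0; exact: cell_point_thin. Qed.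

Lemma cell_chart_neq0 x : thin_cell K B x -> cell_fun (cell_chart x) != 0.
Proof.
move=> Bx; apply/cell_fun_neq0 => i j bij; rewrite cell_minor_chart//.
by rewrite mulf_neq0 ?invr_neq0 ?(thin_cell_neq0 Bx).
Qed.

Lemma cell_invK x : thin_cell K B x -> cell_inv (cell_chart x) = x.
Proof.
move=> Bx; have Bi := cell_inv_thin (cell_chart_neq0 Bx).
apply: (@point_eq _ _ _ _ i0 j0); rewrite ?(thin_cell_neq0 _ b0)// => i j.
by rewrite cell_point_ratio cell_minor_chart.
Qed.

Lemma cell_chartK u : cell_fun u != 0 -> cell_chart (cell_inv u) = u.
Proof.
move=> fu; apply: torP => k; rewrite (cell_chartE _ (cell_inv_thin fu)).
have := valP k; case E: (val k) => [i|r] /=.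
  move=> /andP [ui _]; rewrite scales_cell_point// /chart_scale.
  case: insubP => [k' _ kE|]; last by rewrite -E (valP k).
  by congr (val u _); apply: val_inj; rewrite kE.
move=> /andP [br /eqP rr]; rewrite slopes_cell_point// /chart_slope.
case: insubP => [k' _ kE|]; last by rewrite -E (valP k).
by congr (val u _); apply: val_inj; rewrite kE.
Qed.

Lemma cell_chart_morphism (A : set (proj K (pairs m))) : A `<=` thin_cell K B ->
  morphism (fun x : A => cell_chart (val x)).
Proof.
move=> sA; apply: morphism_tor => k.
have BA (x : A) : thin_cell K B (val x) by exact/sA/set_valP.
apply: (regular_ext (fun x => esym (cell_chartE k (BA x)))).
have r1 : regular setT (fun _ : A => 1 : K) by apply: regular_cst; exact: openT.
case: (val k) => i.
  rewrite /col_scale; case: (boolP (up i)) => [ui|_].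
    by apply: regular_alt_ratio => x /sA Bx; exact: (thin_cell_neq0 Bx).
  case: (boolP (low i)) => [li|_]; last exact: r1.
  by apply: regular_alt_ratio => x /sA Bx; exact: (thin_cell_neq0 Bx).
rewrite /col_slope; case: (boolP (both i)) => [/andP [ui _]|_]; last exact: r1.
by apply: regular_alt_ratio => x /sA Bx; exact: (thin_cell_neq0 Bx).
Qed.

Lemma cell_inv_morphism : morphism cell_inv.
Proof.
pose v u := plucker (cell_mx B x0 i0 j0 (chart_scale u) (chart_slope u)).
have v0 u := cell_mx_punctured Bx0 b0 (chart_normalised u).
apply: (morphism_proj (v := v) (v0 := v0)) => [ij|u]; last first.
  by congr point_of; exact: val_inj.
apply: (regular_ext _ (cell_minor_regular (val ij).1 (val ij).2)) => u.
by rewrite -alt_cell_mx alt_pair.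
Qed.

(** Column [l] is multiplied by the entry [l] of the torus element; restoring the
normalisation divides the two rows by its entries [i0] and [j0]. *)
Definition cell_weight (i : 'I_m) (k : cell_coord) : int :=
  match val k with
  | inl l => (i == l)%:Z - (i == if up l then i0 else j0)%:Z
  | inr _ => (i == i0)%:Z - (i == j0)%:Z
  end.

Definition torus_tor (s : torus K m) : tor K 'I_m := tor_of (fun i => val s i).

Lemma torus_torE s i : val (torus_tor s) i = val s i.
Proof. by rewrite tor_ofE// torus_neq0. Qed.

Lemma prod_weight (u : tor K 'I_m) k l :
  \prod_i val u i ^ ((i == k)%:Z - (i == l)%:Z) = val u k / val u l.
Proof.
have D r : \prod_i val u i ^ (i == r)%:Z = val u r.
  rewrite (bigD1 r)//= eqxx expr1z big1 ?mulr1// => i ir.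
  by rewrite (negPf ir) expr0z.
under eq_bigr => i _ do rewrite expfzDr ?tor_neq0// -invr_expz.
by rewrite big_split/= prodfV !D.
Qed.

Lemma cell_chart_tact t x : thin_cell K B x ->
  cell_chart (tact t x) = tor_mul (monom cell_weight (torus_tor t)) (cell_chart x).
Proof.
move=> Bx; have Btx := thin_cell_tact t Bx.
apply: torP => k; rewrite tor_mulE monomE !cell_chartE//.
have [c c0 cE] := alt_tact t x.
have t0 i := torus_neq0 t i.
rewrite /cell_weight; have := valP k; case: (val k) => [l|r].
  move=> /and3P [ul _ _]; rewrite prod_weight !torus_torE /col_scale.
  have q0 := thin_cell_neq0 Bx b0.
  case: ifP ul => [ul _|_ /= ll]; first by rewrite !cE; field; rewrite !t0 q0 c0.
  by rewrite ll !cE; field; rewrite !t0 q0 c0.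
move=> /andP [br _]; rewrite prod_weight !torus_torE /col_slope br /slope !cE.
have /andP [ur _] := br.
by field; rewrite !t0 c0 (thin_cell_neq0 Bx ur).
Qed.

(** An element fixes a point exactly if its weights on the bases are all equal, a
condition which does not depend on the point. *)
Lemma stab_of_fixed s x : thin_cell K B x -> tact s x = x -> stab B s.
Proof.
move=> Bx sx y By; have [c c0 cE] := alt_tact s x; have [d d0 dE] := alt_tact s y.
have wE i j : b i j -> c * (val s i * val s j) = 1.
  move=> bij; have qx := thin_cell_neq0 Bx bij.
  by apply: (mulIf qx); rewrite mul1r -mulrA -cE sx.
have q0 := thin_cell_neq0 By b0; have s0 i := torus_neq0 s i.
apply: (@point_eq _ _ _ _ i0 j0) => //.
  by rewrite dE !mulf_neq0.
move=> i j; have [bij|nbij] := boolP (b i j).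
  have E : val s i * val s j = val s i0 * val s j0.
    by apply: (mulfI c0); rewrite !wE.
  rewrite !dE E; field; by rewrite !s0 q0 d0.
by rewrite dE (thin_cell_eq0 By nbij) !mulr0 !mul0r.
Qed.

Lemma nonloop i j : b i j -> up i || low i.
Proof.
move=> bij; apply: contraT; rewrite negb_or => /andP [ui li].
have := plucker_relation i j i0 j0 Bx0.1.
rewrite /= (thin_cell_eq0 Bx0 ui) (thin_cell_eq0 Bx0 li) mul0r mulr0 subr0 => /eqP.
by rewrite mulf_eq0 (negPf (thin_cell_neq0 Bx0 b0)) (negPf (thin_cell_neq0 Bx0 bij)).
Qed.

End CellChart.

(** * Subtori and the hyperplane section *)

Section TorusCoordinates.
Variables (K : numClosedFieldType) (m : nat).

(** Coordinates of [S] by a standard torus, in which the entries of an element of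
[S] are the monomials with exponents [F]. *)
Definition torus_param (S : subtorus K m) (L : finType)
    (kap : subtorus_set S -> tor K L) (F : L -> 'I_m -> int) :=
  [/\ quotient_map kap,
      forall s t, kap (smul s t) = tor_mul (kap s) (kap t) &
      forall s, torus_tor (val s) = monom F (kap s)].

Lemma torus_val_regular (S : subtorus K m) i :
  regular setT (fun s : subtorus_set S => val (val s) i).
Proof.
have mS : morphism (fun s : subtorus_set S => (val s : torus K m)).
  exact: morphism_val.
exact: (affine_coord_regular i mS).
Qed.

Definition tor_torus (u : tor K 'I_m) : torus K m :=
  SigSub (mem_set ((fun i => tor_neq0 u i) : torus_set (val u))).

Lemma full_torus_param :
  torus_param (fun s : subtorus_set (full_torus K m) => torus_tor (val s))
    (fun i j => (i == j)%:Z).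
Proof.
split.
- pose sec (u : tor K 'I_m) : subtorus_set (full_torus K m) :=
    SigSub (mem_set (I : subtorus_set (full_torus K m) (tor_torus u))).
  apply: (@quotient_map_section _ _ _ _ sec).
  + apply: morphism_tor => i.
    apply: (@regular_ext _ _ _ _ _ (fun s : subtorus_set (full_torus K m) =>
      esym (torus_torE (val s) i))).
    exact: torus_val_regular.
  + apply: morphism_into; apply: morphism_into; exact: morphism_val.
  + by move=> u; apply: torP => i; rewrite torus_torE.
- by move=> s t; apply: torP => i; rewrite tor_mulE !torus_torE tmulE.
- by move=> s; rewrite monom_id.
Qed.

End TorusCoordinates.

Section SymplecticTorus.
Variables (K : numClosedFieldType) (n : nat).
Local Notation sp := (subtorus_set (sp_torus K n)).

Definition sp_weight (i : 'I_n) (k : 'I_(n + n)) : int :=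
  (k == lshift n i)%:Z - (k == rev_ord (lshift n i))%:Z.

Definition sp_coord (s : sp) : tor K 'I_n := tor_of (fun i => val (val s) (lshift n i)).

Lemma sp_coordE s i : val (sp_coord s) i = val (val s) (lshift n i).
Proof. by rewrite tor_ofE// torus_neq0. Qed.

Lemma sp_rev (s : sp) i :
  val (val s) (rev_ord (lshift n i)) = (val (val s) (lshift n i))^-1.
Proof. by have [mu H] := set_valP s; have [-> ->] := H i. Qed.

Lemma half_cases (k : 'I_(n + n)) : exists i, k = lshift n i \/ k = rev_ord (lshift n i).
Proof.
have [kn|nk] := ltnP k n.
  by exists (Ordinal kn); left; apply: val_inj.
have lt : (n + n - k.+1 < n)%N.
  by rewrite ltn_subLR ?ltn_ord// addSn ltnS leq_add2r.
exists (Ordinal lt); right; apply: val_inj => /=.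
by rewrite subnSK ?subKn// ltnW.
Qed.

Lemma lshift_rev_neq (i j : 'I_n) : lshift n i != rev_ord (lshift n j).
Proof.
apply/eqP => /(congr1 val) /= E.
have := ltn_ord i; rewrite E ltnNge => /negP; apply.
by rewrite -addnBA ?leq_addr//.
Qed.

Lemma monom_sp_weight (a : tor K 'I_n) i :
  val (monom sp_weight a) (lshift n i) = val a i /\
  val (monom sp_weight a) (rev_ord (lshift n i)) = (val a i)^-1.
Proof.
split; rewrite monomE (bigD1 i)//= /sp_weight.
  rewrite eqxx (negPf (lshift_rev_neq _ _)) subr0 expr1z big1 ?mulr1// => j ji.
  rewrite (negPf (lshift_rev_neq _ _)) subr0 (inj_eq (@lshift_inj _ _)) eq_sym.
  by rewrite (negPf ji) expr0z.
rewrite eqxx eq_sym (negPf (lshift_rev_neq _ _)) sub0r -invr_expz expr1z.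
rewrite big1 ?mulr1// => j ji.
rewrite eq_sym (negPf (lshift_rev_neq _ _)) sub0r (inj_eq rev_ord_inj).
by rewrite (inj_eq (@lshift_inj _ _)) eq_sym (negPf ji) expr0z.
Qed.

Lemma sp_torus_param : torus_param sp_coord sp_weight.
Proof.
have Wsp (a : tor K 'I_n) : sp_torus_set (tor_torus (monom sp_weight a)).
  by exists (val a) => i; have [-> ->] := monom_sp_weight a i.
split.
- pose sec (a : tor K 'I_n) : sp := SigSub (mem_set (Wsp a)).
  apply: (@quotient_map_section _ _ _ _ sec).
  + apply: morphism_tor => i; apply: (regular_ext (fun s : sp => esym (sp_coordE s i))).
    exact: torus_val_regular.
  + apply: morphism_into; apply: morphism_into.
    apply: morphism_affine => k.
    exact: (morphism_tor_coord k (monom_morphism K sp_weight)).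
  + by move=> a; apply: torP => i; rewrite sp_coordE /= (monom_sp_weight a i).1.
- by move=> s t; apply: torP => i; rewrite tor_mulE !sp_coordE tmulE.
- move=> s; apply: torP => k; rewrite torus_torE.
  have [i [->|->]] := half_cases k; have [El Er] := monom_sp_weight (sp_coord s) i.
    by rewrite El sp_coordE.
  by rewrite Er sp_coordE sp_rev.
Qed.

End SymplecticTorus.

Section CellToricChart.
Variables (K : numClosedFieldType) (m : nat) (B : {set {set 'I_m}}).
Variables (x0 : proj K (pairs m)) (i0 j0 : 'I_m).
Hypotheses (Bx0 : thin_cell K B x0) (b0 : [set i0; j0]%SET \in B).
Variables (S : subtorus K m) (L : finType) (kap : subtorus_set S -> tor K L)
  (F : L -> 'I_m -> int) (kapP : torus_param kap F).
Variable X : stable_subset S B.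
Local Notation J := (cell_coord B x0 i0 j0).
Local Notation h := (@cell_chart K m B x0 i0 j0).
Local Notation cell_inv := (cell_inv Bx0 b0).

Definition param_weight l (k : J) : int := \sum_i F l i * cell_weight i k.

Lemma chart_sact s x : h (val (sact (X := X) s x)) =
  tor_mul (monom param_weight (kap s)) (h (val x)).
Proof.
have [_ _ kF] := kapP; rewrite /= (cell_chart_tact x0 b0); last first.
  by apply: (@stable_thin _ _ _ _ X); exact: set_valP.
by rewrite kF monom_comp.
Qed.

Lemma cell_toric_chart : (forall x, thin_cell K B x -> stable_set X x) ->
  toric_chart X #|J|.
Proof.
move=> cX; have [qk kM kF] := kapP.
have BX (x : stable_set X) : thin_cell K B (val x).
  by apply: (@stable_thin _ _ _ _ X); exact: set_valP.
pose X0 : stable_set X := SigSub (mem_set (cX _ Bx0)).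
pose hV u : stable_set X := if pselect (stable_set X (cell_inv u)) is left H
  then SigSub (mem_set H) else X0.
have hVE u : cell_fun u != 0 -> val (hV u) = cell_inv u.
  by move=> /(cell_inv_thin Bx0 b0) /cX H; rewrite /hV; case: pselect.
exists L, J, kap, param_weight, (@cell_fun K m B x0 i0 j0), (fun x => h (val x)), hV.
split; first by split.
split; split.
- exact: cell_fun_regular.
- apply: (cell_chart_morphism x0 b0).
  exact: (@stable_thin _ _ _ _ X).
- apply: morphism_into.
  have m1 : morphism (fun u : [set u | cell_fun u != 0] => cell_inv (val u)).
    exact: (morphism_comp (morphism_val _) (cell_inv_morphism Bx0 b0)).
  by apply: morphism_ext m1 => u; rewrite hVE//; exact: (set_valP u).
- by move=> x; exact: cell_chart_neq0.
- move=> x; apply: val_inj; rewrite hVE; last exact: cell_chart_neq0.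
  exact: cell_invK.
- by move=> u fu; rewrite hVE//; exact: cell_chartK.
- exact: chart_sact.
Qed.

(** Let [X] be defined in the chart by an equation [c u * val u j + r u = 0] where
[c] has no zeros, and the coordinate [j] occurs neither in [c] and [r] nor in the
condition defining the chart.  Its solution [- r u / c u] for [val u j] is
admissible where [r] is non-zero, so that the other coordinates form a chart. *)
Section SolveCoordinate.
Variables (j : J) (c r : tor K J -> K) (H : set (proj K (pairs m))).
Hypothesis XH : forall x, stable_set X x <-> thin_cell K B x /\ H x.
Hypothesis X_neq0 : stable_set X !=set0.
Let agree (u v : tor K J) := forall k, k != j -> val u k = val v k.
Hypothesis c_reg : regular setT c.
Hypothesis r_reg : regular setT r.
Hypothesis c_agree : forall u v, agree u v -> c u = c v.
Hypothesis r_agree : forall u v, agree u v -> r u = r v.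
Hypothesis f_agree : forall u v, agree u v -> cell_fun u = cell_fun v.
Hypothesis c_neq0 : forall u, cell_fun u != 0 -> c u != 0.
Hypothesis H_eq : forall x, thin_cell K B x ->
  (H x <-> c (h x) * val (h x) j + r (h x) = 0).

Lemma solved_toric_chart : toric_chart X #|J|.-1.
Proof.
have [qk kM kF] := kapP.
have BX (x : stable_set X) : thin_cell K B (val x).
  by apply: (@stable_thin _ _ _ _ X); exact: set_valP.
have [X00 XX00] := X_neq0; pose X0 : stable_set X := SigSub (mem_set XX00).
pose J' : finType := {k : J | k != j}.
pose res : tor K J -> tor K J' := pull (val : J' -> J).
pose ext (u : tor K J') (a : K) : tor K J :=
  tor_of (fun k => if insub k is Some k' then val u (k' : J') else a).
have extE u a k : a != 0 ->
    val (ext u a) k = if insub k is Some k' then val u (k' : J') else a.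
  by move=> a0; rewrite tor_ofE//; case: insub => *; rewrite ?tor_neq0.
have ext_j u a : a != 0 -> val (ext u a) j = a.
  by move=> a0; rewrite extE// insubN// eqxx.
have ext_agree u a a' : a != 0 -> a' != 0 -> agree (ext u a) (ext u a').
  by move=> a0 a0' k kj; rewrite !extE//; case: insubP => //; rewrite kj.
have res_ext u a : a != 0 -> res (ext u a) = u.
  by move=> a0; apply: torP => k; rewrite pullE extE// valK.
have ext_res u a : a != 0 -> agree (ext (res u) a) u.
  move=> a0 k kj; rewrite extE//; case: insubP => [k' _ kE|]; last by rewrite kj.
  by rewrite pullE kE.
have one0 : (1 : K) != 0 by exact: oner_neq0.
pose e1 u := ext u 1.
pose sol u := - r (e1 u) / c (e1 u).
pose f' u := cell_fun (e1 u) * r (e1 u).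
pose E u := ext u (sol u).
have f'P u : f' u != 0 -> [/\ cell_fun (e1 u) != 0, sol u != 0 & cell_fun (E u) != 0].
  rewrite mulf_eq0 negb_or => /andP [f0 r0].
  have s0 : sol u != 0 by rewrite mulf_neq0 ?invr_neq0 ?c_neq0// oppr_eq0.
  by split=> //; rewrite (f_agree (ext_agree u _ _ s0 one0)).
have EX u : f' u != 0 -> stable_set X (cell_inv (E u)).
  move=> /f'P [f1 s0 fE]; apply/XH; have BE := cell_inv_thin Bx0 b0 fE.
  split=> //; apply/(H_eq BE); rewrite cell_chartK// ext_j//.
  rewrite (c_agree (ext_agree u _ _ s0 one0)) (r_agree (ext_agree u _ _ s0 one0)).
  by rewrite /sol mulrC divfK ?c_neq0// addNr.
pose hV u : stable_set X := if pselect (stable_set X (cell_inv (E u))) is left H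
  then SigSub (mem_set H) else X0.
have hVE u : f' u != 0 -> val (hV u) = cell_inv (E u).
  by move=> /EX EXu; rewrite /hV; case: pselect.
have me1 : morphism e1.
  apply: morphism_tor => k.
  apply: (regular_ext (fun u => esym (extE u _ k one0))).
  case: insub => [k'|]; first exact: regular_tor_coord.
  by apply: regular_cst; exact: openT.
have resE (x : stable_set X) : f' (res (h (val x))) != 0 /\
    E (res (h (val x))) = h (val x).
  have Bx := BX x; have [_ Hx] := (XH _).1 (set_valP x).
  have /eqP := (H_eq Bx).1 Hx; rewrite addrC addr_eq0 => /eqP rE.
  have fx := cell_chart_neq0 Bx0 b0 Bx.
  have ag1 := ext_res (h (val x)) 1 one0.
  have r0 : r (h (val x)) != 0.
    by rewrite rE oppr_eq0 mulf_neq0 ?tor_neq0// c_neq0.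
  split; first by rewrite /f' /e1 (f_agree ag1) (r_agree ag1) mulf_neq0.
  have sE : sol (res (h (val x))) = val (h (val x)) j.
    rewrite /sol /e1 (c_agree ag1) (r_agree ag1) rE opprK mulrC mulrA mulVf ?mul1r//.
    exact: c_neq0.
  rewrite /E sE; apply: torP => k; rewrite extE ?tor_neq0//.
  case: insubP => [k' _ kE|]; first by rewrite pullE kE.
  by rewrite negbK => /eqP ->.
exists L, J', kap, (fun l (k : J') => param_weight l (val k)), f',
  (fun x => res (h (val x))), hV.
split.
  split=> //; rewrite card_sig (eq_card (B := predC1 j)) ?cardC1//.
split; split.
- by apply: regularM; [exact: openT|exact: (regular_comp me1 (@cell_fun_regular _ _ _ _ _ _))
    |exact: (regular_comp me1 r_reg)].
- have mh : morphism (fun x : stable_set X => h (val x)).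
    by apply: (cell_chart_morphism x0 b0); exact: (@stable_thin _ _ _ _ X).
  by apply: (@morphism_comp _ _ _ _ _ res mh); exact: pull_morphism.
- apply: morphism_into; pose Wf : set (tor K J') := [set u | f' u != 0].
  have mE : morphism (fun u : Wf => E (val u)).
    apply: morphism_tor => k.
    have m1 : morphism (fun u : Wf => e1 (val u)).
      exact: (morphism_comp (morphism_val _) me1).
    have s0 (u : Wf) : sol (val u) != 0 by have [] := f'P _ (set_valP u).
    apply: (regular_ext (fun u : Wf => esym (extE (val u) _ k (s0 u)))).
    case: insub => [k'|]; first exact: (morphism_tor_coord k' (morphism_val _)).
    apply: regularM; first exact: openT.
      by apply: regularN; [exact: openT|exact: (regular_comp m1 r_reg)].
    apply: regular_inv; first exact: (regular_comp m1 c_reg).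
    by move=> u; apply: c_neq0; have [] := f'P _ (set_valP u).
  have m1 : morphism (fun u : Wf => cell_inv (E (val u))).
    exact: (morphism_comp mE (cell_inv_morphism Bx0 b0)).
  by apply: morphism_ext m1 => u; rewrite hVE//; exact: (set_valP u).
- by move=> x; have [] := resE x.
- move=> x; apply: val_inj; have [f0 EE] := resE x.
  by rewrite hVE// EE; exact: cell_invK.
- move=> u fu; rewrite hVE//; have [_ s0 fE] := f'P u fu.
  by rewrite cell_chartK// res_ext.
- move=> s x; rewrite chart_sact; apply: torP => k.
  by rewrite pullE !tor_mulE pullE !monomE.
Qed.

End SolveCoordinate.

End CellToricChart.

Section HyperplaneChart.
Variables (K : numClosedFieldType) (n : nat) (B : {set {set 'I_(n + n)}}).
Local Notation b i j := ([set i; j]%SET \in B).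
Local Notation q x := (alt (coords x)).
Local Notation lft i := (lshift n i).
Local Notation rgt i := (rev_ord (lshift n i)).

Lemma hyperplane_alt (x : proj K (pairs (n + n))) :
  hyperplane K n x <-> \sum_(i < n) q x (lft i) (rgt i) = 0.
Proof.
rewrite /hyperplane /=; under eq_bigr => i _ do rewrite -alt_pair.
by [].
Qed.

Lemma star_pairP i : reflect (b (lft i) (rgt i))
  (i \in [set i : 'I_n | b (lft i) (rgt i)]%SET).
Proof. by rewrite inE; exact: idP. Qed.

Lemma star_count0 : star_count B = 0%N ->
  forall x, thin_cell K B x -> stable_set (sp_cell K B) x.
Proof.
move=> /eqP; rewrite cards_eq0 => /eqP B0 x Bx; split=> //.
apply/hyperplane_alt; rewrite big1// => i _; apply: (thin_cell_eq0 Bx).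
by apply/negP => /star_pairP; rewrite B0 finset.in_set0.
Qed.

(** The equation of the hyperplane would have a single non-zero term. *)
Lemma star_count1 : star_count B = 1%N -> ~ (stable_set (sp_cell K B) !=set0).
Proof.
move=> /eqP /cards1P [i Bi] [x [Bx /hyperplane_alt]].
rewrite (bigD1 i)//= big1 ?addr0 => [|j ji].
  by apply/eqP/(thin_cell_neq0 Bx)/star_pairP; rewrite Bi set11.
apply: (thin_cell_eq0 Bx); apply/negP => /star_pairP; rewrite Bi finset.in_set1.
by rewrite (negPf ji).
Qed.

Section TwoPairs.
Variables (i1 i2 : 'I_n) (x0 : proj K (pairs (n + n))).
Hypotheses (Bx0 : thin_cell K B x0) (b1 : b (lft i1) (rgt i1))
  (b2 : b (lft i2) (rgt i2)) (i12 : i1 != i2).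
Local Notation J := (cell_coord B x0 (lft i2) (rgt i2)).

(** The equation is linear in the scale of column [lft i1]: this column occurs
in the term of [i1] only, which does not vanish. *)
Lemma sp_cell_chart : stable_set (sp_cell K B) !=set0 ->
  (0 < #|J|)%N /\ toric_chart (sp_cell K B) #|J|.-1.
Proof.
move=> ne.
have li1 : lft i1 != lft i2 by rewrite (inj_eq (@lshift_inj _ _)).
have pj : cell_coord_pred B x0 (lft i2) (rgt i2) (inl (lft i1)).
  by apply/and3P; split; [exact: (nonloop Bx0 b2 b1)|exact: li1|exact: lshift_rev_neq].
pose j : J := Sub (inl (lft i1)) pj.
split; first by apply/card_gt0P; exists j.
pose minor (u : tor K J) i :=
  minor_of B x0 (lft i2) (rgt i2) (chart_scale u) (chart_slope u) (lft i) (rgt i).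
pose c u := chart_scale u (rgt i1) * @bracket K _ B x0 (lft i2) (rgt i2) u (lft i1) (rgt i1).
pose r u := \sum_(i < n | i != i1) minor u i.
have tj u : chart_scale u (lft i1) = val u j.
  rewrite /chart_scale; case: insubP => [k _ kE|]; last by rewrite pj.
  by congr (val u _); exact: val_inj.
have agt (u v : tor K J) i : (forall k, k != j -> val u k = val v k) ->
    i != lft i1 -> chart_scale u i = chart_scale v i.
  move=> uv ii; rewrite /chart_scale; case: insubP => // k _ kE; apply: uv.
  by apply: contraNneq ii => kj; move: kE; rewrite kj => -[->].
have agz (u v : tor K J) : (forall k, k != j -> val u k = val v k) ->
    chart_slope u =1 chart_slope v.
  move=> uv i; rewrite /chart_slope; case: insubP => // k _ kE; apply: uv.
  by apply/negP => /eqP kj; move: kE; rewrite kj.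
have agb (u v : tor K J) i k : (forall k, k != j -> val u k = val v k) ->
    bracket u i k = bracket v i k.
  by move=> /agz zz; rewrite /bracket !zz.
have rl (i k : 'I_n) : rgt i != lft k by rewrite eq_sym; exact: lshift_rev_neq.
apply: (@solved_toric_chart _ _ _ _ _ _ Bx0 b2 _ _ _ _ (sp_torus_param K n) _ j c r
  (hyperplane K n)) => //.
- apply: regularM; [exact: openT|exact: chart_scale_regular|exact: bracket_regular].
- by apply: regular_sum => [|i _]; [exact: openT|exact: cell_minor_regular].
- by move=> u v uv; rewrite /c (agt u v)// (agb u v).
- move=> u v uv; apply: eq_bigr => i ii; rewrite /minor !cell_minorE.
  by rewrite (agb u v)// !(agt u v)// (inj_eq (@lshift_inj _ _)).
- by move=> u v uv; apply: eq_bigr => ik _; exact: agb.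
- move=> u /prodf_neq0 fu; rewrite mulf_neq0 ?chart_scale_neq0//.
  exact: (fu (lft i1, rgt i1)).
- move=> x Bx; set u := cell_chart _ _ _ _ x.
  have -> : c u * val u j + r u = \sum_(i < n) minor u i.
    rewrite [RHS](bigD1 i1)//= /minor cell_minorE tj; congr (_ + _).
    by rewrite mulrC mulrA.
  have q0 := thin_cell_neq0 Bx b2.
  rewrite hyperplane_alt /minor.
  under [X in _ <-> X = 0]eq_bigr => i _ do rewrite (cell_minor_chart Bx0 b2 _ _ Bx).
  rewrite -mulr_suml; split=> [->|/eqP]; first by rewrite mul0r.
  by rewrite mulf_eq0 invr_eq0 (negPf q0) orbF => /eqP.
Qed.

End TwoPairs.

(** The charts of the cell and of its section are taken with respect to the same
basis, so that their ranks can be compared. *)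
Theorem sp_cell_quotient : stable_set (sp_cell K B) !=set0 ->
  [/\ variety (orbit_space (sp_cell K B)),
      categorical_quotient (qact (sp_cell K B)) (orbit_map (sp_cell K B)),
      fibration (qmul : quot_torus (sp_torus K n) B -> _ -> _)
        (qact (sp_cell K B)) (orbit_map (sp_cell K B)) &
      exists dMH dM dT' dT : nat,
        [/\ has_dim (orbit_space (sp_cell K B)) dMH,
            has_dim (orbit_space (full_cell K B)) dM,
            has_dim (quot_torus (full_torus K (n + n)) B) dT' &
            has_dim (quot_torus (sp_torus K n) B) dT] /\
        (star_count B = 0%N -> (dMH + dT = dM + dT')%N) /\
        ((2 <= star_count B)%N -> (dMH + dT).+1 = (dM + dT')%N)].
Proof.
move=> ne; have [x0 [Bx0 _]] := ne.
have [i0 [j0 b0]] : exists i j, b i j.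
  have [ij x0ij] := coords_neq0 x0; exists (val ij).1, (val ij).2.
  by rewrite -(thin_cellP Bx0) alt_pair.
have stabT (S : subtorus K (n + n)) (X : stable_subset S B) s x :
    subtorus_set S s -> stable_set X x -> tact s x = x -> stab B s.
  by move=> _ /(@stable_thin _ _ _ _ X) Bx; exact: (stab_of_fixed b0 Bx).
have full k l (bkl : b k l) : exists dM dT',
    [/\ has_dim (orbit_space (full_cell K B)) dM,
        has_dim (quot_torus (full_torus K (n + n)) B) dT' &
        (dM + dT' = #|cell_coord B x0 k l|)%N].
  have ch := cell_toric_chart Bx0 bkl (full_torus_param K (n + n))
    (X := full_cell K B) (fun x Bx => Bx).
  have [|_ _ _ //] := toric_chart_quotient ch _ (@stabT _ _).
  by exists x0.
have [c0|] := eqVneq (star_count B) 0%N.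
  have ch := cell_toric_chart Bx0 b0 (sp_torus_param K n) (star_count0 c0).
  have [v cq fib [dQ [dT [hQ hT QT]]]] := toric_chart_quotient ch ne (@stabT _ _).
  have [dM [dT' [hM hT' MT]]] := full _ _ b0.
  split=> //; exists dQ, dM, dT', dT; split=> //; split; first by rewrite QT MT.
  by rewrite c0.
have [c1|c1 c0] := eqVneq (star_count B) 1%N; first by case: (star_count1 c1).
have c2 : (1 < star_count B)%N by case: (star_count B) c0 c1 => [|[]].
have /card_gt1P [i1 [i2 [/star_pairP b1 /star_pairP b2 i12]]] := c2.
have [J0 ch] := sp_cell_chart Bx0 b1 b2 i12 ne.
have [v cq fib [dQ [dT [hQ hT QT]]]] := toric_chart_quotient ch ne (@stabT _ _).
have [dM [dT' [hM hT' MT]]] := full _ _ b2.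
split=> //; exists dQ, dM, dT', dT; split=> //; split=> [E|_].
  by rewrite E in c2.
by rewrite QT MT prednK.
Qed.

End HyperplaneChart.

Local Close Scope quotient_scope.

Theorem theorem3p12 (R : realType) (n : nat) (hn : (2 <= n)%N)
    (M : matroid 'I_(n + n)) (hM : has_rank M 2)
    (hne : (thin_cell R[i] (bases M) `&` hyperplane R[i] n) !=set0) :
  let G_M := full_cell R[i] (bases M) in
  let G_MH := sp_cell R[i] (bases M) in
  let T'_M := quot_torus (full_torus R[i] (n + n)) (bases M) in
  let T_M := quot_torus (sp_torus R[i] n) (bases M) in
  [/\ variety (orbit_space G_MH),
      categorical_quotient (qact G_MH) (orbit_map G_MH),
      fibration (qmul : T_M -> T_M -> T_M) (qact G_MH) (orbit_map G_MH) &
      exists dMH dM dT' dT : nat,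
        [/\ has_dim (orbit_space G_MH) dMH,
            has_dim (orbit_space G_M) dM,
            has_dim T'_M dT' &
            has_dim T_M dT] /\
        (star_count (bases M) = 0%N ->
           dMH%:Z = dM%:Z + dT'%:Z - dT%:Z) /\
        ((2 <= star_count (bases M))%N ->
           dMH%:Z = dM%:Z - 1 + dT'%:Z - dT%:Z)].
Proof.
move=> G_MH T'_M T_M.
have [v cq fib [dMH [dM [dT' [dT [dims [H0 H2]]]]]]] :=
  @sp_cell_quotient R[i] n (bases M) hne.
split=> //; exists dMH, dM, dT', dT; split=> //; split=> [/H0|/H2] E.
  by apply/eqP; rewrite eq_sym subr_eq -!PoszD E.
by apply/eqP; rewrite eq_sym subr_eq addrAC subr_eq -!PoszD -E addn1.
Qed.
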